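(* Let $(M,g)$ be a compact $m$-dimensional manifold with smooth Riemannian metric $g$, and let $N\subset M$ be a compact submanifold of dimension $n$ with $m\ge n+2$, such that the metric $g$ can be diagonalized near $N$ (in the sense defined in the context). Choose local coordinates $(x_1,\dots,x_{m-n},y_1,\dots,y_n)$ in a neighborhood of $N$ so that $$g=\begin{pmatrix} g_1 & 0\\ 0 & g_2\end{pmatrix}$$ in this neighborhood. Let $\tilde g$ be another smooth regular Riemannian metric on $M\setminus N$ such that $$\tilde g=\begin{pmatrix} f^2 g_1 & 0\\ 0 & g_2\end{pmatrix}$$ in a neighborhood of $N$, where $f\in C^\infty(M\setminus N)$. If $m=2$, assume that $f\in L^{2+\epsilon}_g(M)$ for some $\epsilon\in(0,\infty)$. If $m\ge 3$, assume that $\inf(f)>0$ and $f\in L_g^{(m(m-n)/2)+\epsilon}(M)$ for some $\epsilon\in(0,\infty)$. Then the Sobolev space $W^{1,2}_{\tilde g}(M\setminus N)$ with respect to $\tilde g$ is compactly included in $L^2_{\tilde g}(M\setminus N)$.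
   Context: The metric $g$ ''can be diagonalized near $N$'' means: in a neighborhood of $N$ there exist local coordinates $(x_1,\dots,x_{m-n},y_1,\dots,y_n)$, where $(0,\dots,0,y_1,\dots,y_n)$ are coordinates for $N$, such that $(dx_1,\dots,dx_{m-n},dy_1,\dots,dy_n)$ is globally defined in some open neighborhood of $N$ and such that $g$ is written in block form $g=\begin{pmatrix} g_1&0\\0&g_2\end{pmatrix}$, where $g_1$ is an $(m-n)\times(m-n)$ positive definite matrix and $g_2$ is an $n\times n$ positive definite matrix. (The matrices are with respect to $dx_1,\dots,dx_{m-n},dy_1,\dots,dy_n$.) $L^p_g$ and $L^p_{\tilde g}$ denote the $L^p$ spaces with respect to the Riemannian measures of $g$ and $\tilde g$. $W^{1,2}_{\tilde g}(M\setminus N)$ is the Sobolev space of functions $u\in L^2_{\tilde g}(M\setminus N)$ whose weak gradient is in $L^2$ with respect to $\tilde g$, with norm $\|u\|^2_{W^{1,2}_{\tilde g}}=\int u^2\,d\tilde A+\int|\tilde\nabla u|^2_{\tilde g}\,d\tilde A$, where $d\tilde A$ and $\tilde\nabla$ are the volume measure and gradient of $\tilde g$. *)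

(* Defs.v *)
From HB Require Import structures.
From mathcomp Require Import all_boot all_order all_algebra.
From mathcomp Require Import all_classical all_reals all_analysis.

Set Implicit Arguments.
Unset Strict Implicit.
Unset Printing Implicit Defensive.

Import Order.TTheory GRing.Theory Num.Theory.
Import numFieldNormedType.Exports.

Local Open Scope classical_set_scope.
Local Open Scope ring_scope.

Definition rV_display : measure_display -> measure_display.
Proof. exact. Qed.

(* The sigma-algebra on row vectors generated by the coordinates; for R^n this
   is the Borel sigma-algebra. *)
Section measurable_rV.
Context {R : realType} (n : nat).

Let coor (i : 'I_n) (v : 'rV[R]_n) : measurableTypeR R := v ord0 i.

Let rV_set0 : g_sigma_preimage coor set0.
Proof. exact: sigma_algebra0. Qed.

Let rV_setC A : g_sigma_preimage coor A -> g_sigma_preimage coor (~` A).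
Proof. exact: sigma_algebraC. Qed.

Let rV_bigcup (F : (set 'rV[R]_n)^nat) :
  (forall i, g_sigma_preimage coor (F i)) ->
  g_sigma_preimage coor (\bigcup_i F i).
Proof. exact: sigma_algebra_bigcup. Qed.

HB.instance Definition _ := @isMeasurable.Build
  (rV_display (R.-ocitv.-measurable).-sigma)
  'rV[R]_n (g_sigma_preimage coor) rV_set0 rV_setC rV_bigcup.

Lemma measurable_coor (i : 'I_n) : measurable_fun [set: 'rV[R]_n] (coor i).
Proof.
move=> _ Y mY; rewrite setTI; apply: sub_sigma_algebra => /=.
rewrite -bigcup_seq/=; exists i => /=; first by rewrite mem_index_enum.
by exists Y => //; rewrite setTI.
Qed.

Lemma measurable_fun_coor d (T : measurableType d) (f : T -> 'rV[R]_n) :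
  (forall i, measurable_fun [set: T] (coor i \o f)) ->
  measurable_fun [set: T] f.
Proof.
move=> mf; apply: (measurability (\big[setU/set0]_(i < n)
  preimage_set_system setT (coor i) measurable)) => //.
move=> _ [B + <-]; rewrite -bigcup_seq => -[i _ [Y mY <-]].
by have := mf i measurableT Y mY; rewrite !setTI.
Qed.

End measurable_rV.

Definition rV_cons {R : realType} {n} (p : 'rV[R]_n * measurableTypeR R) :
  'rV[R]_n.+1 := row_mx (p.2 : R)%:M p.1 : 'rV[R]_(1 + n).

Lemma measurable_rV_cons {R : realType} n :
  measurable_fun setT (@rV_cons R n).
Proof.
apply: measurable_fun_coor => i.
rewrite (_ : _ \o _ = fun p : 'rV[R]_n * measurableTypeR R =>
  match fintype.split (i : 'I_(1 + n)) with
  | inl _ => p.2 | inr j => (p.1 : 'rV[R]_n) ord0 j end).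
  case: (fintype.split _) => [_|j]; first exact: measurable_snd.
  by apply: measurableT_comp (measurable_coor j) _; exact: measurable_fst.
apply/funext => p /=; rewrite /rV_cons mxE.
by case: (fintype.split _) => // j; rewrite !ord1 mxE.
Qed.

Fixpoint lebesgue_rV {R : realType} n : {measure set 'rV[R]_n -> \bar R} :=
  match n with
  | 0 => dirac (0 : 'rV[R]_0)
  | k.+1 => measure_function_pushforward__canonical__measure_function_Measure
      (lebesgue_rV k \x (@lebesgue_measure R))%E (@measurable_rV_cons R k)
  end.

Section euclidean.
Context {R : realType} {m : nat}.
Implicit Types (f h w : 'rV[R]_m -> R) (O : set 'rV[R]_m).

Definition partial (i : 'I_m) f : 'rV[R]_m -> R :=
  fun x => 'D_(delta_mx ord0 i) (f : 'rV[R]_m -> R^o) x.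

Definition iter_partial (s : seq 'I_m) f : 'rV[R]_m -> R := foldr partial f s.

Definition smooth_on O f : Prop :=
  forall (s : seq 'I_m) x, O x ->
    {for x, continuous (iter_partial s f)} /\
    forall i, derivable (iter_partial s f : 'rV[R]_m -> R^o) x (delta_mx ord0 i).

Definition smooth_map_on k O (F : 'rV[R]_m -> 'rV[R]_k) : Prop :=
  forall j : 'I_k, smooth_on O (fun x => F x ord0 j).

Definition test_function O (phi : 'rV[R]_m -> R) : Prop :=
  smooth_on setT phi /\
  exists K, [/\ compact K, K `<=` O & forall x, ~ K x -> phi x = 0].

Definition locally_integrable_on O f : Prop :=
  forall K, compact K -> K `<=` O ->
    (lebesgue_rV m).-integrable K (EFin \o f).

Definition weak_partial O (i : 'I_m) h w : Prop :=
  [/\ locally_integrable_on O h, locally_integrable_on O w &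
    forall phi, test_function O phi ->
      (\int[lebesgue_rV m]_(x in O) (h x * partial i phi x))%R =
      - (\int[lebesgue_rV m]_(x in O) (w x * phi x))%R].

Definition posdefmx (A : 'M[R]_m) : Prop :=
  A^T = A /\ forall v : 'rV[R]_m, v != 0 -> 0 < (v *m A *m v^T) ord0 ord0.

End euclidean.

(* Only the values of [cmap] on [cdom] and of [cinv] on [cmap @` cdom] are
   meaningful. *)
Record chart (R : realType) (M : ptopologicalType) (m : nat) := Chart {
  cdom : set M ;
  cmap : M -> 'rV[R]_m ;
  cinv : 'rV[R]_m -> M ;
  cdom_open : open cdom ;
  cimg_open : open (cmap @` cdom) ;
  cmapK : forall p, cdom p -> cinv (cmap p) = p ;
  cmap_cont : {within cdom, continuous cmap} ;
  cinv_cont : {within cmap @` cdom, continuous cinv} }.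

Definition smooth_transition (R : realType) (M : ptopologicalType) (m : nat)
    (c c' : chart R M m) : Prop :=
  smooth_map_on (cmap c @` (cdom c `&` cdom c')) (cmap c' \o cinv c).

(* A maximal smooth atlas, with a preferred chart at each point: the tangent
   space at p is identified with R^m (row vectors) through [chart_at p], so
   that vector fields and metrics are functions on M. Since the neighbouring
   preferred charts are unrelated, regularity is always tested in the
   coordinates of a chart of the atlas, see [metric_coord]. *)
Record smooth_structure (R : realType) (M : ptopologicalType) (m : nat) := {
  atlas : set (chart R M m) ;
  chart_at : M -> chart R M m ;
  chart_at_atlas : forall p, atlas (chart_at p) ;
  chart_at_dom : forall p, cdom (chart_at p) p ;
  atlas_compat : forall c c', atlas c -> atlas c' -> smooth_transition c c' ;
  atlas_max : forall c,
    (forall c', atlas c' -> smooth_transition c c' /\ smooth_transition c' c) ->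
    atlas c }.

Definition borel (M : ptopologicalType) := g_sigma_algebraType (@open M).

Section manifold.
Context {R : realType} {M : ptopologicalType} {m : nat}.
Variable S : smooth_structure R M m.
Implicit Types (c : chart R M m) (U N : set M) (p q : M) (u : M -> R).
Implicit Types (g : M -> 'M[R]_m) (X : M -> 'rV[R]_m).

Definition cimg c U : set 'rV[R]_m := cmap c @` (cdom c `&` U).

(* The i-th row is the coordinate vector field d/dc_i at p. *)
Definition frame c p : 'M[R]_m :=
  jacobian (cmap (chart_at S p) \o cinv c) (cmap c p).

(* The j-th column is the differential dc_j at p. *)
Definition coframe c p : 'M[R]_m :=
  jacobian (cmap c \o cinv (chart_at S p)) (cmap (chart_at S p) p).

Definition smooth_fun U u : Prop :=
  forall c, atlas S c -> smooth_on (cimg c U) (u \o cinv c).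

(* The matrix of g in the coordinates of c:
   its (i, j) entry is g(d/dc_i, d/dc_j). *)
Definition metric_coord g c p : 'M[R]_m :=
  frame c p *m g p *m (frame c p)^T.

Definition riemannian_metric U g : Prop :=
  (forall p, U p -> posdefmx (g p)) /\
  forall c, atlas S c -> forall i j,
    smooth_on (cimg c U) (fun x => metric_coord g c (cinv c x) i j).

(* mu is the Riemannian measure of the metric g on U, seen as a measure on M
   that does not charge the complement of U. These conditions determine mu. *)
Definition riemannian_measure U g (mu : {measure set (borel M) -> \bar R}) :=
  mu (~` U) = 0%E /\
  forall c (B : set M), atlas S c ->
    measurable (B : set (borel M)) -> B `<=` cdom c `&` U ->
    mu B = (\int[lebesgue_rV m]_(x in cmap c @` B)
              (Num.sqrt (\det (metric_coord g c (cinv c x))))%:E)%E.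

Definition embedded_at (n : nat) N c : Prop :=
  forall q, cdom c q ->
    N q <-> (forall i : 'I_m, (i < m - n)%N -> cmap c q ord0 i = 0).

Definition submanifold (n : nat) N : Prop :=
  forall p, N p -> exists c, [/\ atlas S c, cdom c p & embedded_at n N c].

(* D is a family of local coordinates (x_1, .., x_(m-n), y_1, .., y_n) defined
   on a neighbourhood of N, in which N is {x = 0}, whose differentials agree on
   overlaps (hence are globally defined on the neighbourhood), and in which g
   is block diagonal. The diagonal blocks of a positive definite matrix are
   positive definite. *)
Definition diagonalizes (n : nat) N g (D : set (chart R M m)) : Prop :=
  [/\ D `<=` atlas S,
      N `<=` \bigcup_(c in D) cdom c,
      forall c, D c -> embedded_at n N c,
      forall c c' p, D c -> D c' -> cdom c p -> cdom c' p ->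
        coframe c p = coframe c' p &
      forall c p (i j : 'I_m), D c -> cdom c p ->
        (i < m - n)%N != (j < m - n)%N -> metric_coord g c p i j = 0].

Section function_spaces.
Variables (U : set M) (mu : {measure set (borel M) -> \bar R}).

Definition Lp (p : R) : set (M -> R) :=
  [set u | (u \_ U : borel M -> R) \in Lfun mu p%:E].

Definition Lp_norm (p : R) u : \bar R :=
  ('N[mu]_p%:E [EFin \o (u \_ U : borel M -> R)])%E.

Definition normsq g X p : R := (X p *m g p *m (X p)^T) ord0 ord0.

(* In the coordinates of any chart c, the weak derivative of u in the direction
   d/dc_i is g(X, d/dc_i). *)
Definition is_weak_gradient g u X : Prop :=
  forall c, atlas S c -> forall i,
    weak_partial (cimg c U) i (u \o cinv c)
      (fun x => (X (cinv c x) *m g (cinv c x) *m (frame c (cinv c x))^T) ord0 i).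

(* [X] is unique up to a null set when it exists. *)
Definition weak_gradient g u : M -> 'rV[R]_m :=
  xget (fun=> 0) [set X | is_weak_gradient g u X].

Definition gradient_energy g u : \bar R :=
  (\int[mu]_(p in U : set (borel M)) (normsq g (weak_gradient g u) p)%:E)%E.

Definition W12 g : set (M -> R) :=
  [set u | [/\ Lp 2 u, exists X, is_weak_gradient g u X &
               (gradient_energy g u < +oo)%E]].

Definition W12_norm g u : \bar R :=
  ((\int[mu]_(p in U : set (borel M)) (u p ^+ 2)%:E + gradient_energy g u)
     `^ 2^-1)%E.

End function_spaces.
End manifold.

Definition compactly_included (R : realType) (T : Type)
    (V : set (T -> R)) (normV : (T -> R) -> \bar R)
    (W : set (T -> R)) (normW : (T -> R) -> \bar R) : Prop :=
  V `<=` W /\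
  forall (u : nat -> T -> R) (C : R),
    (forall k, V (u k)) -> (forall k, (normV (u k) <= C%:E)%E) ->
    exists s : nat -> nat, {homo s : i j / (i < j)%N} /\
      exists2 v, W v & normW (u (s k) \- v) @[k --> \oo] --> 0%E.

(* The block matrix (a *: A11, A12; A21, A22), with A11 of size k. *)
Definition scale_block (R : realType) m (k : nat) (a : R) (A : 'M[R]_m) :
    'M[R]_m :=
  \matrix_(i, j) if (i < k)%N && (j < k)%N then a * A i j else A i j.

(* Main.v *)
(* No regularity across [N] is needed. Since [m - n >= 2], the first coordinate of
   a chart that diagonalizes [g] vanishes on [N]; near a point of [N] the set
   [~` N] is therefore, up to the null hyperplane where it vanishes, covered by
   the images of two open boxes [Q], and away from [N] one box suffices.

   On such a box the Riemannian density of the metric is [rho = |f|^k sqrt(det g)]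
   with [k = m - n]. The hypothesis on [f] says that [rho] is in [L^p] for some
   [p > m / 2], and the energy dominates [\int_Q |Du|^2 dx], because every
   diagonal coefficient of the metric is at most [C rho]. It remains to see that
   a sequence bounded for [\int_Q |Du|^2 dx + \int_Q u^2 rho dx] is precompact in
   [L^2(Q, rho dx)]. Bisect [Q] repeatedly, in the coordinate directions in turn.
   Testing the weak derivative against a tent function bounds the difference of
   the averages of [u] over the two halves of a box of generation [t] by the
   energy in that box; summed over the boxes with their [rho]-masses, which are
   [O(vol ^ (1 - 1/p))], this gives a geometric series because [p > m / 2].
   So [u] is uniformly close in [L^2(rho dx)] to its averages of generation [J],
   and these range over a bounded set of a finite-dimensional space.

   Convergence along an ultrafilter on the indices lets the finitely many boxes be
   treated simultaneously; completeness of [L^2] then produces the limit. *)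
Require Import Defs.
From mathcomp Require Import all_boot all_order all_algebra.
From mathcomp Require Import all_classical all_reals all_analysis.
From mathcomp Require Import measurable_realfun ring lra zify.
Set Implicit Arguments.
Unset Strict Implicit.
Unset Printing Implicit Defensive.
Import Order.TTheory GRing.Theory Num.Theory.
Import numFieldNormedType.Exports.
Local Open Scope classical_set_scope.
Local Open Scope ring_scope.

(** * Smooth functions of compact support *)

(** The exponent m / 2 comes from scaling: at generation s, volumes are of order 2^-s and sides of
    order 2^(-s/m). The squared difference of averages is at most side^2 / vol times the local
    energy; multiplied by the mass, it carries the factor 2^(-s (2/m - 1/p)), which decays exactly
    when p > m / 2. As rho is |f|^k up to bounded factors, this asks for f in L^q with q > k m / 2.

    Bounding the metric by C rho takes f^2 <= C |f|^k for the scaled block and 1 <= C |f|^k for the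
    other one. If m >= 3 both follow from inf f > 0 and k >= 2; if m = 2 then k = 2, so the first is
    an equality and the other block is empty.

    Two obstacles shape the analysis on a box. The function u is bounded only in L^2(rho dx), is
    only locally integrable, and rho may degenerate at the boundary; so an unweighted L^2 bound
    comes first, from Poincare inequalities on smaller boxes and a middle box where rho is bounded
    below. And the averages must be shown to converge to u almost everywhere: the same series with
    weight 1 gives a limit, which has the integrals of u over all boxes of the bisection. *)

Definition flat {R : realType} (p : {poly R}) (t : R) : R :=
  if 0 < t then p.[t^-1] * expR (- t^-1) else 0.

(** A class closed under differentiation, so that smoothness needs no count of derivatives. The
    generators [flat p], t |-> p(1/t) exp(-1/t) extended by 0, are differentiated by changing [p].
    Closure under primitives serves the smoothed tents, which are built from primitives of bumps. *)
Inductive smooth1 {R : realType} : (R -> R) -> Prop :=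
| smooth1_flat p : smooth1 (flat p)
| smooth1_cst c : smooth1 (cst c)
| smooth1_add f g : smooth1 f -> smooth1 g -> smooth1 (f \+ g)
| smooth1_mul f g : smooth1 f -> smooth1 g -> smooth1 (f \* g)
| smooth1_affine f a b : smooth1 f -> smooth1 (fun x => f (a * x + b))
| smooth1_prim f F : smooth1 f -> (forall x : R, is_derive x (1 : R) F (f x)) -> smooth1 F.

Section flat.
Context {R : realType}.
Implicit Types (p : {poly R}) (f : R -> R) (t : R).

(** Horner induction on [p]: a factor 1/t costs one power of t, hence the induction hypothesis at
    [n.+1]; the constant term is controlled by exp(1/t) >= t^-(n+1) / (n+1)!. *)
Lemma flat_small p n :
  exists C, forall t, 0 < t -> t <= 1 -> `|flat p t| <= C * t ^+ n.
Proof.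
elim/poly_ind: p n => [|p c IH] n.
  exists 0 => t t0 _; rewrite /flat t0 horner0 mul0r normr0 mul0r //.
have [C HC] := IH n.+1.
exists (C + `|c| * (n.+1)`!%:R) => t t0 t1.
have tn0 : t != 0 by rewrite gt_eqF.
have -> : flat (p * 'X + c%:P) t = flat p t / t + c * expR (- t^-1).
  by rewrite /flat t0 !hornerE; field.
apply: (le_trans (ler_normD _ _)); rewrite mulrDl; apply: lerD.
  rewrite normrM normfV (gtr0_norm t0) ler_pdivrMr //.
  by rewrite -mulrA -exprSr; exact: HC.
rewrite normrM -mulrA ler_wpM2l// ger0_norm ?expR_ge0//.
rewrite expRN -[leRHS]invrK lef_pV2 ?posrE ?expR_gt0 ?invr_gt0 ?mulr_gt0//; last first.
  by rewrite exprn_gt0.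
have := @expR_ge1Dxn R t^-1 n; rewrite invr_ge0 (ltW t0) => /(_ isT).
apply: le_trans; rewrite invfM -exprVn.
apply: (@le_trans _ _ (t^-1 ^+ n.+1 / (n.+1)`!%:R)); last by rewrite lerDr.
rewrite mulrC ler_wpM2r ?invr_ge0 ?ler0n// exprSr ler_peMr ?exprn_ge0 ?invr_ge0 ?(ltW t0)//.
by rewrite -[1]invr1 lef_pV2 ?posrE.
Qed.

(** Only t = 0 is delicate: there [flat_small] with exponent 2 squeezes the difference quotient
    between multiples of |h|. *)
Lemma flat_derive p (x : R) :
  is_derive x (1 : R) (flat p) (flat ((p - p^`()) * 'X^2) x).
Proof.
have [x0|x0|->] := ltgtP x 0.
- rewrite /flat (lt_gtF x0).
  apply: (@near_eq_is_derive _ _ _ (cst 0)); rewrite ?oner_eq0//.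
    near=> y; rewrite ifF// lt_gtF//; near: y.
    exact: lt_nbhsl.
- have -> : flat ((p - p^`()) * 'X^2) x =
      (p.[x^-1] - p^`().[x^-1]) * x^-1 ^+ 2 * expR (- x^-1).
    by rewrite /flat x0 !hornerE.
  have xn0 : x != 0 by rewrite gt_eqF.
  apply: (@near_eq_is_derive _ _ _ (fun t => p.[t^-1] * expR (- t^-1))).
  + by near=> y; rewrite /flat ifT//; near: y; exact: lt_nbhsr.
  + have dV : is_derive x (1 : R) (fun t : R => t^-1) (- x ^- 2).
      have := is_deriveV xn0 (@is_derive_id R R x 1).
      by rewrite /GRing.scale/= mulr1.
    have dp : is_derive x (1 : R) (fun t => p.[t^-1]) (- x ^- 2 * p^`().[x^-1]).
      by rewrite mulrC; apply: (@is_derive1_comp _ (horner p) (fun t => t^-1)).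
    have de : is_derive x (1 : R) (fun t : R => expR (- t^-1)) (x ^- 2 * expR (- x^-1)).
      have dN : is_derive x (1 : R) (fun t : R => - t^-1) (x ^- 2).
        by rewrite -[x ^- 2]opprK; exact: is_deriveN.
      by rewrite mulrC; exact: (@is_derive1_comp _ expR (fun t => - t^-1)).
    apply: is_derive_eq; rewrite /GRing.scale/=; field.
    by rewrite xn0.
- have -> : flat ((p - p^`()) * 'X^2) 0 = 0 by rewrite /flat ltxx.
  have [C HC] := flat_small p 2.
  have bnd (h : R) : h != 0 -> `|h| <= 1 ->
      - (`|C| * `|h|) <= h^-1 *: (flat p (h *: (1 : R) + 0) - flat p 0) <= `|C| * `|h|.
    move=> hn0 h1; rewrite -ler_norml {2}/flat ltxx subr0 addr0.
    rewrite /GRing.scale/= mulr1 normrM normfV ler_pdivrMl ?normr_gt0//.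
    have [h0|h0] := ltP 0 h; last by rewrite /flat ltNge h0/= normr0 !mulr_ge0.
    move: h1; rewrite (gtr0_norm h0) => h1; apply: (le_trans (HC h h0 h1)).
    by rewrite [leRHS]mulrCA -expr2 ler_wpM2r ?sqr_ge0 ?ler_norm.
  have cv : h^-1 *: (flat p (h *: 1 + 0) - flat p 0) @[h --> 0^'] --> (0 : R).
    apply: (@squeeze_cvgr _ _ _ _ (fun h => - (`|C| * `|h|)) (fun h => `|C| * `|h|)).
    + near=> h; apply: bnd; first by near: h; exact: nbhs_dnbhs_neq.
      by near: h; exact: dnbhs0_le.
    + rewrite -[X in _ --> X]oppr0; apply: cvgN; rewrite -[X in _ --> X](mulr0 `|C|).
      apply: cvgM; first exact: cvg_cst.
      rewrite -[X in _ --> X](@normr0 R R); apply: cvg_norm; exact: cvg_within.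
    + rewrite -[X in _ --> X](mulr0 `|C|).
      apply: cvgM; first exact: cvg_cst.
      rewrite -[X in _ --> X](@normr0 R R); apply: cvg_norm; exact: cvg_within.
  split.
    by apply/cvg_ex; exists 0.
  exact: (cvg_lim _ cv).
Unshelve. all: by end_near. Qed.

Lemma smooth1_derive f : smooth1 f -> exists2 f', smooth1 f' & forall x : R, is_derive x (1 : R) f (f' x).
Proof.
elim=> {f} [p|c|f g sf [f' sf' df] sg [g' sg' dg]|f g sf [f' sf' df] sg [g' sg' dg]
  |f a b sf [f' sf' df]|f F sf [f' sf' df] dF].
- by exists (flat ((p - p^`()) * 'X^2)) => [|x]; [exact: smooth1_flat|exact: flat_derive].
- by exists (cst 0) => [|x]; [exact: smooth1_cst|exact: is_derive_cst].
- by exists (f' \+ g') => [|x]; [exact: smooth1_add|exact: is_deriveD].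
- exists ((f \* g') \+ (g \* f')) => [|x].
    by apply: smooth1_add; apply: smooth1_mul.
  exact: is_deriveM.
- exists (cst a \* (fun x => f' (a * x + b))) => [|x].
    by apply: smooth1_mul; [exact: smooth1_cst|exact: smooth1_affine].
  rewrite /=.
  have da : is_derive x (1 : R) (fun x => a * x + b) a.
    apply: is_derive_eq; rewrite /GRing.scale/=; ring.
  rewrite mulrC; by apply: (@is_derive1_comp _ f (fun x => a * x + b)).
- by exists f.
Qed.

Lemma smooth1_continuous f : smooth1 f -> continuous f.
Proof.
move=> /smooth1_derive[f' _ df] x.
by apply: differentiable_continuous; apply/derivable1_diffP; case: (df x).
Qed.

Lemma smooth1_primitive f a : smooth1 f -> (forall x, x <= a -> f x = 0) ->
  exists F, [/\ smooth1 F, forall x : R, is_derive x (1 : R) F (f x) & forall x, x <= a -> F x = 0].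
Proof.
move=> sf f0; have cf := smooth1_continuous sf.
(* Integration starts strictly before [a]: the fundamental theorem of calculus covers x > a - 1, and
   around any other point F vanishes identically. *)
pose F x := \int[lebesgue_measure]_(t in `[(a - 1)%R, x]) f t.
have Fa x : x <= a -> F x = 0.
  move=> xa; rewrite /F (eq_Rintegral _ (g := cst 0)) ?Rintegral_cst//= ?mul0r//.
  move=> y; rewrite inE/= in_itv/= => /andP[_ yx]; rewrite f0//.
  exact: le_trans yx xa.
have dF x : is_derive x (1 : R) F (f x).
  have [ax|xa] := ltP (a - 1) x.
    have [] := @continuous_FTC1_closed R f (a - 1) x (x + 1) _ _ _ (cf x).
    - by rewrite ltrDl ltr01.
    - apply: continuous_compact_integrable; first exact: segment_compact.
      exact: continuous_subspaceT.
    - exact: ax.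
    move=> d1 d2.
    apply: DeriveDef; first exact: d1.
    by rewrite -derive1E; exact: d2.
  have -> : f x = 0 by rewrite f0//; lra.
  apply: (@near_eq_is_derive _ _ _ (cst 0)); rewrite ?oner_eq0//.
  near=> y; rewrite Fa//; near: y.
  by have: x < a by [lra]; move=> /lt_nbhsl; apply: filterS => y /ltW.
by exists F; split => //; exact: smooth1_prim dF.
Unshelve. all: by end_near. Qed.


Lemma flat_ge0_le1 t : 0 <= flat 1 t <= 1.
Proof.
rewrite /flat; case: ifP => t0; rewrite ?lexx ?ler01//.
by rewrite hornerC mul1r expR_ge0/= -expR0 ler_expR oppr_le0 invr_ge0 ltW.
Qed.

(** An approximation from inside of the indicator of the open interval between [a] and [b]: it
    vanishes within 1/(k+1) of the endpoints and beyond, and tends to 1 inside since exp(-1/s) tends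
    to 1 as s grows. *)
Definition bump (k : nat) (a b x : R) : R :=
  flat 1 (k.+1%:R * (x - a) - 1) * flat 1 (k.+1%:R * (b - x) - 1).

Lemma bump_smooth1 k (a b : R) : smooth1 (bump k a b).
Proof.
rewrite (_ : bump k a b =
  (fun x => flat 1 (k.+1%:R * x + (- k.+1%:R * a - 1))) \*
  (fun x => flat 1 (- k.+1%:R * x + (k.+1%:R * b - 1)))).
  by apply: smooth1_mul; apply: smooth1_affine; exact: smooth1_flat.
by apply/funext => x /=; rewrite /bump; congr (flat _ _ * flat _ _); ring.
Qed.

Lemma bump_ge0_le1 k (a b x : R) : 0 <= bump k a b x <= 1.
Proof.
have /andP[p0 p1] := flat_ge0_le1 (k.+1%:R * (x - a) - 1).
have /andP[q0 q1] := flat_ge0_le1 (k.+1%:R * (b - x) - 1).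
by rewrite /bump mulr_ge0//= mulr_ile1.
Qed.

Lemma bump_left k (a b x : R) : x <= a + k.+1%:R^-1 -> bump k a b x = 0.
Proof.
move=> xa; rewrite /bump /flat ifF ?mul0r//; apply/negbTE; rewrite -leNgt.
by rewrite subr_le0 mulrC -ler_pdivlMr// mul1r lerBlDl.
Qed.

Lemma bump_right k (a b x : R) : b - k.+1%:R^-1 <= x -> bump k a b x = 0.
Proof.
move=> xa; rewrite /bump mulrC /flat ifF ?mul0r//; apply/negbTE; rewrite -leNgt.
by rewrite subr_le0 mulrC -ler_pdivlMr// mul1r lerBlDr addrC -lerBlDr.
Qed.

Lemma nbhs_infty_gtrS (r : R) : \forall k \near \oo, r < k.+1%:R.
Proof.
near=> k; apply: (@lt_trans _ _ k%:R); last by rewrite ltr_nat.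
near: k; exact: nbhs_infty_gtr.
Unshelve. all: by end_near. Qed.

Lemma flat_cvg1 (c : R) : 0 < c -> flat 1 (k.+1%:R * c - 1) @[k --> \oo] --> (1 : R).
Proof.
move=> c0.
have cvV : (k.+1%:R * c - 1)^-1 @[k --> \oo] --> (0 : R).
  apply/gtr0_cvgV0.
    near=> k; rewrite subr_gt0 -ltr_pdivrMr// mul1r.
    near: k; exact: nbhs_infty_gtrS.
  apply/cvgryPge => A; near=> k.
  rewrite lerBrDr -ler_pdivrMr//.
  by apply/ltW; near: k; exact: nbhs_infty_gtrS.
have : expR (- (k.+1%:R * c - 1)^-1) @[k --> \oo] --> (1 : R).
  rewrite -[X in _ --> X]expR0; apply: continuous_cvg; first exact: continuous_expR.
  by rewrite -[X in _ --> X]oppr0; exact: cvgN.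
apply: cvg_trans; apply: near_eq_cvg; near=> k.
rewrite /flat hornerC mul1r ifT// subr_gt0 -ltr_pdivrMr// mul1r.
near: k; exact: nbhs_infty_gtrS.
Unshelve. all: by end_near. Qed.

Lemma bump_cvg (a b x : R) : bump k a b x @[k --> \oo] --> (\1_(`]a, b[) x : R).
Proof.
rewrite indicE; case: (boolP (x \in _)) => [|/negP]; rewrite inE/= in_itv/=.
  move=> /andP[ax xb]; rewrite -[X in _ --> X]mulr1.
  by apply: cvgM; apply: flat_cvg1; rewrite subr_gt0.
move=> /negP; rewrite negb_and -!leNgt => xab.
rewrite (_ : (fun k => bump k a b x) = cst 0); first exact: cvg_cst.
apply/funext => k; case/orP: xab => h.
  by rewrite bump_left// (le_trans h)// lerDl invr_ge0.
by rewrite bump_right// (le_trans _ h)// lerBlDr lerDl invr_ge0.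
Qed.

End flat.

(** Product test functions are enough here: a partial derivative replaces a single factor, so
    smoothness in several variables reduces to the one-variable class [smooth1]. *)
Definition tensor {R : realType} {m} (psi : 'I_m -> R -> R) : 'rV[R]_m -> R :=
  fun x => \prod_j psi j (x ord0 j).

Section tensor.
Context {R : realType} {m : nat}.
Implicit Types (psi : 'I_m -> R -> R) (O : set 'rV[R]_m).

Lemma tensor_continuous psi : (forall j, smooth1 (psi j)) -> continuous (tensor psi).
Proof.
move=> spsi; apply: (@continuous_big R 'I_m *%R 1 xpredT (@mul_continuous R) _ (index_enum _)
  (fun j (x : 'rV[R]_m) => psi j (x ord0 j))).
- move=> j _ x; apply: continuous_comp; first exact: coord_continuous.
  exact: smooth1_continuous.
Qed.

Lemma tensor_line psi i x h : tensor psi (h *: delta_mx ord0 i + x) =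
  (\prod_(j | j != i) psi j (x ord0 j)) * psi i (h + x ord0 i).
Proof.
rewrite /tensor (bigD1 i)//= mulrC; congr (_ * _).
  apply: eq_bigr => j ji; rewrite !mxE eqxx (negbTE ji)/= mulr0 add0r//.
by rewrite !mxE !eqxx/= mulr1.
Qed.

Lemma is_derive_tensor psi i (f' : R -> R) (x : 'rV[R]_m) :
  (forall t : R, is_derive t (1 : R) (psi i) (f' t)) ->
  is_derive x (delta_mx ord0 i) (tensor psi : 'rV[R]_m -> R^o)
    (tensor (fun j => if j == i then f' else psi j) x).
Proof.
move=> dpsi; have [dp ep] := dpsi (x ord0 i).
have cv : h^-1 *: ((tensor psi (h *: delta_mx ord0 i + x) - tensor psi x) : R^o)
    @[h --> 0^'] --> (tensor (fun j => if j == i then f' else psi j) x : R^o).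
  have -> : tensor (fun j => if j == i then f' else psi j) x =
      (\prod_(j | j != i) psi j (x ord0 j)) * f' (x ord0 i).
    rewrite /tensor (bigD1 i)//= eqxx mulrC; congr (_ * _).
    by apply: eq_bigr => j ji; rewrite (negbTE ji).
  rewrite [X in X @ _](_ : _ = fun h => (\prod_(j | j != i) psi j (x ord0 j)) *
      (h^-1 *: (psi i (h *: (1 : R) + x ord0 i) - psi i (x ord0 i)))); last first.
    apply/funext => h; have := tensor_line psi i x 0.
    rewrite scale0r !add0r => ->; rewrite tensor_line -mulrBr.
    by rewrite /GRing.scale/= mulr1 mulrCA.
  by apply: cvgM; [exact: cvg_cst|rewrite -ep; exact: dp].
split; first by apply/cvg_ex; eexists; exact: cv.
exact: (cvg_lim _ cv).
Qed.

Lemma iter_partial_tensor psi (s : seq 'I_m) : (forall j, smooth1 (psi j)) ->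
  exists2 psi', (forall j, smooth1 (psi' j)) & iter_partial s (tensor psi) = tensor psi'.
Proof.
move=> spsi; elim: s => [|i s [psi' sp' e]]; first by exists psi.
have [g sg dg] := smooth1_derive (sp' i).
exists (fun j => if j == i then g else psi' j).
  by move=> j; case: ifP.
rewrite /= e; apply/funext => x; rewrite /partial.
by have [_ ->] := is_derive_tensor x dg.
Qed.

Lemma smooth_tensor psi O : (forall j, smooth1 (psi j)) -> smooth_on O (tensor psi).
Proof.
move=> spsi s x _; have [psi' sp' ->] := iter_partial_tensor s spsi; split.
  exact: tensor_continuous.
by move=> i; have [g _ dg] := smooth1_derive (sp' i); case: (is_derive_tensor x dg).
Qed.

Lemma tensor_test_function psi O (a b : 'I_m -> R) : (forall j, smooth1 (psi j)) ->
  (forall j t, ~~ (a j <= t <= b j) -> psi j t = 0) ->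
  [set x : 'rV[R]_m | forall j, `[a j, b j]%classic (x ord0 j)] `<=` O ->
  test_function O (tensor psi).
Proof.
move=> spsi psi0 abO; split; first exact: smooth_tensor.
exists [set x : 'rV[R]_m | forall j, `[a j, b j]%classic (x ord0 j)]; split=> //.
  apply: (@rV_compact R m (fun j => `[a j, b j]%classic)) => j.
  exact: segment_compact.
move=> x /existsNP[j /=]; rewrite in_itv/= => /negP abj.
by rewrite /tensor (bigD1 j)//= psi0// mul0r.
Qed.

End tensor.

(** * Boxes and Lebesgue measure *)

Arguments lebesgue_rV : simpl never.

Definition boxI {R : realType} {m} (Y : 'I_m -> set R) : set 'rV[R]_m :=
  [set x | forall i, Y i (x ord0 i)].

(** Half-open boxes are cut into halves that partition them exactly. Open boxes carry the weak
    derivatives and closed ones the compactness; the three differ by null sets. *)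
Definition hbox {R : realType} {m} (B : 'rV[R]_m * 'rV[R]_m) : set 'rV[R]_m :=
  boxI (fun i => `[B.1 ord0 i, B.2 ord0 i[%classic).
Definition obox {R : realType} {m} (B : 'rV[R]_m * 'rV[R]_m) : set 'rV[R]_m :=
  boxI (fun i => `]B.1 ord0 i, B.2 ord0 i[%classic).
Definition cbox {R : realType} {m} (B : 'rV[R]_m * 'rV[R]_m) : set 'rV[R]_m :=
  boxI (fun i => `[B.1 ord0 i, B.2 ord0 i]%classic).
Definition vol {R : realType} {m} (B : 'rV[R]_m * 'rV[R]_m) : R :=
  \prod_i (B.2 ord0 i - B.1 ord0 i).

Section box_measure.
Context {R : realType}.
Notation lebesgue_measure := (@lebesgue_measure R).

Lemma measurable_boxI m (Y : 'I_m -> set R) :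
  (forall i, measurable (Y i : set (measurableTypeR R))) -> measurable (boxI Y).
Proof.
move=> mY; rewrite (_ : boxI Y =
    \big[setI/setT]_(i < m) ((fun x : 'rV[R]_m => x ord0 i) @^-1` Y i)).
  apply: bigsetI_measurable => i _.
  by have := @measurable_coor R m i measurableT (Y i) (mY i); rewrite setTI.
rewrite -bigcap_seq; apply/seteqP; split => [x h i _|x h i]; first exact: h.
by apply: (h i); rewrite /= mem_index_enum.
Qed.

Lemma rV_cons_lift m (p : 'rV[R]_m * measurableTypeR R) (j : 'I_m) :
  rV_cons p ord0 (lift ord0 j) = p.1 ord0 j.
Proof.
rewrite /rV_cons (_ : lift ord0 j = rshift 1 j :> 'I_(1 + m)); last exact/val_inj.
exact: (row_mxEr (((p.2 : R)%:M)%R : 'M[R]_1) (p.1 : 'rV[R]_m)).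
Qed.

Lemma rV_cons0 m (p : 'rV[R]_m * measurableTypeR R) : rV_cons p ord0 ord0 = p.2.
Proof.
transitivity (rV_cons p ord0 (lshift m (ord0 : 'I_1) : 'I_(1 + m))).
  by congr (rV_cons p _ _); exact/val_inj.
rewrite /rV_cons; apply: etrans.
  exact: (row_mxEl (((p.2 : R)%:M)%R : 'M[R]_1) (p.1 : 'rV[R]_m)).
by rewrite mxE eqxx.
Qed.

Lemma lebesgue_rV_boxI m (Y : 'I_m -> set R) :
  (forall i, measurable (Y i : set (measurableTypeR R))) ->
  lebesgue_rV m (boxI Y) = (\prod_(i < m) lebesgue_measure (Y i))%E.
Proof.
elim: m Y => [|m IH] Y mY.
  rewrite big_ord0 /= diracE mem_set//.
  by move=> [].
have -> : lebesgue_rV m.+1 (boxI Y) =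
  (lebesgue_rV m \x lebesgue_measure)%E (@rV_cons R m @^-1` boxI Y) by [].
have -> : @rV_cons R m @^-1` boxI Y =
    (boxI (fun i => Y (lift ord0 i))) `*` Y ord0.
  apply/seteqP; split => [[x t]|[x t]] /=.
    move=> h; split=> [i|].
      by have := h (lift ord0 i); rewrite rV_cons_lift.
    by have := h ord0; rewrite rV_cons0.
  move=> [hx ht] i.
  by have [j ->|->] := unliftP ord0 i; rewrite ?rV_cons_lift ?rV_cons0//; exact: hx.
rewrite product_measure1E//; last by apply: measurable_boxI.
by rewrite IH// big_ord_recl muleC.
Qed.

Lemma lebesgue_rV_hyperplane m (i : 'I_m) (c : R) :
  lebesgue_rV m [set x | x ord0 i = c] = 0%E.
Proof.
have E : [set x : 'rV[R]_m | x ord0 i = c] =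
    boxI (fun j => if j == i then [set c] else setT).
  apply/seteqP; split => x /= => [xc j|/(_ i)]; last by rewrite eqxx.
  by case: ifPn => // /eqP ->.
transitivity (lebesgue_rV m (boxI (fun j => if j == i then [set c] else setT))).
  by congr (lebesgue_rV m _).
rewrite lebesgue_rV_boxI.
  by rewrite (bigD1 i)//= eqxx lebesgue_measure_set1 mul0e.
by move=> j; case: ifP.
Qed.

Section boxes.
Context {m : nat}.
Implicit Types B : 'rV[R]_m * 'rV[R]_m.

Lemma measurable_hbox B : measurable (hbox B).
Proof. by apply: measurable_boxI => i; exact: measurable_itv. Qed.

Lemma measurable_obox B : measurable (obox B).
Proof. by apply: measurable_boxI => i; exact: measurable_itv. Qed.

Lemma measurable_cbox B : measurable (cbox B).
Proof. by apply: measurable_boxI => i; exact: measurable_itv. Qed.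

Lemma vol_gt0 B : (forall i, B.1 ord0 i < B.2 ord0 i) -> 0 < vol B.
Proof. by move=> h; apply: prodr_gt0 => i _; rewrite subr_gt0. Qed.

Let leb_itv (a b : R) x y : a <= b ->
  lebesgue_measure [set` Interval (BSide x a) (BSide y b)] = (b - a)%:E.
Proof.
rewrite le_eqVlt => /predU1P[->|ab]; rewrite lebesgue_measure_itv/= lte_fin.
  by rewrite ltxx subrr.
by rewrite ab EFinB.
Qed.

Let prodEFin (f : 'I_m -> R) : (\prod_(i < m) (f i)%:E)%E = (\prod_i f i)%:E.
Proof. exact/esym/(big_morph EFin (@EFinM R) (erefl 1%:E)). Qed.

Lemma lebesgue_hbox B : (forall i, B.1 ord0 i <= B.2 ord0 i) ->
  lebesgue_rV m (hbox B) = (vol B)%:E.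
Proof.
move=> h; rewrite lebesgue_rV_boxI// -prodEFin; apply: eq_bigr => i _.
exact: leb_itv.
Qed.

Lemma lebesgue_obox B : (forall i, B.1 ord0 i <= B.2 ord0 i) ->
  lebesgue_rV m (obox B) = (vol B)%:E.
Proof.
move=> h; rewrite lebesgue_rV_boxI// -prodEFin; apply: eq_bigr => i _.
exact: leb_itv.
Qed.

Lemma sub_oh B : obox B `<=` hbox B.
Proof.
by move=> x h i; have := h i; rewrite /= !in_itv/= => /andP[/ltW-> ->].
Qed.

Lemma sub_hc B : hbox B `<=` cbox B.
Proof.
by move=> x h i; have := h i; rewrite /= !in_itv/= => /andP[-> /ltW->].
Qed.

Lemma lebesgue_hboxDobox B : (forall i, B.1 ord0 i <= B.2 ord0 i) ->
  lebesgue_rV m (hbox B `\` obox B) = 0%E.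
Proof.
move=> h; rewrite measureD//=; [|exact: measurable_hbox|exact: measurable_obox|].
  rewrite setIC (setIidl (@sub_oh B)) lebesgue_hbox// lebesgue_obox//.
  by rewrite subee.
by rewrite lebesgue_hbox// ltry.
Qed.

Lemma compact_cbox B : compact (cbox B).
Proof.
apply: (@rV_compact R m (fun j => `[B.1 ord0 j, B.2 ord0 j]%classic)) => j.
exact: segment_compact.
Qed.

Lemma nbhs_obox (x : 'rV[R]_m) (O : set 'rV[R]_m) : nbhs x O ->
  exists2 e : R, 0 < e & obox (x - const_mx e, x + const_mx e) `<=` O.
Proof.
move=> /nbhs_ballP[e /= e0 eO]; exists e => // y h; apply: eO.
split => // i j; rewrite ord1; have := h j; rewrite /= !mxE in_itv/= => /andP[h1 h2].
by rewrite /ball/= ltr_distlC; apply/andP; split; lra.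
Qed.

Lemma open_obox B : open (obox B).
Proof.
rewrite openE => x h; rewrite /interior.
have : \forall y \near (x : 'rV[R]_m), forall i, `]B.1 ord0 i, B.2 ord0 i[%classic ((y : 'rV[R]_m) ord0 i).
  apply: (@filter_forall _ 'I_m
    (fun i (y : 'rV[R]_m) => `]B.1 ord0 i, B.2 ord0 i[%classic (y ord0 i)) (nbhs x) _) => i.
  apply: (@coord_continuous R 1 m ord0 i x); apply: open_nbhs_nbhs; split.
    exact: interval_open.
  exact: h.
by apply: filterS.
Qed.

(** The sigma-algebra is generated by the coordinates, so an open set is measurable as a countable
    union of boxes with rational corners. *)
Lemma open_measurable_rV (O : set 'rV[R]_m) : open O -> measurable O.
Proof.
move=> oO.
(* The inclusion in [O] is part of the set itself, so that the union can range over all pairs of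
   rational corners: [F q] is either a box or empty. *)
pose F (q : 'rV[rat]_m * 'rV[rat]_m) : set 'rV[R]_m :=
  let B := (map_mx ratr q.1, map_mx ratr q.2) in
  [set x | obox B x /\ obox B `<=` O].
rewrite (_ : O = \bigcup_q F q).
  apply: countable_bigcupT_measurable => [|q].
    exact: countableP.
  rewrite /F; have [h|h] := pselect (obox (map_mx ratr q.1, map_mx ratr q.2) `<=` O).
    rewrite (_ : [set _ | _] = obox (map_mx ratr q.1, map_mx ratr q.2)).
      exact: measurable_obox.
    by apply/seteqP; split => x //= -[].
  rewrite (_ : [set _ | _] = set0)//.
  by apply/seteqP; split => x //= -[].
apply/seteqP; split => [x Ox|x [q _ [hx hO]]]; last exact: hO.
have [e e0 he] : exists2 e : R, 0 < e & obox (x - const_mx e, x + const_mx e) `<=` O.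
  by apply: nbhs_obox; exact: open_nbhs_nbhs.
have q1 i : exists q, ratr q \in `]x ord0 i - e, x ord0 i[.
  by apply: rat_in_itvoo; rewrite ltrBlDr ltrDl.
have q2 i : exists q, ratr q \in `]x ord0 i, x ord0 i + e[.
  by apply: rat_in_itvoo; rewrite ltrDl.
pose p1 : 'rV[rat]_m := \row_i projT1 (cid (q1 i)).
pose p2 : 'rV[rat]_m := \row_i projT1 (cid (q2 i)).
exists (p1, p2) => //; split => [i|y hy] /=.
  rewrite in_itv/= !mxE; case: cid => q /=; case: cid => q' /=.
  by rewrite !in_itv/= => /andP[h1 h2] /andP[h3 h4]; apply/andP; split.
apply: he => i; have := hy i; rewrite /= !in_itv/= !mxE.
case: cid => q /=; case: cid => q' /=.
by rewrite !in_itv/= => /andP[h1 h2] /andP[h3 h4] /andP[h5 h6]; apply/andP; split; lra.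
Qed.

End boxes.
End box_measure.

Lemma measurable_fun_gt d (T : measurableType d) (R : realType) (D : set T) (f : T -> R) :
  (forall a, measurable (D `&` f @^-1` `]a, +oo[%classic)) -> measurable_fun D f.
Proof.
move=> h; apply: (measurability _ (RGenOInfty.measurableE R)).
by move=> _ [_ [a ->] <-]; exact: h.
Qed.

Section rV_measurability.
Context {R : realType} {m : nat}.

Lemma within_continuous_measurable_rV (O : set 'rV[R]_m) (f : 'rV[R]_m -> R) :
  open O -> (forall x, O x -> {for x, continuous f}) -> measurable_fun O f.
Proof.
move=> oO cf; apply: measurable_fun_gt => a; apply: open_measurable_rV.
rewrite openE => x [Ox fx]; rewrite /interior.
apply: filterI; first exact: open_nbhs_nbhs.
by apply: (cf x Ox); apply: open_nbhs_nbhs; split => //; exact: interval_open.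
Qed.

Lemma continuous_measurable_rV (f : 'rV[R]_m -> R) :
  continuous f -> measurable_fun setT f.
Proof.
by move=> cf; apply: within_continuous_measurable_rV => [|x _]; [exact: openT|exact: cf].
Qed.

End rV_measurability.

Lemma cvg_Rintegral_dominated d (T : measurableType d) (R : realType)
    (mu : {measure set T -> \bar R}) (D : set T) (f_ : nat -> T -> R) (f g : T -> R) :
  measurable D -> (forall n, measurable_fun D (f_ n)) -> measurable_fun D f ->
  (forall x, D x -> f_ n x @[n --> \oo] --> f x) ->
  mu.-integrable D (EFin \o g) -> (forall n x, D x -> `|f_ n x| <= g x) ->
  \int[mu]_(x in D) f_ n x @[n --> \oo] --> \int[mu]_(x in D) f x.
Proof.
move=> mD mf_ mf cvf ig fg.
have [] := @dominated_convergence _ _ _ mu D mD (fun n => EFin \o f_ n)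
  (EFin \o f) (EFin \o g).
- by move=> n; exact/measurable_EFinP.
- exact/measurable_EFinP.
- by apply: aeW => x Dx; apply: cvg_EFin; [exact: nearW|exact: cvf].
- exact: ig.
- by apply: aeW => x n Dx; rewrite lee_fin; exact: fg.
move=> intf _ cv; apply: fine_cvg; rewrite fineK; first exact: cv.
exact: integrable_fin_num.
Qed.

Section indic.
Context d (T : measurableType d) (R : realType) (mu : {measure set T -> \bar R}).
Implicit Types (D P : set T) (u : T -> R).

Lemma Rintegral_indic_mulr D P u : P `<=` D ->
  \int[mu]_(x in D) (u x * \1_P x) = \int[mu]_(x in P) u x.
Proof.
move=> PD; rewrite -[in RHS](setIidr PD) Rintegral_mkcondr; apply: eq_Rintegral => x _.
by rewrite patchE indicE; case: ifP; rewrite ?mulr1 ?mulr0.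
Qed.

Lemma integrable_mul_indic D P u : measurable D -> measurable P ->
  mu.-integrable D (EFin \o u) -> mu.-integrable D (EFin \o (fun x => u x * \1_P x)).
Proof.
move=> mD mP iu; apply: le_integrable (iu) => //.
  apply/measurable_EFinP; apply: measurable_funM.
    exact/measurable_EFinP/measurable_int/iu.
  exact: measurable_indic.
move=> x _; rewrite /= lee_fin normrM indicE; case: (_ \in _); rewrite ?normr1 ?mulr1//.
by rewrite normr0 mulr0.
Qed.

End indic.

Lemma indic_boxI {R : realType} m (Y : 'I_m -> set R) (x : 'rV[R]_m) :
  \1_(boxI Y) x = \prod_j \1_(Y j) (x ord0 j) :> R.
Proof.
rewrite indicE; case: (boolP (x \in _)) => [|/negP]; rewrite inE => h.
  by rewrite big1// => j _; rewrite indicE mem_set//; exact: h.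
move/existsNP : h => [j h]; rewrite (bigD1 j)//= indicE memNset//= mul0r//.
Qed.

(** * The tent estimate for weak derivatives *)

Definition upd {R : realType} {m} (v : 'rV[R]_m) (i : 'I_m) (c : R) : 'rV[R]_m :=
  \row_j if j == i then c else v ord0 j.
Definition mid {R : realType} {m} (i : 'I_m) (B : 'rV[R]_m * 'rV[R]_m) : R :=
  (B.1 ord0 i + B.2 ord0 i) / 2.
Definition lo {R : realType} {m} (i : 'I_m) (B : 'rV[R]_m * 'rV[R]_m) :=
  (B.1, upd B.2 i (mid i B)).
Definition hi {R : realType} {m} (i : 'I_m) (B : 'rV[R]_m * 'rV[R]_m) :=
  (upd B.1 i (mid i B), B.2).

Section tent.
Context {R : realType} {m : nat}.
Implicit Types (B : 'rV[R]_m * 'rV[R]_m) (i : 'I_m).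
Notation mu := (@lebesgue_rV R m).

Lemma loP i B x : B.1 ord0 i < B.2 ord0 i ->
  obox (lo i B) x <-> obox B x /\ x ord0 i < mid i B.
Proof.
move=> lt; split => [h|[h xi] j].
  split => [j|]; last by have := h i; rewrite /= !mxE eqxx in_itv/= => /andP[].
  have := h j; rewrite /= !mxE !in_itv/=; case: eqVneq => [->|//].
  by rewrite /mid => /andP[-> h2]; lra.
have := h j; rewrite /= !mxE !in_itv/=; case: eqVneq => [->|//].
by move=> /andP[-> _].
Qed.

Lemma hiP i B x : B.1 ord0 i < B.2 ord0 i ->
  obox (hi i B) x <-> obox B x /\ mid i B < x ord0 i.
Proof.
move=> lt; split => [h|[h xi] j].
  split => [j|]; last by have := h i; rewrite /= !mxE eqxx in_itv/= => /andP[].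
  have := h j; rewrite /= !mxE !in_itv/=; case: eqVneq => [->|//].
  by rewrite /mid => /andP[h1 ->]; rewrite andbT; lra.
have := h j; rewrite /= !mxE !in_itv/=; case: eqVneq => [->|//].
by move=> /andP[_ ->]; rewrite xi.
Qed.

(** The test function is a tent in direction [i], of slope 1 on the lower half and -1 on the upper
    half, times the indicator of the box in the other directions. Its height is half the side,
    whence the factor on the right. It is approached by smooth product functions, and dominated
    convergence handles the side with [u]. *)
Lemma weak_partial_tent (O : set 'rV[R]_m) i (u w : 'rV[R]_m -> R) B :
  weak_partial O i u w -> (forall j, B.1 ord0 j < B.2 ord0 j) ->
  obox B `<=` O -> mu.-integrable (obox B) (EFin \o u) ->
  mu.-integrable (obox B) (EFin \o w) ->
  `|\int[mu]_(x in obox (lo i B)) u x - \int[mu]_(x in obox (hi i B)) u x| <=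
  (B.2 ord0 i - B.1 ord0 i) / 2 * \int[mu]_(x in obox B) `|w x|.
Proof.
move=> [_ _ uw] ltB BO iu iw.
pose a := B.1 ord0; pose b := B.2 ord0; pose c := mid i B; pose s := (b i - a i) / 2.
have s0 : 0 < s by rewrite divr_gt0// subr_gt0; exact: ltB.
have cE : c = a i + s by rewrite /c /mid /s -/(a i) -/(b i); lra.
have bE : b i = c + s by rewrite cE /s; lra.
rewrite -[(B.2 ord0 i - B.1 ord0 i) / 2]/s; clearbody s.
pose e (k : nat) : R := k.+1%:R^-1.
have e0 k : 0 < e k by rewrite invr_gt0.
pose be k t := bump k (a i) c t.
have exF k : exists F, [/\ smooth1 F, forall x : R, is_derive x (1 : R) F (be k x) &
    forall x, x <= a i + e k -> F x = 0].
  by apply: smooth1_primitive; [exact: bump_smooth1|move=> x; exact: bump_left].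
pose F k := projT1 (cid (exF k)).
have smF k : smooth1 (F k) by rewrite /F; case: cid => f [].
have dF k : forall x : R, is_derive x (1 : R) (F k) (be k x) by rewrite /F; case: cid => f [].
(* A smoothed tent: its derivative is the bump on the lower half minus the translate of this bump to
   the upper half. *)
pose G k t := F k t - F k (t - s).
have smshift (f : R -> R) : smooth1 f -> smooth1 (fun t => f (t - s)).
  move=> sf; rewrite (_ : (fun t => _) = (fun t => f (1 * t + - s))).
    exact: smooth1_affine.
  by apply/funext => t; rewrite mul1r.
have smN (f : R -> R) : smooth1 f -> smooth1 (fun t => - f t).
  move=> sf; rewrite (_ : (fun t => _) = (cst (-1) \* f)).
    by apply: smooth1_mul => //; exact: smooth1_cst.
  by apply/funext => t /=; rewrite mulN1r.
have smG k : smooth1 (G k) by apply: smooth1_add => //; apply: smN; exact: smshift.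
have dG k : forall t : R, is_derive t (1 : R) (G k) (be k t - be k (t - s)).
  move=> t; apply: is_deriveB.
  have ds : is_derive t (1 : R) (fun t : R => t - s) 1.
    by apply: is_derive_eq; rewrite subr0.
  by rewrite -[X in is_derive _ _ _ X]mulr1; apply: (@is_derive1_comp _ (F k) (fun t => t - s)).
(* The mean value theorem serves twice: it bounds the tent by [s], and it makes the tent vanish near
   both ends of the side, since [xi] then falls where the bump is zero. *)
have GE k (t : R) : exists2 xi : R, t - s < xi < t & G k t = be k xi * s.
  have ts : t - s < t by rewrite ltrBlDr ltrDl.
  have cF : {within `[t - s, t], continuous (F k)}.
    by apply: continuous_subspaceT; exact: smooth1_continuous.
  have [xi] := MVT ts (fun x _ => dF k x) cF.
  rewrite in_itv/= => xit E; exists xi => //; rewrite /G E; congr (_ * _); ring.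
have Gs k t : `|G k t| <= s.
  have [xi _ ->] := GE k t; have /andP[h0 h1] := bump_ge0_le1 k (a i) c xi.
  rewrite normrM (gtr0_norm s0); apply: ler_piMl; first exact: ltW.
  by rewrite ger0_norm.
pose psi k j := if j == i then G k else bump k (a j) (b j).
pose dpsi k j := if j == i then (fun t => be k t - be k (t - s)) else bump k (a j) (b j).
have smpsi k j : smooth1 (psi k j) by rewrite /psi; case: ifP => // _; exact: bump_smooth1.
have smdpsi k j : smooth1 (dpsi k j).
  rewrite /dpsi; case: ifP => // _; last exact: bump_smooth1.
  by apply: smooth1_add; [exact: bump_smooth1|apply: smN; apply: smshift; exact: bump_smooth1].
have bump0 k (x y t : R) : ~~ (x + e k <= t <= y - e k) -> bump k x y t = 0.
  rewrite negb_and -!ltNge => /orP[] h.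
    by apply: bump_left; exact: ltW.
  by apply: bump_right; exact: ltW.
have psi0 k j (t : R) : ~~ (a j + e k <= t <= b j - e k) -> psi k j t = 0.
  rewrite /psi; case: eqVneq => [->|_]; last exact: bump0.
  have [xi /andP[x1 x2] ->] := GE k t => h; rewrite /be bump0 ?mul0r//.
  apply: contra h => /andP[h1 h2]; have := e0 k => ?; apply/andP; split; lra.
have dpsi0 k j (t : R) : ~~ (a j + e k <= t <= b j - e k) -> dpsi k j t = 0.
  rewrite /dpsi; case: eqVneq => [->|_]; last exact: bump0.
  move=> h; rewrite /be !bump0 ?subr0//.
    by apply: contra h => /andP[h1 h2]; have := e0 k => ?; apply/andP; split; lra.
  by apply: contra h => /andP[h1 h2]; have := e0 k => ?; apply/andP; split; lra.
have tens0 k (p : 'I_m -> R -> R) x : (forall j (t : R), ~~ (a j + e k <= t <= b j - e k) -> p j t = 0) ->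
    ~ obox B x -> tensor p x = 0.
  move=> p0 /existsNP[j /=]; rewrite in_itv/= => /negP h.
  rewrite /tensor (bigD1 j)//= p0 ?mul0r//; apply: contra h => /andP[h1 h2].
  by have := e0 k => ?; rewrite -/a -/b; apply/andP; split; lra.
have test k : test_function O (tensor (psi k)).
  apply: (@tensor_test_function _ _ _ _ (fun j => a j + e k) (fun j => b j - e k)) => //; first exact: psi0.
  move=> x h; apply: BO => j; have := h j; rewrite /= !in_itv/= => /andP[h1 h2].
  by have := e0 k; rewrite -/a -/b => ?; apply/andP; split; lra.
have part k : partial i (tensor (psi k)) = tensor (dpsi k).
  apply/funext => x; rewrite /partial.
  have dpi : forall t : R, is_derive t (1 : R) (psi k i) (dpsi k i t).
    by move=> t; rewrite /psi /dpsi eqxx; exact: dG.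
  have [_ ->] := is_derive_tensor x dpi.
  by apply: eq_bigr => j _; rewrite /psi /dpsi; case: eqVneq => [->|//]; rewrite ?eqxx.
have mB := measurable_obox B.
have OtoB (h : 'rV[R]_m -> R) k (p : 'I_m -> R -> R) : (forall j (t : R), ~~ (a j + e k <= t <= b j - e k) -> p j t = 0) ->
   \int[mu]_(x in O) (h x * tensor p x) = \int[mu]_(x in obox B) (h x * tensor p x).
  move=> p0; rewrite Rintegral_mkcond [RHS]Rintegral_mkcond; apply: eq_Rintegral => x _.
  rewrite !patchE; have [xB|xB] := pselect (obox B x).
    by rewrite (mem_set xB) (mem_set (BO x xB)).
  by rewrite (memNset xB) (tens0 k)// mulr0; case: ifP.
have bnd (k : nat) (p : 'I_m -> R -> R) (x : 'rV[R]_m) (C : R) :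
    (forall (j : 'I_m) (t : R), j != i -> p j t = bump k (a j) (b j) t) ->
    (forall t, `|p i t| <= C) -> `|tensor p x| <= C.
  move=> pj pi; rewrite /tensor (bigD1 i)//= normrM -[leRHS]mulr1.
  apply: ler_pM; [exact: normr_ge0|exact: normr_ge0|exact: pi|].
  rewrite normr_prod; apply: prodr_ile1 => j ji.
  rewrite pj// normr_ge0/=; have /andP[h0 h1] := bump_ge0_le1 k (a j) (b j) (x ord0 j).
  by rewrite ger0_norm.
have psiS k x : `|tensor (psi k) x| <= s.
  by apply: (bnd k) => [j t ji|t]; rewrite /psi ?(negbTE ji)// eqxx.
have dpsi1 k x : `|tensor (dpsi k) x| <= 1.
  apply: (bnd k) => [j t ji|t]; rewrite /dpsi ?(negbTE ji)// eqxx.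
  have /andP[h0 h1] := bump_ge0_le1 k (a i) c t.
  have /andP[h2 h3] := bump_ge0_le1 k (a i) c (t - s).
  by rewrite ler_norml /be; apply/andP; split; lra.
have mten p : (forall j, smooth1 (p j)) -> measurable_fun (obox B) (tensor p).
  move=> sp; apply: (measurable_funS measurableT) => //.
  by apply: continuous_measurable_rV; exact: tensor_continuous.
have mu_ : measurable_fun (obox B) u by exact/measurable_EFinP/measurable_int/iu.
have mw_ : measurable_fun (obox B) w by exact/measurable_EFinP/measurable_int/iw.
have ineq k : `|\int[mu]_(x in obox B) (u x * tensor (dpsi k) x)| <=
    s * \int[mu]_(x in obox B) `|w x|.
  rewrite -(OtoB u k (dpsi k) (dpsi0 k)) -part (uw _ (test k)) normrN.
  rewrite (OtoB w k (psi k) (psi0 k)).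
  have iwn : mu.-integrable (obox B) (EFin \o (fun x => s * `|w x|)).
    rewrite (_ : _ \o _ = (fun x => s%:E * (EFin \o (fun x => `|w x|)%R) x)%E)//.
    by apply: integrableZl => //; exact: (integrable_norm iw).
  have iwt : mu.-integrable (obox B) (EFin \o (fun x => w x * tensor (psi k) x)).
    apply: le_integrable (iwn) => //.
      apply/measurable_EFinP; apply: measurable_funM => //; exact: mten.
    move=> x Bx; rewrite /= lee_fin [leRHS]ger0_norm ?mulr_ge0 ?(ltW s0)//.
    by rewrite normrM mulrC ler_wpM2r.
  apply: (le_trans (le_normr_Rintegral mB iwt)).
  rewrite -RintegralZl//; last exact: (integrable_norm iw).
  apply: le_Rintegral => //; first exact: (integrable_norm iwt).
  by move=> x Bx; rewrite normrM mulrC ler_wpM2r.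
pose D x : R := \1_(obox (lo i B)) x - \1_(obox (hi i B)) x.
have Dcv x : tensor (dpsi k) x @[k --> \oo] --> D x.
  pose l j : R := if j == i then \1_(`]a i, c[) (x ord0 i) - \1_(`]a i, c[) (x ord0 i - s)
     else \1_(`]a j, b j[) (x ord0 j).
  have -> : D x = \prod_j l j.
    rewrite /D !indic_boxI (bigD1 i)//= [X in _ - X](bigD1 i)//= [RHS](bigD1 i)//=.
    rewrite /l eqxx !mxE eqxx mulrBl.
    have -> : (\1_(`]a i, c[) (x ord0 i - s) : R) = \1_(`]c, b i[) (x ord0 i).
      rewrite !indicE; congr (_ %:R); congr nat_of_bool; apply/idP/idP; rewrite !inE/= !in_itv/=;
        move=> /andP[h1 h2]; apply/andP; split; lra.
    congr (_ * _ - _ * _); apply: eq_bigr => j ji; rewrite ?mxE (negbTE ji)//.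
  apply: (@cvg_big R 'I_m *%R 1 xpredT (@mul_continuous R) _ _ (index_enum _)
    (fun j k => dpsi k j (x ord0 j)) l) => j _.
  rewrite /dpsi /l; case: eqVneq => [->|_]; last exact: bump_cvg.
  by apply: cvgB; exact: bump_cvg.
have cv : \int[mu]_(x in obox B) (u x * tensor (dpsi k) x) @[k --> \oo] -->
    \int[mu]_(x in obox B) (u x * D x).
  apply: (@cvg_Rintegral_dominated _ _ _ _ _ _ _ (fun x => `|u x|)) => //.
  - by move=> k; apply: measurable_funM => //; exact: mten.
  - apply: measurable_funM => //; apply: measurable_funB; apply: measurable_indic; exact: measurable_obox.
  - by move=> x Bx; apply: cvgM; [exact: cvg_cst|exact: Dcv].
  - exact: (integrable_norm iu).
  - by move=> k x Bx; rewrite normrM ler_piMr.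
have <- : \int[mu]_(x in obox B) (u x * D x) =
    \int[mu]_(x in obox (lo i B)) u x - \int[mu]_(x in obox (hi i B)) u x.
  have subi : obox (lo i B) `<=` obox B by move=> x /(loP x (ltB i))[].
  have subh : obox (hi i B) `<=` obox B by move=> x /(hiP x (ltB i))[].
  rewrite -[X in _ = X - _](@Rintegral_indic_mulr _ _ _ mu _ _ u subi).
  rewrite -[X in _ = _ - X](@Rintegral_indic_mulr _ _ _ mu _ _ u subh).
  rewrite -RintegralB//; first by apply: eq_Rintegral => x _; rewrite -mulrBr.
    by apply: integrable_mul_indic => //; exact: measurable_obox.
  by apply: integrable_mul_indic => //; exact: measurable_obox.
by apply: (cvgr_to_le (cvg_norm cv)); apply: nearW.
Qed.

End tent.

(** * Dyadic bisection of a box *)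

Section tree.
Context {R : realType} {m : nat}.
Notation T := 'rV[R]_m.+1.
Implicit Types (B : T * T) (x : T) (i : 'I_m.+1) (s n k : nat).
Notation mu := (@lebesgue_rV R m.+1).

Definition nondeg B := forall i, B.1 ord0 i < B.2 ord0 i.

Lemma nondeg_lo i B : nondeg B -> nondeg (lo i B).
Proof.
move=> nB j; rewrite /= !mxE; case: eqVneq => [->|_]; last exact: nB.
by rewrite /mid; have := nB i; lra.
Qed.

Lemma nondeg_hi i B : nondeg B -> nondeg (hi i B).
Proof.
move=> nB j; rewrite /= !mxE; case: eqVneq => [->|_]; last exact: nB.
by rewrite /mid; have := nB i; lra.
Qed.

Lemma hbox_lo i B : nondeg B -> hbox (lo i B) = hbox B `&` [set x | x ord0 i < mid i B].
Proof.
move=> nB; have lt := nB i; apply/seteqP; split => [x h|x [h xi] j].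
  split => [j|]; last by have := h i; rewrite /= !mxE eqxx in_itv/= => /andP[].
  have := h j; rewrite /= !mxE !in_itv/=; case: eqVneq => [->|//].
  by rewrite /mid => /andP[-> h2]; lra.
have := h j; rewrite /= !mxE !in_itv/=; case: eqVneq => [->|//].
by move=> /andP[-> _].
Qed.

Lemma hbox_hi i B : nondeg B -> hbox (hi i B) = hbox B `&` [set x | ~~ (x ord0 i < mid i B)].
Proof.
move=> nB; have lt := nB i; apply/seteqP; split => [x h|x [h /= xi] j].
  split => [j|/=]; last by have := h i; rewrite /= !mxE eqxx in_itv/= -leNgt => /andP[].
  have := h j; rewrite /= !mxE !in_itv/=; case: eqVneq => [->|//].
  by rewrite /mid => /andP[h1 ->]; rewrite andbT; lra.
have := h j; rewrite /= !mxE !in_itv/=; case: eqVneq => [->|//].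
by move=> /andP[_ ->]; rewrite leNgt xi.
Qed.

Lemma hbox_lo_sub i B : nondeg B -> hbox (lo i B) `<=` hbox B.
Proof. by move=> /hbox_lo ->; exact: subIsetl. Qed.

Lemma hbox_hi_sub i B : nondeg B -> hbox (hi i B) `<=` hbox B.
Proof. by move=> /hbox_hi ->; exact: subIsetl. Qed.

Lemma hbox_split i B : nondeg B -> hbox B = hbox (lo i B) `|` hbox (hi i B).
Proof.
move=> nB; rewrite hbox_lo// hbox_hi// -setIUr; apply/esym/setIidl => x _ /=.
by case: (x ord0 i < _); [left|right].
Qed.

Lemma hbox_disj i B : nondeg B -> [disjoint hbox (lo i B) & hbox (hi i B)].
Proof.
move=> nB; rewrite hbox_lo// hbox_hi//; apply/disj_setPS => x [[_ /= h1] [_ /= h2]].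
by rewrite h1 in h2.
Qed.

Lemma side_upd_lo i B : (lo i B).2 ord0 i - (lo i B).1 ord0 i = (B.2 ord0 i - B.1 ord0 i) / 2.
Proof. by rewrite /= !mxE eqxx /mid; lra. Qed.

Lemma side_upd_hi i B : (hi i B).2 ord0 i - (hi i B).1 ord0 i = (B.2 ord0 i - B.1 ord0 i) / 2.
Proof. by rewrite /= !mxE eqxx /mid; lra. Qed.

Lemma vol_lo i B : vol (lo i B) = vol B / 2.
Proof.
rewrite /vol (bigD1 i)//= [in RHS](bigD1 i)//= !mxE eqxx mulrAC; congr (_ * _).
  by rewrite /mid; lra.
by apply: eq_bigr => j ji; rewrite !mxE (negbTE ji).
Qed.

Lemma vol_hi i B : vol (hi i B) = vol B / 2.
Proof.
rewrite /vol (bigD1 i)//= [in RHS](bigD1 i)//= !mxE eqxx mulrAC; congr (_ * _).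
  by rewrite /mid; lra.
by apply: eq_bigr => j ji; rewrite !mxE (negbTE ji).
Qed.

Definition dir s : 'I_m.+1 := inord (s %% m.+1).

Definition child s B x :=
  if x ord0 (dir s) < mid (dir s) B then lo (dir s) B else hi (dir s) B.

(** The box around [x] after [n] cuts of [B]. The argument [s] is the generation of [B], which fixes
    the direction of the next cut. Following the path of [x] avoids enumerating the 2^n boxes: a
    function of [bx n s B x] is a step function on the generation. *)
Fixpoint bx n s B x := if n is n'.+1 then bx n' s.+1 (child s B x) x else B.

Lemma bx_lo n s B x : nondeg B -> hbox (lo (dir s) B) x ->
  bx n.+1 s B x = bx n s.+1 (lo (dir s) B) x.
Proof. by move=> nB; rewrite hbox_lo// => -[_ /= h]; rewrite /child h. Qed.

Lemma bx_hi n s B x : nondeg B -> hbox (hi (dir s) B) x ->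
  bx n.+1 s B x = bx n s.+1 (hi (dir s) B) x.
Proof. by move=> nB; rewrite hbox_hi// => -[_ /= /negbTE h]; rewrite /child h. Qed.

Lemma hbox_child s B x : nondeg B -> hbox B x ->
  [/\ nondeg (child s B x), hbox (child s B x) x & hbox (child s B x) `<=` hbox B].
Proof.
move=> nB Bx; rewrite /child; case: ifPn => h.
  split; [exact: nondeg_lo|by rewrite hbox_lo|exact: hbox_lo_sub].
by split; [exact: nondeg_hi|by rewrite hbox_hi|exact: hbox_hi_sub].
Qed.

Lemma hbox_bx n s B x : nondeg B -> hbox B x ->
  [/\ nondeg (bx n s B x), hbox (bx n s B x) x & hbox (bx n s B x) `<=` hbox B].
Proof.
elim: n s B => [|n IH] s B nB Bx /=; first by split.
have [h1 h2 h3] := hbox_child s nB Bx; have [h4 h5 h6] := IH s.+1 _ h1 h2.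
by split => //; exact: subset_trans h3.
Qed.

Lemma bx_add n k s B x y : nondeg B -> hbox B x -> hbox (bx n s B x) y ->
  bx (n + k) s B y = bx k (s + n) (bx n s B x) y.
Proof.
elim: n s B => [|n IH] s B nB Bx; first by rewrite addn0.
move=> /= Hy; have [h1 h2 h3] := hbox_child s nB Bx.
have [_ _ h6] := hbox_bx n s.+1 h1 h2.
have cy : child s B y = child s B x.
  have := h6 _ Hy; rewrite /child; case: ifPn => h.
    by rewrite hbox_lo// => -[_ /= ->].
  by rewrite hbox_hi// => -[_ /= /negbTE ->].
by rewrite cy IH// addSnnS.
Qed.

Lemma measurable_bx (phi : T * T -> R) n s B :
  measurable_fun setT (fun x => phi (bx n s B x)).
Proof.
elim: n s B => [|n IH] s B /=; first exact: measurable_cst.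
rewrite (_ : (fun x => _) = (fun x => if x ord0 (dir s) < mid (dir s) B
    then phi (bx n s.+1 (lo (dir s) B) x) else phi (bx n s.+1 (hi (dir s) B) x))).
  apply: measurable_fun_ifT => //.
  apply: measurable_fun_ltr; [exact: measurable_coor|exact: measurable_cst].
by apply/funext => x; rewrite /child; case: ifP.
Qed.

(** The number of t < s congruent to [i] modulo [m.+1], that is, how many of the first [s] cuts
    halve the side [i]. *)
Definition sidexp s i : nat := ((s + (m - i)) %/ m.+1)%N.

Lemma sidexp_dir s : sidexp s (dir s) = (s %/ m.+1)%N.
Proof.
rewrite /sidexp /dir inordK ?ltn_mod//.
rewrite {1}(divn_eq s m.+1) -addnA subnKC; last by rewrite -ltnS ltn_mod.
by rewrite divnMDl// (divn_small (ltnSn m)) addn0.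
Qed.

Lemma sidexpS s i : sidexp s.+1 i = ((i == dir s) + sidexp s i)%N.
Proof.
rewrite /sidexp addSn divnS//; congr (_ + _)%N.
have im : (i <= m)%N by rewrite -ltnS ltn_ord.
rewrite -addnS -subSn// addnBA; last exact: ltnW.
have -> : (m.+1 %| s + m.+1 - i)%N = (s + m.+1 == i %[mod m.+1])%N.
  by rewrite eqn_mod_dvd//; apply: (leq_trans im); rewrite addnS leqW// leq_addl.
rewrite modnDr (modn_small (ltn_ord i)) eq_sym -(inj_eq val_inj)/= /dir inordK//.
by rewrite ltn_mod.
Qed.

(* The box B is reached after s bisections of Q. *)
Definition in_tree (Q : T * T) s B := [/\ nondeg B, hbox B `<=` hbox Q,
  forall i, B.2 ord0 i - B.1 ord0 i = (Q.2 ord0 i - Q.1 ord0 i) / 2 ^+ sidexp s i &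
  vol B = vol Q / 2 ^+ s].

Lemma in_tree0 Q : nondeg Q -> in_tree Q 0 Q.
Proof.
move=> nQ; split=> // [i|]; last by rewrite divr1.
rewrite /sidexp add0n divn_small ?expr0 ?divr1//.
by rewrite ltnS leq_subr.
Qed.

Lemma in_tree_lo Q s B : in_tree Q s B -> in_tree Q s.+1 (lo (dir s) B).
Proof.
move=> [nB BQ sB vB]; split; first exact: nondeg_lo.
- by apply: subset_trans BQ; exact: hbox_lo_sub.
- move=> i; rewrite sidexpS; case: eqVneq => [->|ji].
    by rewrite side_upd_lo sB add1n exprSr invfM mulrA.
  by rewrite /= !mxE (negbTE ji) sB.
- by rewrite vol_lo vB exprSr invfM mulrA.
Qed.

Lemma in_tree_hi Q s B : in_tree Q s B -> in_tree Q s.+1 (hi (dir s) B).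
Proof.
move=> [nB BQ sB vB]; split; first exact: nondeg_hi.
- by apply: subset_trans BQ; exact: hbox_hi_sub.
- move=> i; rewrite sidexpS; case: eqVneq => [->|ji].
    by rewrite side_upd_hi sB add1n exprSr invfM mulrA.
  by rewrite /= !mxE (negbTE ji) sB.
- by rewrite vol_hi vB exprSr invfM mulrA.
Qed.

Lemma in_tree_bx Q n s B x : in_tree Q s B -> hbox B x -> in_tree Q (s + n) (bx n s B x).
Proof.
elim: n s B => [|n IH] s B tB Bx; first by rewrite addn0.
have [nB _ _ _] := tB.
rewrite -addSnnS /=; apply: IH; last by case: (hbox_child s nB Bx).
by rewrite /child; case: ifP => _; [exact: in_tree_lo|exact: in_tree_hi].
Qed.

Lemma Rintegral_hbox_split (u : T -> R) i B : nondeg B -> mu.-integrable (hbox B) (EFin \o u) ->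
  \int[mu]_(x in hbox B) u x = \int[mu]_(x in hbox (lo i B)) u x + \int[mu]_(x in hbox (hi i B)) u x.
Proof.
move=> nB iu; rewrite {1}(hbox_split i nB) Rintegral_setU//.
- exact: measurable_hbox.
- exact: measurable_hbox.
- by rewrite -hbox_split.
- exact: hbox_disj.
Qed.

Lemma integral_hbox_split (f : T -> \bar R) i B : nondeg B -> measurable_fun (hbox B) f ->
  (forall x, hbox B x -> 0 <= f x)%E ->
  (\int[mu]_(x in hbox B) f x = \int[mu]_(x in hbox (lo i B)) f x + \int[mu]_(x in hbox (hi i B)) f x)%E.
Proof.
move=> nB mf f0; rewrite {1}(hbox_split i nB) ge0_integral_setU//.
- exact: measurable_hbox.
- exact: measurable_hbox.
- by rewrite -hbox_split.
- by rewrite -hbox_split.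
- exact: hbox_disj.
Qed.

Definition avg (u : T -> R) B : R := (vol B)^-1 * \int[mu]_(x in hbox B) u x.

Lemma Rintegral_hbox_cst B c : nondeg B -> \int[mu]_(x in hbox B) c = c * vol B.
Proof.
move=> nB; rewrite Rintegral_cst//; last exact: measurable_hbox.
by rewrite lebesgue_hbox// => i; exact: ltW.
Qed.

Lemma lebesgue_hbox_fin B : nondeg B -> (mu (hbox B) < +oo)%E.
Proof. by move=> nB; rewrite lebesgue_hbox ?ltry// => i; exact: ltW. Qed.

(* Functions of bx n s B x take finitely many values. *)
Lemma bx_bounded (phi : T * T -> R) n s B : exists M, forall x, `|phi (bx n s B x)| <= M.
Proof.
elim: n s B => [|n IH] s B; first by exists `|phi B|.
have [M1 H1] := IH s.+1 (lo (dir s) B); have [M2 H2] := IH s.+1 (hi (dir s) B).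
exists (Num.max M1 M2) => x /=; rewrite le_max /child.
by case: ifP => _; rewrite ?H1 ?H2 ?orbT.
Qed.

Lemma bx_integrable (phi : T * T -> R) n s B : nondeg B ->
  mu.-integrable (hbox B) (EFin \o (fun x => phi (bx n s B x))).
Proof.
move=> nB; apply: measurable_bounded_integrable.
- exact: measurable_hbox.
- exact: lebesgue_hbox_fin.
- by apply: (measurable_funS measurableT) => //; exact: measurable_bx.
- have [M HM] := bx_bounded phi n s B.
  by exists M; split; rewrite ?num_real// => y My x _ /=; apply: (le_trans (HM x)); exact: ltW.
Qed.

(** The martingale property of the averages: it holds on a single box by definition of [avg], and
    passes from the two halves to the whole. *)
Lemma Rintegral_avg_bx (u : T -> R) n s B : nondeg B -> mu.-integrable (hbox B) (EFin \o u) ->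
  \int[mu]_(x in hbox B) avg u (bx n s B x) = \int[mu]_(x in hbox B) u x.
Proof.
elim: n s B => [|n IH] s B nB iu.
  rewrite /= Rintegral_hbox_cst// /avg mulrAC mulVf ?mul1r// gt_eqF//.
  exact: vol_gt0.
rewrite (Rintegral_hbox_split (dir s))//; last exact: bx_integrable.
rewrite (Rintegral_hbox_split (dir s) nB iu); congr (_ + _).
  rewrite -(IH s.+1); first by apply: eq_Rintegral => x; rewrite inE => /(bx_lo n nB) ->.
    exact: nondeg_lo.
  apply: integrableS iu; [exact: measurable_hbox|exact: measurable_hbox|exact: hbox_lo_sub].
rewrite -(IH s.+1); first by apply: eq_Rintegral => x; rewrite inE => /(bx_hi n nB) ->.
  exact: nondeg_hi.
apply: integrableS iu; [exact: measurable_hbox|exact: measurable_hbox|exact: hbox_hi_sub].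
Qed.

End tree.

(** * Bisection boxes determine an integrable function *)

Section tree_density.
Context {R : realType} {m : nat}.
Notation T := 'rV[R]_m.+1.
Implicit Types (B : T * T) (x : T) (i : 'I_m.+1) (s n k : nat) (E : set T).
Notation mu := (@lebesgue_rV R m.+1).

(* Inside B, the set E is a union of boxes of generation n below B. *)
Fixpoint tree_set n s B E : Prop :=
  if n is n'.+1
  then tree_set n' s.+1 (lo (dir s) B) E /\ tree_set n' s.+1 (hi (dir s) B) E
  else hbox B `<=` E \/ hbox B `&` E = set0.

Lemma tree_setI n s B E E' :
  tree_set n s B E -> tree_set n s B E' -> tree_set n s B (E `&` E').
Proof.
elim: n s B => [|n IH] s B /=; last by move=> [h1 h2] [h3 h4]; split; exact: IH.
move=> [h1|h1] [h2|h2]; [left|right|right|right].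
- by move=> x Bx; split; [exact: h1|exact: h2].
- by rewrite setIA setIAC h2 set0I.
- by rewrite setIA h1 set0I.
- by rewrite setIA h1 set0I.
Qed.

Lemma tree_setS n s B E : nondeg B -> tree_set n s B E -> tree_set n.+1 s B E.
Proof.
elim: n s B => [|n IH] s B nB /=.
  have l := @hbox_lo_sub _ _ (dir s) B nB; have h := @hbox_hi_sub _ _ (dir s) B nB.
  move=> [H|H]; first by split; left; [exact: subset_trans H|exact: subset_trans H].
  have nE (A : set T) : A `<=` hbox B -> A `&` E = set0.
    move=> AB; apply/seteqP; split => x //= [/AB Bx Ex].
    by rewrite -[False]/(set0 x) -H; split.
  by split; right; exact: nE.
move=> [h1 h2]; split; apply: IH => //; [exact: nondeg_lo|exact: nondeg_hi].
Qed.

Lemma tree_set_bx (P : T * T -> Prop) n s B E : nondeg B ->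
  (forall x, hbox B x -> (E x <-> P (bx n s B x))) -> tree_set n s B E.
Proof.
elim: n s B => [|n IH] s B nB EP /=.
  have [h|h] := pselect (P B); first by left => x Bx; apply/(EP x Bx).
  by right; apply/seteqP; split => x //= [Bx /(EP x Bx)].
split.
  apply: IH => [|x Bx]; first exact: nondeg_lo.
  by rewrite -(bx_lo n nB Bx); apply: EP; exact: hbox_lo_sub Bx.
apply: IH => [|x Bx]; first exact: nondeg_hi.
by rewrite -(bx_hi n nB Bx); apply: EP; exact: hbox_hi_sub Bx.
Qed.

Lemma Rintegral_tree_set (z : T -> R) n s B E : nondeg B ->
  measurable E -> mu.-integrable (hbox B) (EFin \o z) ->
  (forall n x, hbox B x -> \int[mu]_(y in hbox (bx n s B x)) z y = 0) ->
  tree_set n s B E -> \int[mu]_(x in hbox B `&` E) z x = 0.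
Proof.
elim: n s B => [|n IH] s B nB mE iz z0 /=.
  move=> [BE|->]; last by rewrite Rintegral_set0.
  (* [bx 0 s B x] is [B] itself; the lower corner is a point of the half-open box at which the
     hypothesis can be applied. *)
  rewrite setIidl//; apply: (z0 0 B.1) => i.
  by rewrite /= in_itv/= lexx/=; exact: nB.
have l := @hbox_lo_sub _ _ (dir s) B nB; have h := @hbox_hi_sub _ _ (dir s) B nB.
move=> [h1 h2]; rewrite (hbox_split (dir s) nB) setIUl Rintegral_setU.
- rewrite (IH s.+1) ?(IH s.+1 (hi (dir s) B)) ?addr0//.
  + exact: nondeg_hi.
  + by apply: integrableS iz => //; exact: measurable_hbox.
  + move=> k x Bx; rewrite -(bx_hi k nB Bx); apply: z0; exact: h.
  + exact: nondeg_lo.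
  + by apply: integrableS iz => //; exact: measurable_hbox.
  + move=> k x Bx; rewrite -(bx_lo k nB Bx); apply: z0; exact: l.
- by apply: measurableI => //; exact: measurable_hbox.
- by apply: measurableI => //; exact: measurable_hbox.
- apply: integrableS iz; [exact: measurable_hbox| |].
    by apply: measurableU; apply: measurableI => //; exact: measurable_hbox.
  by move=> x [[Bx _]|[Bx _]]; [exact: l|exact: h].
- apply/disj_setPS => x [[h3 _] [h4 _]]; move: (hbox_disj (dir s) nB) => /disj_setPS.
  by apply; split; [exact: h3|exact: h4].
Qed.

Lemma side_cvg0 (Q : T * T) i :
  ((Q.2 ord0 i - Q.1 ord0 i) / 2 ^+ sidexp n i) @[n --> \oo] --> (0 : R).
Proof.
have geo : (2^-1 : R) ^+ k @[k --> \oo] --> (0 : R).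
  by apply: cvg_expr; rewrite ger0_norm; lra.
have ex : sidexp n i @[n --> \oo] --> \oo.
  move=> A [N _ NA]; exists (N * m.+1)%N => // n /= Nn; apply: NA => /=.
  rewrite /sidexp leq_divRL//; apply: (leq_trans Nn); exact: leq_addr.
rewrite -[X in _ --> X](mulr0 (Q.2 ord0 i - Q.1 ord0 i)).
apply: cvgM; first exact: cvg_cst.
rewrite (_ : (fun n => _) = (fun k => (2^-1 : R) ^+ k) \o (sidexp ^~ i)).
  exact: cvg_comp ex geo.
by apply/funext => n /=; rewrite exprVn.
Qed.

(** Half-spaces suffice. Inside [Q], a point satisfies a < x_i if and only if the lower corner of
    one of its boxes does, because the sides shrink to 0; each such condition is a [tree_set]. What
    lies outside [Q] is a [tree_set] of generation 0. *)
Lemma measurable_tree_generated (Q : T * T) : nondeg Q ->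
  @measurable _ T `<=`
  <<s [set E | measurable E /\ exists n, tree_set n 0 Q E] >>.
Proof.
move=> nQ; set G := [set E | _].
have h : measurable_fun [set: g_sigma_algebraType G] (id : g_sigma_algebraType G -> T).
  apply: measurable_fun_coor => i; apply: measurable_fun_gt => a; rewrite setTI.
  pose F n := hbox Q `&` [set x | a < (bx n 0 Q x).1 ord0 i].
  have -> : ((fun v : T => v ord0 i) \o id) @^-1` `]a, +oo[%classic =
      (\bigcup_n F n) `|` ([set x : T | a < x ord0 i] `\` hbox Q).
    apply/seteqP; split => x /=; rewrite in_itv/= andbT.
      move=> ax; have [Qx|Qx] := pselect (hbox Q x); last by right.
      left; have sx := @side_cvg0 Q i.
      have : \forall n \near \oo, (Q.2 ord0 i - Q.1 ord0 i) / 2 ^+ sidexp n i < x ord0 i - a.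
        by apply: (cvgr_lt 0 sx); rewrite subr_gt0.
      move=> [n _ /(_ n (leqnn n)) hn]; exists n => //; split => //=.
      have [_ bxx _] := hbox_bx n 0 nQ Qx.
      have [_ _ sd _] := in_tree_bx n (in_tree0 nQ) Qx.
      move: hn; rewrite -sd => hn; have := bxx i; rewrite /= in_itv/= => /andP[h1 h2].
      by lra.
    move=> [[n _ [Qx /= an]]|[]//].
    have [_ bxx _] := hbox_bx n 0 nQ Qx.
    by have := bxx i; rewrite /= in_itv/= => /andP[h1 _]; exact: lt_le_trans h1.
  have mG (E : set T) : G E -> measurable (E : set (g_sigma_algebraType G)).
    exact: sub_sigma_algebra.
  apply: measurableU; last first.
    apply: mG; split.
      apply: measurableD; last exact: measurable_hbox.
      have := @measurable_coor R m.+1 i measurableT `]a, +oo[%classic (measurable_itv _).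
      by rewrite setTI; congr measurable; apply/seteqP; split => x /=; rewrite in_itv/= andbT.
    exists 0 => /=; right; apply/seteqP; split => x //= [Qx []//].
  apply: bigcupT_measurable => n; apply: mG; split.
    apply: measurableI; first exact: measurable_hbox.
    have := @measurable_bx R m (fun B => B.1 ord0 i) n 0 Q measurableT `]a, +oo[%classic (measurable_itv _).
    by rewrite setTI; congr measurable; apply/seteqP; split => x /=; rewrite in_itv/= andbT.
  exists n; apply: (@tree_set_bx (fun B => a < B.1 ord0 i)) => // x Qx.
  by split => [[]|].
by move=> E mE; have := h measurableT E mE; rewrite setTI.
Qed.

(** A pi-lambda argument: two tree sets intersect in a tree set after refinement to a common
    generation, and the sets on which [z] integrates to 0 form a lambda-system, increasing unions
    being handled by dominated convergence. *)
Lemma Rintegral_tree_eq0 (z : T -> R) (Q : T * T) : nondeg Q ->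
  mu.-integrable (hbox Q) (EFin \o z) ->
  (forall n x, hbox Q x -> \int[mu]_(y in hbox (bx n 0 Q x)) z y = 0) ->
  forall E, measurable E -> \int[mu]_(x in hbox Q `&` E) z x = 0.
Proof.
move=> nQ iz z0 E mE; have mQ := measurable_hbox Q.
pose G := [set E : set T | measurable E /\ exists n, tree_set n 0 Q E].
pose H := [set E : set T | measurable E /\ \int[mu]_(x in hbox Q `&` E) z x = 0].
have IE E' : \int[mu]_(x in hbox Q `&` E') z x = \int[mu]_(x in hbox Q) (z x * \1_E' x).
  rewrite Rintegral_mkcondr; apply: eq_Rintegral => x _.
  by rewrite patchE indicE; case: ifP; rewrite ?mulr1 ?mulr0.
have GH : G `<=` H.
  by move=> E' [mE' [n tn]]; split => //; exact: Rintegral_tree_set tn.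
have GI : setI_closed G.
  move=> A A' [mA [n tA]] [mA' [n' tA']]; split; first exact: measurableI.
  have up k j A0 : tree_set k 0 Q A0 -> tree_set (k + j) 0 Q A0.
    by move=> tk; elim: j => [|j IH]; rewrite ?addn0// addnS; exact: tree_setS.
  exists (n + n')%N; apply: tree_setI; first exact: up.
  by rewrite addnC; exact: up.
have : <<s [set: T], G>> `<=` H.
  apply: (@lambda_system_subset _ G GI [set: T] H) => //.
  split => //.
  - split; first exact: measurableT.
    by rewrite setIT; apply: (z0 0 Q.1) => i; rewrite /= in_itv/= lexx/=; exact: nQ.
  - move=> A A' AA' [mA zA] [mA' zA']; split; first exact: measurableD.
    have := zA; rewrite -{1}(setDUK AA') setIUr Rintegral_setU.
    + by rewrite zA' add0r.
    + exact: measurableI.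
    + by apply: measurableI => //; exact: measurableD.
    + apply: integrableS iz => //; last by move=> x [[]|[]].
      by apply: measurableU; apply: measurableI => //; exact: measurableD.
    + by apply/disj_setPS => x [[_ h3] [_ [_ h4]]].
  - move=> F ndF HF; split; first by apply: bigcupT_measurable => i; case: (HF i).
    rewrite IE.
    have cv : \int[mu]_(x in hbox Q) (z x * \1_(F n) x) @[n --> \oo] -->
        \int[mu]_(x in hbox Q) (z x * \1_(\bigcup_n F n) x).
      have mz : measurable_fun (hbox Q) z by exact/measurable_EFinP/measurable_int/iz.
      apply: (@cvg_Rintegral_dominated _ _ _ _ _ _ _ (fun x => `|z x|)) => //.
      + move=> n; apply: measurable_funM => //; apply: measurable_indic; by case: (HF n).
      + apply: measurable_funM => //; apply: measurable_indic.
        by apply: bigcupT_measurable => i; case: (HF i).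
      + move=> x _; apply: cvgM; first exact: cvg_cst.
        have [[n _ Fx]|nF] := pselect ((\bigcup_n F n) x).
          apply: cvg_near_cst; exists n => // k /= nk.
          rewrite !indicE !mem_set//; [by exists n|].
          by have := ndF _ _ nk; rewrite subsetEset; apply.
        apply: cvg_near_cst; apply: nearW => k; rewrite !indicE !memNset//.
        by move=> Fx; apply: nF; exists k.
      + exact: (integrable_norm iz).
      + move=> n x _; rewrite normrM ler_piMr// indicE; case: (_ \in _); rewrite ?normr1 ?normr0//.
    rewrite -(cvg_lim _ cv)//; rewrite (_ : (fun n => _) = cst 0) ?lim_cst//.
    by apply/funext => n; rewrite -IE; case: (HF n).
by move=> /(_ E (measurable_tree_generated nQ mE))[].
Qed.

End tree_density.

Lemma eqW d (T : porderType d) (x y : T) : x = y -> (x <= y)%O.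
Proof. by move=> ->. Qed.

Section cauchy_schwarz.
Context d (T : measurableType d) (R : realType) (mu : {measure set T -> \bar R}).

Lemma integrable_cst_fin (D : set T) (c : R) : measurable D -> (mu D < +oo)%E ->
  mu.-integrable D (EFin \o (fun=> c)).
Proof.
move=> mD Dfin; apply: measurable_bounded_integrable => //.
by exists `|c|; split; rewrite ?num_real// => y cy x _; exact: ltW.
Qed.

Lemma integrable_addr (D : set T) (f g : T -> R) : measurable D ->
  mu.-integrable D (EFin \o f) -> mu.-integrable D (EFin \o g) ->
  mu.-integrable D (EFin \o (fun x => f x + g x)).
Proof. by move=> mD i1 i2; exact: (integrableD mD i1 i2). Qed.

Lemma integrable_subr (D : set T) (f g : T -> R) : measurable D ->
  mu.-integrable D (EFin \o f) -> mu.-integrable D (EFin \o g) ->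
  mu.-integrable D (EFin \o (fun x => f x - g x)).
Proof. by move=> mD i1 i2; exact: (integrableB mD i1 i2). Qed.

Lemma integrable_scaler (D : set T) (c : R) (f : T -> R) : measurable D ->
  mu.-integrable D (EFin \o f) -> mu.-integrable D (EFin \o (fun x => c * f x)).
Proof. by move=> mD i1; exact: (integrableZl mD c i1). Qed.

Lemma integrable_of_sqr (D : set T) (w : T -> R) : measurable D -> (mu D < +oo)%E ->
  measurable_fun D w -> mu.-integrable D (EFin \o (fun x => w x ^+ 2)) ->
  mu.-integrable D (EFin \o w).
Proof.
move=> mD D_fin mw iw2.
have ic : mu.-integrable D (EFin \o (fun x => 1 + w x ^+ 2)).
  by apply: integrable_addr => //; exact: integrable_cst_fin.
apply: le_integrable ic => //; first exact/measurable_EFinP.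
move=> x _; rewrite /= lee_fin [leRHS]ger0_norm ?addr_ge0 ?sqr_ge0//.
rewrite -[w x ^+ 2]real_normK ?num_real//.
have := sqr_ge0 (`|w x| - 1); have := normr_ge0 (w x); move: `|w x| => t.
nra.
Qed.

(** Cauchy-Schwarz against the constant 1: the integral of (|w| - l)^2 is nonnegative, and [l] is
    taken to be the mean of |w|, which minimizes it. *)
Lemma sqr_Rintegral_le (D : set T) (w : T -> R) (V : R) : measurable D -> 0 < V ->
  mu D = V%:E -> measurable_fun D w -> mu.-integrable D (EFin \o (fun x => w x ^+ 2)) ->
  (\int[mu]_(x in D) `|w x|) ^+ 2 <= V * \int[mu]_(x in D) (w x ^+ 2).
Proof.
move=> mD V0 muD mw iw2.
have D_fin : (mu D < +oo)%E by rewrite muD ltry.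
have iw := integrable_of_sqr mD D_fin mw iw2.
have ian : mu.-integrable D (EFin \o (fun x => `|w x|)) by exact: (integrable_norm iw).
set A := \int[mu]_(x in D) `|w x|; set S := \int[mu]_(x in D) _.
pose l := A / V.
have : 0 <= \int[mu]_(x in D) (w x ^+ 2 - 2 * l * `|w x| + l ^+ 2).
  apply: Rintegral_ge0 => x _.
  rewrite -[w x ^+ 2]real_normK ?num_real//.
  by have := sqr_ge0 (`|w x| - l); move: `|w x| => t; nra.
have il2 : mu.-integrable D (EFin \o (fun x => 2 * l * `|w x|)).
  exact: integrable_scaler.
have ic : mu.-integrable D (EFin \o (fun _ => l ^+ 2)).
  exact: integrable_cst_fin.
rewrite RintegralD//; last first.
  exact: integrable_subr.
rewrite RintegralB// RintegralZl// Rintegral_cst// muD /= -/A -/S /l => h.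
have : 0 <= V * (S - 2 * (A / V) * A + (A / V) ^+ 2 * V) by rewrite mulr_ge0// ltW.
rewrite (_ : V * _ = V * S - A ^+ 2); first by lra.
by field; rewrite gt_eqF.
Qed.

End cauchy_schwarz.

(** * Decay of the differences of averages *)

Section tree_estimate.
Context {R : realType} {m : nat}.
Notation T := 'rV[R]_m.+1.
Implicit Types (B : T * T) (x : T) (i : 'I_m.+1) (s n k : nat) (E : set T).
Notation mu := (@lebesgue_rV R m.+1).
Variables (Q : T * T) (u : T -> R) (w : 'I_m.+1 -> T -> R) (l : R).
Hypothesis nQ : nondeg Q.
Hypothesis Ql : forall i, Q.2 ord0 i - Q.1 ord0 i <= l.
Hypothesis iu : mu.-integrable (hbox Q) (EFin \o u).
Hypothesis mw : forall i, measurable_fun (hbox Q) (w i).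
Let W x := \sum_i w i x ^+ 2.
Hypothesis iW : mu.-integrable (hbox Q) (EFin \o W).
Hypothesis tent : forall i B, nondeg B -> hbox B `<=` hbox Q ->
  `|\int[mu]_(x in hbox (lo i B)) u x - \int[mu]_(x in hbox (hi i B)) u x| <=
  (B.2 ord0 i - B.1 ord0 i) / 2 * \int[mu]_(x in hbox B) `|w i x|.

Let IW B := \int[mu]_(x in hbox B) W x.

Lemma local_energy_ge0 B : 0 <= IW B.
Proof. by apply: Rintegral_ge0 => x _; apply: sumr_ge0 => i _; exact: sqr_ge0. Qed.

(** If a and b are the integrals of [u] over the halves, the averages over a half and over [B]
    differ by (a - b) / vol B up to sign, since 2 a - (a + b) = a - b. The tent estimate and
    Cauchy-Schwarz bound (a - b)^2. *)
Lemma lo_sub_avg i B : nondeg B -> hbox B `<=` hbox Q ->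
  (avg u (lo i B) - avg u B) ^+ 2 <=
    (B.2 ord0 i - B.1 ord0 i) ^+ 2 / 4 / vol B * IW B /\
  (avg u (hi i B) - avg u B) ^+ 2 <=
    (B.2 ord0 i - B.1 ord0 i) ^+ 2 / 4 / vol B * IW B.
Proof.
move=> nB BQ; have V0 := vol_gt0 nB.
have iB (f : T -> R) : mu.-integrable (hbox Q) (EFin \o f) -> mu.-integrable (hbox B) (EFin \o f).
  by move=> i_; apply: integrableS i_ => //; exact: measurable_hbox.
rewrite /avg vol_lo vol_hi (Rintegral_hbox_split i nB (iB _ iu)).
set a := \int[mu]_(x in hbox (lo i B)) u x; set b := \int[mu]_(x in hbox (hi i B)) u x.
have sd0 : 0 < B.2 ord0 i - B.1 ord0 i by rewrite subr_gt0; exact: nB.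
have ht := tent i nB BQ; rewrite -/a -/b in ht.
set sd := B.2 ord0 i - B.1 ord0 i in sd0 ht *.
have muB : mu (hbox B) = (vol B)%:E by apply: lebesgue_hbox => j; exact: ltW.
have iwi : mu.-integrable (hbox B) (EFin \o (fun x => w i x ^+ 2)).
  apply: le_integrable (iB _ iW) => //; first exact: measurable_hbox.
    apply/measurable_EFinP; apply: measurable_funX; apply: measurable_funS (mw i) => //.
    exact: measurable_hbox.
  move=> x _; rewrite /= lee_fin ger0_norm ?sqr_ge0// ger0_norm; last first.
    by apply: sumr_ge0 => j _; exact: sqr_ge0.
  by rewrite /W (bigD1 i)//= lerDl; apply: sumr_ge0 => j _; exact: sqr_ge0.
have cs : (\int[mu]_(x in hbox B) `|w i x|) ^+ 2 <= vol B * \int[mu]_(x in hbox B) (w i x ^+ 2).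
  apply: sqr_Rintegral_le => //; first exact: measurable_hbox.
  by apply: measurable_funS (mw i) => //; exact: measurable_hbox.
have leW : \int[mu]_(x in hbox B) (w i x ^+ 2) <= IW B.
  apply: le_Rintegral => //; [exact: measurable_hbox|exact: iB|].
  move=> x _; rewrite /W (bigD1 i)//= lerDl.
  by apply: sumr_ge0 => j _; exact: sqr_ge0.
set N := \int[mu]_(x in hbox B) `|w i x| in ht cs.
have N0 : 0 <= N by apply: Rintegral_ge0.
have ab2 : (a - b) ^+ 2 <= sd ^+ 2 / 4 * (vol B * IW B).
  rewrite -[(a - b) ^+ 2]real_normK ?num_real//.
  have h1 : `|a - b| ^+ 2 <= (sd / 2 * N) ^+ 2.
    by rewrite lerXn2r ?nnegrE// mulr_ge0// ltW// divr_gt0.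
  apply: (le_trans h1); rewrite exprMn.
  have -> : (sd / 2) ^+ 2 = sd ^+ 2 / 4 by field.
  rewrite ler_wpM2l ?divr_ge0 ?sqr_ge0//; apply: (le_trans cs).
  by rewrite ler_wpM2l// ltW.
have key : ((a - b) / vol B) ^+ 2 <= sd ^+ 2 / 4 / vol B * IW B.
  rewrite expr_div_n ler_pdivrMr ?exprn_gt0//.
  rewrite (_ : _ / _ * _ * _ = sd ^+ 2 / 4 * (vol B * IW B))//.
  by field; rewrite gt_eqF.
have Vn0 : vol B != 0 by rewrite gt_eqF.
split.
  by rewrite (_ : _ - _ = (a - b) / vol B)//; field.
by rewrite (_ : _ - _ = - ((a - b) / vol B)) ?sqrrN//; field.
Qed.

Section weight.
Variables (rho : T -> R) (R0 r : R).
Hypothesis mrho : measurable_fun (hbox Q) rho.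
Hypothesis rho0 : forall x, 0 <= rho x.
Hypothesis rhoB : forall B, nondeg B -> hbox B `<=` hbox Q ->
  (\int[mu]_(x in hbox B) (rho x)%:E <= (R0 * vol B `^ (1 - r))%:E)%E.
Hypothesis r0 : 0 <= r.

Let C := l ^+ 2 * R0 * vol Q `^ (- r).
Let kappa := 2 `^ (r - 2 / m.+1%:R).

Lemma mass_const_ge0 : 0 <= R0.
Proof.
have := rhoB nQ (@subset_refl _ _).
have : (0 <= \int[mu]_(x in hbox Q) (rho x)%:E)%E.
  by apply: integral_ge0 => x _; rewrite lee_fin.
move=> /le_trans/[apply]; rewrite lee_fin pmulr_lge0// powR_gt0//.
exact: vol_gt0.
Qed.

(** The coefficient from [lo_sub_avg] times the mass of the box: side^2 / vol * vol^(1 - r) is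
    side^2 * vol^(- r), with vol equal to [vol Q] / 2^s and the side about to be cut halved s /
    (m+1) times, rounded down. *)
Lemma side_const s B : in_tree Q s B ->
  (B.2 ord0 (dir s) - B.1 ord0 (dir s)) ^+ 2 / 4 / vol B * (R0 * vol B `^ (1 - r)) <= C * kappa ^+ s.
Proof.
move=> [nB BQ sB vB]; have V0 := vol_gt0 nB; have VQ := vol_gt0 nQ.
have -> : (B.2 ord0 (dir s) - B.1 ord0 (dir s)) ^+ 2 / 4 / vol B * (R0 * vol B `^ (1 - r)) =
   R0 * ((B.2 ord0 (dir s) - B.1 ord0 (dir s)) ^+ 2 / 4 * vol B `^ (- r)).
  rewrite powRD; last by apply/implyP => _; rewrite gt_eqF.
  rewrite powRr1; last exact: ltW.
  by field; rewrite gt_eqF.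
have -> : vol B `^ (- r) = vol Q `^ (- r) * (2 `^ r) ^+ s.
  rewrite vB powRM; [|exact: ltW|by rewrite invr_ge0 exprn_ge0]; congr (_ * _).
  by rewrite -powR_invn// -powRrM mulrNN -powR_mulrn ?powR_ge0// -powRrM mulrC.
have -> : kappa ^+ s = (2 `^ r) ^+ s * 2 `^ (- (2 / m.+1%:R * s%:R)).
  rewrite /kappa powRD; last by apply/implyP => _; rewrite pnatr_eq0.
  by rewrite exprMn -[in X in _ = _ * X]mulNr powRrM powR_mulrn// powR_ge0.
set X := vol Q `^ (- r); set Y := (2 `^ r) ^+ s; set Z := 2 `^ _.
have -> : C * (Y * Z) = l ^+ 2 * Z * (R0 * X * Y) by rewrite /C -/X; ring.
rewrite mulrCA (mulrA R0 X Y).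
have XY0 : 0 <= R0 * X * Y by rewrite !mulr_ge0 ?mass_const_ge0 ?exprn_ge0 ?powR_ge0.
apply: ler_wpM2r => //.
rewrite sB sidexp_dir expr_div_n -mulrA; apply: ler_pM.
- exact: sqr_ge0.
- by rewrite mulr_ge0// invr_ge0 exprn_ge0// exprn_ge0.
- have sd0 : 0 <= Q.2 ord0 (dir s) - Q.1 ord0 (dir s) by rewrite subr_ge0 ltW.
  by rewrite lerXn2r ?nnegrE//; exact: le_trans (Ql (dir s)).
rewrite /Z -invfM powRN lef_pV2 ?posrE ?powR_gt0 ?mulr_gt0 ?exprn_gt0//.
rewrite -exprM (_ : 4 = 2 ^+ 2); last by rewrite -natrX.
(* The factor 1/4 left by the tent estimate pays for the rounding: with d = m+1, the exponent 2 s /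
   d is at most 2 + 2 floor(s / d). *)
rewrite -exprD -powR_mulrn// ler_powR ?ler1n//.
rewrite mulrAC ler_pdivrMr ?ltr0n// -!natrM ler_nat.
rewrite {1}(divn_eq s m.+1).
have := ltn_pmod s (isT : (0 < m.+1)%N); nia.
Qed.

(** For n = 0 the increment is constant on each half and [side_const] applies. For larger [n] both
    the integral and the energy are additive over the halves, so summing over a whole generation
    costs no constant. *)
Lemma integral_bx_step n s B : in_tree Q s B ->
  (\int[mu]_(x in hbox B) ((avg u (bx n.+1 s B x) - avg u (bx n s B x)) ^+ 2 * rho x)%:E <=
   (C * kappa ^+ (s + n) * IW B)%:E)%E.
Proof.
elim: n s B => [|n IH] s B tB; have [nB BQ _ _] := tB; have mB := measurable_hbox B.
  rewrite addn0.
  have mrB : measurable_fun (hbox B) rho by apply: measurable_funS mrho => //; exact: measurable_hbox.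
  set K := (B.2 ord0 (dir s) - B.1 ord0 (dir s)) ^+ 2 / 4 / vol B * IW B.
  have K0 : 0 <= K.
    by rewrite mulr_ge0 ?local_energy_ge0// divr_ge0 ?divr_ge0 ?sqr_ge0// ltW// vol_gt0.
  apply: (@le_trans _ _ (K%:E * \int[mu]_(x in hbox B) (rho x)%:E)%E).
    rewrite -ge0_integralZl//; first last.
    - by move=> x _; rewrite lee_fin.
    - exact/measurable_EFinP.
    apply: ge0_le_integral => //.
    - by move=> x _; rewrite lee_fin mulr_ge0// sqr_ge0.
    - apply/measurable_EFinP; apply: measurable_funM => //; apply: measurable_funX.
      apply: (measurable_funS measurableT) => //.
      by apply: measurable_funB; [exact: (@measurable_bx _ _ (avg u) 1)|exact: (@measurable_bx _ _ (avg u) 0)].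
    - by apply/measurable_EFinP; apply: measurable_funM => //; exact: measurable_cst.
    - move=> x _; rewrite -EFinM lee_fin ler_wpM2r//= /child.
      by have [h1 h2] := lo_sub_avg (dir s) nB BQ; case: ifP.
  apply: (@le_trans _ _ (K%:E * (R0 * vol B `^ (1 - r))%:E)%E).
    by rewrite lee_wpmul2l// ?lee_fin//; exact: rhoB.
  by rewrite -EFinM lee_fin /K mulrAC ler_wpM2r ?local_energy_ge0//; exact: side_const.
rewrite (integral_hbox_split (dir s))//; first last.
- by move=> x _; rewrite lee_fin mulr_ge0// sqr_ge0.
- apply/measurable_EFinP; apply: measurable_funM.
    apply: (measurable_funS measurableT) => //; apply: measurable_funX.
    by apply: measurable_funB; [exact: (@measurable_bx _ _ (avg u) n.+2)|exact: (@measurable_bx _ _ (avg u) n.+1)].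
  by apply: measurable_funS mrho => //; exact: measurable_hbox.
have -> : IW B = IW (lo (dir s) B) + IW (hi (dir s) B).
  rewrite /IW (Rintegral_hbox_split (dir s) nB)//.
  by apply: integrableS iW => //; exact: measurable_hbox.
rewrite mulrDr EFinD -addSnnS; apply: leeD.
  apply: le_trans (IH s.+1 _ (in_tree_lo tB)).
  apply: eqW; apply: eq_integral => x.
  by rewrite inE => Bx; rewrite (bx_lo n.+1 nB Bx) (bx_lo n nB Bx).
apply: le_trans (IH s.+1 _ (in_tree_hi tB)).
apply: eqW; apply: eq_integral => x.
by rewrite inE => Bx; rewrite (bx_hi n.+1 nB Bx) (bx_hi n nB Bx).
Qed.

End weight.
End tree_estimate.

(** Cauchy-Schwarz with geometric weights: the square of the sum of the increments is at most the
    sum of lam^t times the sum of lam^-t times their squares. *)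
Lemma telescope_sqr {R : realFieldType} (e : nat -> R) (lam : R) (J N : nat) :
  0 < lam -> lam < 1 -> (J <= N)%N ->
  (e N - e J) ^+ 2 <=
  lam ^+ J / (1 - lam) * \sum_(J <= t < N) lam ^- t * (e t.+1 - e t) ^+ 2.
Proof.
move=> l0 l1 /subnKC <-; set k := (N - J)%N.
have l1' : 0 < 1 - lam by rewrite subr_gt0.
have S0 n : 0 <= \sum_(J <= t < n) lam ^- t * (e t.+1 - e t) ^+ 2.
  by apply: sumr_ge0 => t _; rewrite mulr_ge0 ?sqr_ge0// invr_ge0 exprn_ge0// ltW.
(* The induction runs with the exact partial geometric sum; the bound of the statement leaves no
   room for the next term. *)
apply: (@le_trans _ _ ((lam ^+ J - lam ^+ (J + k)) / (1 - lam) *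
    \sum_(J <= t < J + k) lam ^- t * (e t.+1 - e t) ^+ 2)); last first.
  by rewrite ler_wpM2r// ler_wpM2r ?invr_ge0 ?(ltW l1')// lerBlDr lerDl exprn_ge0// ltW.
elim: k => [|k IH]; first by rewrite addn0 !subrr expr0n/= mul0r mul0r.
rewrite addnS big_nat_recr/=; last exact: leq_addr.
set X := \sum_(J <= t < _) _ in IH *.
set d := e (J + k).+1 - e (J + k)%N; set A := e (J + k)%N - e J in IH.
have -> : e (J + k).+1 - e J = A + d by rewrite /A /d; ring.
set S := (lam ^+ J - lam ^+ (J + k)) / (1 - lam) in IH.
set p := lam ^+ (J + k).
have p0 : 0 < p by rewrite exprn_gt0.
have -> : (lam ^+ J - lam ^+ (J + k).+1) / (1 - lam) = S + p.
  by rewrite /S /p exprSr; field; rewrite gt_eqF.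
have X0 : 0 <= X by exact: S0.
have SS0 : 0 <= S.
  rewrite /S divr_ge0 ?(ltW l1')// subr_ge0 exprD ler_piMr ?exprn_ge0 ?(ltW l0)//.
  by rewrite exprn_ile1// ltW.
clearbody S p X d A.
have -> : (S + p) * (X + p^-1 * d ^+ 2) = S * X + (S * d ^+ 2 / p + p * X) + d ^+ 2.
  by field; rewrite gt_eqF.
suff : 2 * (A * d) <= S * d ^+ 2 / p + p * X by move=> h; nra.
(* Given A^2 <= S X, this is the arithmetic-geometric inequality. The case S = 0, which is the empty
   sum, is set apart because a factor S p is cancelled below. *)
move: SS0; rewrite le_eqVlt => /predU1P[S0'|SS0].
  have A0 : A = 0.
    by apply/eqP; rewrite -sqrf_eq0 eq_le sqr_ge0 andbT (le_trans IH)// -S0' mul0r.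
  by rewrite A0 mul0r mulr0 -S0' !mul0r add0r mulr_ge0// ltW.
have : 0 <= (S * d - p * A) ^+ 2 + p ^+ 2 * (S * X - A ^+ 2).
  by rewrite addr_ge0 ?sqr_ge0// mulr_ge0 ?sqr_ge0// subr_ge0.
have -> : (S * d - p * A) ^+ 2 + p ^+ 2 * (S * X - A ^+ 2) =
    (S * p) * (S * d ^+ 2 / p + p * X - 2 * (A * d)).
  by field; rewrite gt_eqF.
by rewrite pmulr_rge0 ?mulr_gt0// subr_ge0.
Qed.

Lemma geom_sum_le {R : realFieldType} (lam : R) (J N : nat) : 0 < lam -> lam < 1 -> (J <= N)%N ->
  \sum_(J <= t < N) lam ^+ t <= lam ^+ J / (1 - lam).
Proof.
move=> l0 l1 /subnKC <-; set k := (N - J)%N.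
have l1' : 0 < 1 - lam by rewrite subr_gt0.
rewrite ler_pdivlMr//.
suff -> : (\sum_(J <= t < J + k) lam ^+ t) * (1 - lam) = lam ^+ J - lam ^+ (J + k).
  by rewrite lerBlDr lerDl exprn_ge0// ltW.
elim: k => [|k IH]; first by rewrite addn0 big_geq// mul0r subrr.
by rewrite addnS big_nat_recr/= ?leq_addr// mulrDl IH exprSr; ring.
Qed.

Section summable_steps.
Context {R : realType} (e : nat -> R) (lam : R).
Hypotheses (lam0 : 0 < lam) (lam1 : lam < 1).
Let g : \bar R := (\sum_(0 <= t <oo) (lam ^- t * (e t.+1 - e t) ^+ 2)%:E)%E.
Hypothesis gfin : g \is a fin_num.

Let term_ge0 t : (0 <= (lam ^- t * (e t.+1 - e t) ^+ 2)%:E)%E.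
Proof. by rewrite lee_fin mulr_ge0 ?sqr_ge0// invr_ge0 exprn_ge0// ltW. Qed.

Lemma summable_steps_sqr J N : (J <= N)%N ->
  (e N - e J) ^+ 2 <= lam ^+ J / (1 - lam) * fine g.
Proof.
move=> JN; apply: (le_trans (telescope_sqr e lam0 lam1 JN)).
have l1' : 0 < 1 - lam by rewrite subr_gt0.
apply: ler_wpM2l; first by rewrite divr_ge0 ?exprn_ge0 ?ltW.
rewrite -lee_fin fineK// -sumEFin.
apply: (@le_trans _ _ (\sum_(0 <= t < N) (lam ^- t * (e t.+1 - e t) ^+ 2)%:E)%E); last first.
  exact: nneseries_lim_ge.
rewrite (big_cat_nat (leq0n J) JN)/= leeDr//.
exact: sume_ge0.
Qed.

(** The limit is written as an upper limit because, when [e] depends on a point, that expression is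
    measurable without knowing where the sequence converges. *)
Lemma summable_steps_cvg : e n @[n --> \oo] --> fine (limn_esup (fun n => (e n)%:E)).
Proof.
have : cvg (e n @[n --> \oo]).
  apply: cauchy_cvg; apply/cauchy_exP => eps eps0.
  have cv : lam ^+ J / (1 - lam) * fine g @[J --> \oo] --> (0 : R).
    rewrite -[X in _ --> X](mul0r (fine g)); apply: cvgM; last exact: cvg_cst.
    rewrite -[X in _ --> X](mul0r (1 - lam)^-1); apply: cvgM; last exact: cvg_cst.
    by apply: cvg_expr; rewrite ger0_norm// ltW.
  have : \forall J \near \oo, lam ^+ J / (1 - lam) * fine g < eps ^+ 2.
    by apply: (cvgr_lt 0 cv); rewrite exprn_gt0.
  move=> [J _ /(_ J (leqnn J)) hJ]; exists (e J); exists J => // N /= JN.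
  rewrite /ball/= distrC -(@ltr_pXn2r _ 2)// ?nnegrE ?normr_ge0 ?(ltW eps0)//.
  by rewrite real_normK ?num_real//; apply: le_lt_trans hJ; exact: summable_steps_sqr.
move=> /cvg_ex[a ca].
have ce : (e n)%:E @[n --> \oo] --> a%:E by apply: cvg_EFin => //; exact: nearW.
by rewrite (cvg_limn_einf_sup ce).2.
Qed.

End summable_steps.

Section tree_limit.
Context {R : realType} {m : nat}.
Notation T := 'rV[R]_m.+1.
Implicit Types (B : T * T) (x : T) (i : 'I_m.+1) (s n k : nat) (E : set T).
Notation mu := (@lebesgue_rV R m.+1).
Variables (Q : T * T) (u : T -> R) (w : 'I_m.+1 -> T -> R) (l : R).
Hypothesis nQ : nondeg Q.
Hypothesis Ql : forall i, Q.2 ord0 i - Q.1 ord0 i <= l.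
Hypothesis iu : mu.-integrable (hbox Q) (EFin \o u).
Hypothesis mw : forall i, measurable_fun (hbox Q) (w i).
Let W x := \sum_i w i x ^+ 2.
Hypothesis iW : mu.-integrable (hbox Q) (EFin \o W).
Hypothesis tent : forall i B, nondeg B -> hbox B `<=` hbox Q ->
  `|\int[mu]_(x in hbox (lo i B)) u x - \int[mu]_(x in hbox (hi i B)) u x| <=
  (B.2 ord0 i - B.1 ord0 i) / 2 * \int[mu]_(x in hbox B) `|w i x|.

Let IW := \int[mu]_(x in hbox Q) W x.
Let En n x := avg u (bx n 0 Q x).
Let mQ : measurable (hbox Q) := measurable_hbox Q.

Let mEn n : measurable_fun (hbox Q) (En n).
Proof. by apply: (measurable_funS measurableT) => //; exact: measurable_bx. Qed.

(** The square root divides the decay rate into two: one factor is spent on the weights lam^-t of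
    [telescope_sqr], the other keeps the weighted series geometric. *)
Let lam (r : R) := Num.sqrt (2 `^ (r - 2 / m.+1%:R) : R).

Let lam2 r : lam r ^+ 2 = 2 `^ (r - 2 / m.+1%:R).
Proof. by rewrite sqr_sqrtr// powR_ge0. Qed.

Let lam_gt0 r : 0 < lam r.
Proof. by rewrite sqrtr_gt0 powR_gt0. Qed.

Let powR2_lt1 (t : R) : t < 0 -> (2 : R) `^ t < 1.
Proof. by move=> t0; rewrite /powR pnatr_eq0/= -[X in _ < X]expR0 ltr_expR nmulr_rlt0// ln_gt0// ltr1n. Qed.

Let lam_lt1 r : r < 2 / m.+1%:R -> lam r < 1.
Proof. by move=> rm; rewrite -sqrtr1 ltr_sqrt// powR2_lt1// subr_lt0. Qed.

Let lamV0 r t : 0 <= lam r ^- t.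
Proof. by rewrite invr_ge0 exprn_ge0// ltW. Qed.

Section weight.
Variables (rho : T -> R) (R0 r : R).
Hypothesis mrho : measurable_fun (hbox Q) rho.
Hypothesis rho0 : forall x, 0 <= rho x.
Hypothesis rhoB : forall B, nondeg B -> hbox B `<=` hbox Q ->
  (\int[mu]_(x in hbox B) (rho x)%:E <= (R0 * vol B `^ (1 - r))%:E)%E.
Hypothesis r0 : 0 <= r.
Hypothesis rm : r < 2 / m.+1%:R.

Let C := l ^+ 2 * R0 * vol Q `^ (- r).

Lemma step_const_ge0 : 0 <= C.
Proof.
have R00 : 0 <= R0 := mass_const_ge0 nQ rho0 rhoB.
by apply: mulr_ge0; [apply: mulr_ge0 => //; exact: sqr_ge0|exact: powR_ge0].
Qed.

Lemma integral_scaled_step t :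
  (\int[mu]_(x in hbox Q) (lam r ^- t * (En t.+1 x - En t x) ^+ 2 * rho x)%:E <=
   (C * IW * lam r ^+ t)%:E)%E.
Proof.
under eq_integral do rewrite -mulrA EFinM.
rewrite ge0_integralZl//; first last.
- by rewrite lee_fin invr_ge0 exprn_ge0// ltW.
- by move=> x _; rewrite lee_fin mulr_ge0// sqr_ge0.
- apply/measurable_EFinP; apply: measurable_funM => //; apply: measurable_funX.
  exact: measurable_funB.
have := integral_bx_step nQ Ql iu mw iW tent mrho rho0 rhoB r0 t (in_tree0 nQ).
rewrite add0n -/C -/IW -lam2 -exprM mulnC exprM => h.
apply: (@le_trans _ _ ((lam r ^- t)%:E * (C * (lam r ^+ t) ^+ 2 * IW)%:E)%E).
  by rewrite lee_wpmul2l// lee_fin invr_ge0 exprn_ge0// ltW.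
rewrite -EFinM lee_fin; apply: eqW.
by field; rewrite expf_neq0// gt_eqF.
Qed.

Lemma integral_En_sub J N : (J <= N)%N ->
  (\int[mu]_(x in hbox Q) ((En N x - En J x) ^+ 2 * rho x)%:E <=
   (C * IW * (lam r ^+ J / (1 - lam r)) ^+ 2)%:E)%E.
Proof.
move=> JN; have l1 := lam_lt1 rm; have l1' : 0 < 1 - lam r by rewrite subr_gt0.
set c := lam r ^+ J / (1 - lam r).
have c0 : 0 <= c by rewrite divr_ge0 ?exprn_ge0 ?ltW.
have mf t : measurable_fun (hbox Q)
    (fun x => (lam r ^- t * (En t.+1 x - En t x) ^+ 2 * rho x)%:E).
  apply/measurable_EFinP; apply: measurable_funM => //; apply: measurable_funM => //.
  by apply: measurable_funX; exact: measurable_funB.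
have f0 t x : (0 <= (lam r ^- t * (En t.+1 x - En t x) ^+ 2 * rho x)%:E)%E.
  by rewrite lee_fin; apply: mulr_ge0 => //; apply: mulr_ge0; [exact: lamV0|exact: sqr_ge0].
apply: (@le_trans _ _ (\int[mu]_(x in hbox Q) (c%:E *
    \sum_(J <= t < N) (lam r ^- t * (En t.+1 x - En t x) ^+ 2 * rho x)%:E))%E).
  apply: ge0_le_integral => //.
  - by move=> x _; rewrite lee_fin mulr_ge0// sqr_ge0.
  - apply/measurable_EFinP; apply: measurable_funM => //; apply: measurable_funX.
    exact: measurable_funB.
  - apply: emeasurable_funM; first exact: measurable_cst.
    exact: emeasurable_sum.
  - move=> x _; rewrite sumEFin -EFinM lee_fin -mulr_suml mulrA ler_wpM2r//.
    exact: (telescope_sqr (fun n => En n x)).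
rewrite ge0_integralZl//; first last.
- by move=> x _; exact: sume_ge0.
- exact: emeasurable_sum.
rewrite ge0_integral_sum//.
apply: (@le_trans _ _ (c%:E * \sum_(J <= t < N) (C * IW * lam r ^+ t)%:E)%E).
  rewrite lee_wpmul2l//; apply: lee_sum => t _; exact: integral_scaled_step.
rewrite sumEFin -EFinM lee_fin -mulr_sumr mulrCA [leRHS](_ : _ = C * IW * (c * c)) ?expr2//.
apply: ler_wpM2l; first by rewrite mulr_ge0 ?step_const_ge0// local_energy_ge0.
by rewrite ler_wpM2l//; exact: geom_sum_le.
Qed.

End weight.

(** The weight 1 satisfies the mass bound with [r = 0] and constant 1. It gives convergence of the
    averages almost everywhere for Lebesgue measure, whatever [rho] is used afterwards. *)
Let l0 := lam 0.
Let l0_gt0 : 0 < l0 := lam_gt0 0.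
Let l0_lt1 : l0 < 1.
Proof. by apply: lam_lt1; rewrite divr_gt0. Qed.

Let g x : \bar R := (\sum_(0 <= t <oo) (l0 ^- t * (En t.+1 x - En t x) ^+ 2)%:E)%E.

Let g0 x : (0 <= g x)%E.
Proof.
by apply: nneseries_ge0 => t _ _; rewrite lee_fin mulr_ge0 ?sqr_ge0 ?lamV0.
Qed.

Let mg : measurable_fun (hbox Q) g.
Proof.
apply: ge0_emeasurable_sum => [t x _ _|t _].
  by rewrite lee_fin mulr_ge0 ?sqr_ge0 ?lamV0.
apply/measurable_EFinP; apply: measurable_funM => //; apply: measurable_funX.
exact: measurable_funB.
Qed.

Let ig : mu.-integrable (hbox Q) g.
Proof.
apply/integrableP; split => //.
under eq_integral do rewrite gee0_abs//.
have one0 : forall x : T, 0 <= (fun=> 1) x :> R by [].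
have one1 : forall B, nondeg B -> hbox B `<=` hbox Q ->
  (\int[mu]_(x in hbox B) ((fun=> 1) x)%:E <= (1 * vol B `^ (1 - 0))%:E)%E.
  move=> B nB _; rewrite integral_cst; last exact: measurable_hbox.
  rewrite mul1e lebesgue_hbox; last by move=> i; exact: ltW.
  by rewrite subr0 mul1r powRr1// ltW// vol_gt0.
rewrite integral_nneseries//; first last.
- by move=> t x _; rewrite lee_fin mulr_ge0 ?sqr_ge0 ?lamV0.
- move=> t; apply/measurable_EFinP; apply: measurable_funM => //; apply: measurable_funX.
  exact: measurable_funB.
set K := l ^+ 2 * 1 * vol Q `^ (- 0) * IW.
apply: (@le_lt_trans _ _ (\sum_(0 <= t <oo) (K * l0 ^+ t)%:E)%E).
  apply: lee_nneseries => [t _ _|t _].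
    apply: integral_ge0 => x _.
    by rewrite lee_fin mulr_ge0 ?sqr_ge0 ?lamV0.
  have := @integral_scaled_step (fun=> 1) 1 0 (measurable_cst _) one0 one1 (lexx _) t.
  apply: le_trans; apply: eqW.
  by apply: eq_integral => x _; rewrite mulr1.
have K0 : 0 <= K.
  by rewrite mulr_ge0 ?local_energy_ge0//; exact: (step_const_ge0 one0 one1).
apply: (@le_lt_trans _ _ (K / (1 - l0))%:E); last exact: ltry.
apply: lime_le.
  by apply: is_cvg_nneseries => t _ _; rewrite lee_fin mulr_ge0// exprn_ge0// ltW.
apply: nearW => n; rewrite sumEFin lee_fin -mulr_sumr ler_wpM2l//.
by have := geom_sum_le l0_gt0 l0_lt1 (leq0n n); rewrite expr0 mul1r.
Qed.

Let En_cauchy x J N : (J <= N)%N -> g x \is a fin_num ->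
  (En N x - En J x) ^+ 2 <= l0 ^+ J / (1 - l0) * fine (g x).
Proof. by move=> JN gx; exact: (summable_steps_sqr l0_gt0 l0_lt1 gx JN). Qed.

Let v x := fine (limn_esup (fun n => (En n x)%:E)).

Let En_cvg x : g x \is a fin_num -> En n x @[n --> \oo] --> v x.
Proof. by move=> gx; exact: (summable_steps_cvg l0_gt0 l0_lt1 gx). Qed.

Let mv : measurable_fun (hbox Q) v.
Proof.
apply: (measurableT_comp (@fine_measurable R setT measurableT)).
by apply: measurable_fun_limn_esup => n; exact/measurable_EFinP.
Qed.

Let g_ae : \forall x \ae mu, hbox Q x -> g x \is a fin_num.
Proof. exact: (integrable_ae mQ ig). Qed.

Let dct E : measurable E -> E `<=` hbox Q ->
  mu.-integrable E (EFin \o v) /\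
  \int[mu]_(x in E) En n x @[n --> \oo] --> \int[mu]_(x in E) v x.
Proof.
move=> mE EQ.
(* The dominating function: |E_n| <= |E_0| + 1 + (E_n - E_0)^2, and the square is at most g / (1 -
   l0). *)
have gE : mu.-integrable E (fun x => (`|En 0 x| + 1)%:E + (1 - l0)^-1%:E * g x)%E.
  apply: (integrableS mQ mE EQ); apply: integrableD => //; last exact: (integrableZl mQ _ ig).
  apply: (integrable_addr mQ (f := fun x => `|En 0 x|) (g := fun=> 1)).
    exact: (integrable_norm (@bx_integrable _ _ (avg u) 0 0 Q nQ)).
  by apply: integrable_cst_fin => //; exact: lebesgue_hbox_fin.
have [] := @dominated_convergence _ _ _ mu E mE (fun n => EFin \o En n) (EFin \o v) _ _ _ _ gE.
- by move=> n; apply/measurable_EFinP; exact: (measurable_funS mQ EQ).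
- by apply/measurable_EFinP; exact: (measurable_funS mQ EQ).
- apply: filterS g_ae => x gx Ex; apply: cvg_EFin; first exact: nearW.
  by apply: En_cvg; apply: gx; exact: EQ.
- apply: filterS g_ae => x gx n Ex; have {}gx := gx (EQ _ Ex).
  rewrite -(fineK gx) -EFinM -EFinD lee_fin.
  have := En_cauchy (leq0n n) gx; rewrite expr0 mul1r -real_normK ?num_real//.
  move: (_^-1 * _) => c h.
  have : `|En n x - En 0 x| <= 1 + c.
    have := sqr_ge0 (`|En n x - En 0 x| - 1).
    by move: h; move: `|_| => t h1 h2; nra.
  have := ler_distD (En 0 x) (En n x) 0; rewrite !subr0.
  by move=> h1 h2; apply: (le_trans h1); rewrite addrC -addrA lerD2l.
move=> iv _ cv; split => //.
by apply: fine_cvg; rewrite fineK; [exact: cv|exact: integrable_fin_num].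
Qed.

(** The averages converge almost everywhere to some [v]. On a box of generation n their integrals
    are constant from generation n on, by the martingale property, so [v] and [u] have the same
    integral over every box; [Rintegral_tree_eq0] then identifies them. *)
Lemma En_ae_cvg : \forall x \ae mu, hbox Q x -> En n x @[n --> \oo] --> u x.
Proof.
have iv : mu.-integrable (hbox Q) (EFin \o v) by have [] := dct mQ (@subset_refl _ _).
have eqB n x : hbox Q x -> \int[mu]_(y in hbox (bx n 0 Q x)) (u y - v y) = 0.
  move=> Qx; have [nb _ bQ] := hbox_bx n 0 nQ Qx; have mb := measurable_hbox (bx n 0 Q x).
  have [ivb cv] := dct mb bQ.
  have iub : mu.-integrable (hbox (bx n 0 Q x)) (EFin \o u) by exact: (integrableS mQ mb bQ).
  rewrite RintegralB//; apply/eqP; rewrite subr_eq0; apply/eqP.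
  apply: (cvg_unique _ _ cv) => //.
  apply: cvg_near_cst; exists n => // N /= nN.
  rewrite -(Rintegral_avg_bx (N - n) (0 + n) nb iub); apply: eq_Rintegral => y; rewrite inE => by_.
  by rewrite /En -[in LHS](subnKC nN) (bx_add _ nQ Qx by_).
have iz : mu.-integrable (hbox Q) (EFin \o (fun x => u x - v x)) by exact: integrable_subr.
have z0 := Rintegral_tree_eq0 nQ iz eqB.
have uv : ae_eq mu (hbox Q) (EFin \o u) (EFin \o v).
  apply: integral_ae_eq => //; first by apply/measurable_EFinP.
  move=> E EQ mE; have := z0 E mE; rewrite setIidr// RintegralB//; last 2 first.
  - exact: (integrableS mQ mE EQ).
  - exact: (integrableS mQ mE EQ).
  move=> /eqP; rewrite subr_eq0 /Rintegral => /eqP h.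
  rewrite -[LHS]fineK; last by apply: integrable_fin_num => //; exact: (integrableS mQ mE EQ).
  rewrite -[RHS]fineK; last by apply: integrable_fin_num => //; exact: (integrableS mQ mE EQ).
  by congr (_%:E).
apply: filterS2 g_ae uv => x gx uvx Qx; have [->] := uvx Qx.
by apply: En_cvg; exact: gx.
Qed.

(** Fatou's lemma in [integral_En_sub] as N grows, the averages of generation N tending to [u]
    almost everywhere. *)
Lemma integral_sub_En (rho : T -> R) (R0 r : R) J :
  measurable_fun (hbox Q) rho -> (forall x, 0 <= rho x) ->
  (forall B, nondeg B -> hbox B `<=` hbox Q ->
    (\int[mu]_(x in hbox B) (rho x)%:E <= (R0 * vol B `^ (1 - r))%:E)%E) ->
  0 <= r -> r < 2 / m.+1%:R ->
  (\int[mu]_(x in hbox Q) ((u x - avg u (bx J 0 Q x)) ^+ 2 * rho x)%:E <=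
   (l ^+ 2 * R0 * vol Q `^ (- r) * \int[mu]_(x in hbox Q) (\sum_i w i x ^+ 2) *
    (lam r ^+ J / (1 - lam r)) ^+ 2)%:E)%E.
Proof.
move=> mrho rho0 rhoB r0 rm.
have muQ : measurable_fun (hbox Q) u by exact/measurable_EFinP/measurable_int/iu.
pose F N x := ((En N x - En J x) ^+ 2 * rho x)%:E.
have mF N : measurable_fun (hbox Q) (F N).
  apply/measurable_EFinP; apply: measurable_funM => //; apply: measurable_funX.
  exact: measurable_funB.
have F0 N x : hbox Q x -> (0 <= F N x)%E by move=> _; rewrite lee_fin mulr_ge0// sqr_ge0.
rewrite (@ae_eq_integral _ _ _ mu _ (fun x => limn_einf (F ^~ x)))//; last 3 first.
- apply/measurable_EFinP; apply: measurable_funM => //; apply: measurable_funX.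
  exact: (measurable_funB muQ (mEn J)).
- apply: (measurableT_comp (@oppe_measurable R setT)).
  by apply: measurable_fun_limn_esup => n; exact: measurableT_comp.
- apply: filterS En_ae_cvg => x ux Qx; apply/esym.
  apply: (cvg_limn_einf_sup _).1; apply: cvg_EFin; first exact: nearW.
  apply: cvgM; last exact: cvg_cst.
  rewrite expr2; under eq_cvg do rewrite expr2.
  by apply: cvgM; apply: cvgB; [exact: ux|exact: cvg_cst|exact: ux|exact: cvg_cst].
apply: (le_trans (fatou mu mQ mF F0)).
rewrite limn_einf_lim; apply: lime_le; first exact: is_cvg_einfs.
(* The lower limit is an infimum over indices at least [n], while the estimate wants an index at
   least [J]; [maxn n J] is both. *)
apply: nearW => n; apply: ereal_inf_le; exists (\int[mu]_(x in hbox Q) F (maxn n J) x)%E.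
  by exists (maxn n J) => //=; exact: leq_maxl.
by apply: integral_En_sub => //; exact: leq_maxr.
Qed.

End tree_limit.

(** * Compactness on a box with an integrable weight *)

(** The image of [F] is an ultrafilter containing a compact segment, hence it converges; the
    sequence stays within d / 2 of the limit on a set of [F]. *)
Lemma ultra_cauchy {R : realType} (F : set_system nat) (a : nat -> R) (M : R) (d : R) :
  UltraFilter F -> (forall k, `|a k| <= M) -> 0 < d ->
  exists A, F A /\ forall k l, A k -> A l -> `|a k - a l| <= d.
Proof.
move=> FU aM d0; have FP : ProperFilter F by exact: ultra_proper.
have aU : UltraFilter (a @ F).
  split; first exact: fmap_proper_filter.
  move=> G GP aG; apply/seteqP; split => P; last exact: aG.
  move=> GPP.
  have [//|h] := in_ultra_setVsetC (a @^-1` P) FU.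
  have GC : G (~` P) by exact: aG.
  have GPC : G (P `&` ~` P) by exact: (filterI GPP GC).
  by have [x [Px nPx]] := filter_ex GPC.
have := @segment_compact R (- M) M; rewrite compact_ultra => /(_ _ aU).
have aI : (a @ F) `[- M, M]%classic.
  have : F (a @^-1` `[- M, M]%classic).
    apply: (@filterS _ F _ setT) => [k _|]; last exact: filterT.
    by rewrite /= in_itv/= -ler_norml.
  by [].
move=> /(_ aI)[p [_ ap]].
have Fp : F (a @^-1` ball p (d / 2)).
  by apply: ap; apply: nbhsx_ballx; rewrite divr_gt0.
exists (a @^-1` ball p (d / 2)); split => // k l.
rewrite /ball/= => h1 h2; rewrite distrC in h1.
by rewrite (le_trans (ler_distD p _ _))// (splitr d) lerD// ltW.
Qed.

Section box_lemmas.
Context {R : realType} {m : nat}.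
Notation T := 'rV[R]_m.+1.
Implicit Types (B Q : T * T) (x : T) (i : 'I_m.+1).
Notation mu := (@lebesgue_rV R m.+1).

Lemma hboxD B : hbox B `\` (hbox B `\` obox B) = obox B.
Proof. by rewrite setDD setIidr//; exact: sub_oh. Qed.

Lemma ge0_integral_hbox B (f : T -> \bar R) : nondeg B -> measurable_fun (hbox B) f ->
  (forall x, hbox B x -> 0 <= f x)%E ->
  (\int[mu]_(x in hbox B) f x = \int[mu]_(x in obox B) f x)%E.
Proof.
move=> nB mf f0; rewrite -[in RHS](hboxD B); apply: ge0_negligible_integral => //.
- by apply: measurableD; [exact: measurable_hbox|exact: measurable_obox].
- exact: measurable_hbox.
- by apply: lebesgue_hboxDobox => i; exact: ltW.
Qed.

Lemma Rintegral_hbox B (f : T -> R) : nondeg B -> mu.-integrable (hbox B) (EFin \o f) ->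
  \int[mu]_(x in hbox B) f x = \int[mu]_(x in obox B) f x.
Proof.
move=> nB if_; rewrite /Rintegral -[in RHS](hboxD B); congr fine.
apply: negligible_integral => //.
- by apply: measurableD; [exact: measurable_hbox|exact: measurable_obox].
- exact: measurable_hbox.
- by apply: lebesgue_hboxDobox => i; exact: ltW.
Qed.

Lemma hbox_obox_sub B Q : nondeg B -> hbox B `<=` hbox Q -> obox B `<=` obox Q.
Proof.
move=> nB BQ x Bx i; have := Bx i; have := BQ _ (sub_oh Bx) i.
have cB : hbox B B.1 by move=> j; rewrite /= in_itv/= lexx/=; exact: nB.
have := BQ _ cB i; rewrite /= !in_itv/= => /andP[h1 _] /andP[_ ->] /andP[h2 _].
by rewrite andbT; exact: le_lt_trans h2.
Qed.

Lemma nondeg_le_sub B Q : nondeg B -> hbox B `<=` hbox Q ->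
  forall i, B.2 ord0 i - B.1 ord0 i <= Q.2 ord0 i - Q.1 ord0 i.
Proof.
move=> nB BQ i.
have cB : hbox B B.1 by move=> j; rewrite /= in_itv/= lexx/=; exact: nB.
have := BQ _ cB i; rewrite /= in_itv/= => /andP[h1 h2].
suff : B.2 ord0 i <= Q.2 ord0 i by lra.
rewrite leNgt; apply/negP => h.
(* If [B] extended beyond [Q] in direction [i], this point would lie in [B] but on the excluded
   upper face of [Q]. *)
have : hbox B (upd B.1 i (Q.2 ord0 i)).
  move=> j; rewrite /= mxE in_itv/=; case: eqVneq => [->|_].
    by rewrite h ltW.
  by rewrite lexx/=; exact: nB.
by move=> /BQ /(_ i); rewrite /= mxE eqxx in_itv/= ltxx andbF.
Qed.

Definition shrink (t : R) Q : T * T :=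
  (Q.1 + t *: (Q.2 - Q.1), Q.2 - t *: (Q.2 - Q.1)).

Lemma nondeg_shrink t Q : nondeg Q -> t < 2^-1 -> nondeg (shrink t Q).
Proof. by move=> nQ t1 i; rewrite /= !mxE; have := nQ i; nra. Qed.

Lemma shrink_sub t t' Q : nondeg Q -> t' <= t -> hbox (shrink t Q) `<=` hbox (shrink t' Q).
Proof.
move=> nQ tt x h i; have := h i; rewrite /= !in_itv/= !mxE => /andP[h1 h2].
by have := nQ i => ?; apply/andP; split; nra.
Qed.

Lemma shrink_cbox t Q : nondeg Q -> 0 < t -> cbox (shrink t Q) `<=` obox Q.
Proof.
move=> nQ t0 x h i; have := h i; rewrite /= !in_itv/= !mxE => /andP[h1 h2].
by have := nQ i => ?; apply/andP; split; nra.
Qed.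

(** Starting at 1/4 keeps every shrunken box nondegenerate and makes all of them contain the middle
    box [shrink 4^-1 Q]. *)
Lemma obox_shrink Q x : nondeg Q -> obox Q x ->
  \forall j \near \oo, hbox (shrink (j.+4%:R)^-1 Q) x.
Proof.
move=> nQ Qx; apply: (@filter_forall _ 'I_m.+1 (fun i j =>
  `[(shrink (j.+4%:R)^-1 Q).1 ord0 i, (shrink (j.+4%:R)^-1 Q).2 ord0 i[%classic (x ord0 i))) => i.
have := Qx i; rewrite /= in_itv/= => /andP[h1 h2]; have nQi := nQ i.
set s := Q.2 ord0 i - Q.1 ord0 i.
have s0 : 0 < s by rewrite subr_gt0.
have near1 (c : R) : 0 < c -> \forall j \near \oo, (j.+4%:R)^-1 * s < c.
  move=> c0; near=> j; rewrite mulrC ltr_pdivrMr// mulrC -ltr_pdivrMr//.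
  apply: (@lt_trans _ _ j.+1%:R); last by rewrite ltr_nat; lia.
  by near: j; exact: nbhs_infty_gtrS.
near=> j; rewrite in_itv/= !mxE -/s.
have a1 : (j.+4%:R)^-1 * s < x ord0 i - Q.1 ord0 i.
  by near: j; apply: near1; rewrite subr_gt0.
have a2 : (j.+4%:R)^-1 * s < Q.2 ord0 i - x ord0 i.
  by near: j; apply: near1; rewrite subr_gt0.
move: (_ * s) a1 a2 => z a1 a2; apply/andP; split; lra.
Unshelve. all: by end_near. Qed.

Lemma obox_bigcup_shrink Q : nondeg Q -> obox Q = \bigcup_j cbox (shrink (j.+4%:R)^-1 Q).
Proof.
move=> nQ; apply/seteqP; split => [x Qx|x [j _ h]].
  have [j _ /(_ j (leqnn j)) h] := obox_shrink nQ Qx.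
  by exists j => //; exact: sub_hc.
by apply: (shrink_cbox nQ _ h); rewrite invr_gt0.
Qed.

Lemma locally_integrable_measurable (O : set T) (h : T -> R) Q : nondeg Q ->
  obox Q `<=` O -> locally_integrable_on O h -> measurable_fun (obox Q) h.
Proof.
move=> nQ QO lh; rewrite (obox_bigcup_shrink nQ); apply/measurable_fun_bigcup.
  by move=> j; exact: measurable_cbox.
move=> j; apply/measurable_EFinP/measurable_int/lh; first exact: compact_cbox.
by apply: subset_trans QO; apply: shrink_cbox => //; rewrite invr_gt0.
Qed.

End box_lemmas.

Lemma integral_2D d (T : measurableType d) (R : realType) (mu : {measure set T -> \bar R})
    (D : set T) (f g : T -> R) : measurable D -> measurable_fun D f -> measurable_fun D g ->
  (forall x, 0 <= f x) -> (forall x, 0 <= g x) ->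
  (\int[mu]_(x in D) (2 * f x + 2 * g x)%:E =
   2%:E * \int[mu]_(x in D) (f x)%:E + 2%:E * \int[mu]_(x in D) (g x)%:E)%E.
Proof.
move=> mD mf mg f0 g0.
have m2 (h : T -> R) : measurable_fun D h -> measurable_fun D (fun x => (2 * h x)%:E).
  by move=> mh; apply/measurable_EFinP; apply: measurable_funM => //; exact: measurable_cst.
under eq_integral do rewrite EFinD.
rewrite ge0_integralD//; last 4 first.
- by move=> x _; rewrite lee_fin mulr_ge0.
- exact: m2.
- by move=> x _; rewrite lee_fin mulr_ge0.
- exact: m2.
by congr (_ + _)%E; under eq_integral do rewrite EFinM; rewrite ge0_integralZl//;
  [exact/measurable_EFinP|move=> x _; rewrite lee_fin|exact/measurable_EFinP|move=> x _; rewrite lee_fin].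
Qed.

Lemma sqr_le_2D {R : realFieldType} (a b : R) : a ^+ 2 <= 2 * (a - b) ^+ 2 + 2 * b ^+ 2.
Proof. by have := sqr_ge0 (a - 2 * b); nra. Qed.

Lemma sqrB_le_2D {R : realFieldType} (a b : R) : (a + b) ^+ 2 <= 2 * a ^+ 2 + 2 * b ^+ 2.
Proof. by have := sqr_ge0 (a - b); nra. Qed.

Section box_compactness.
Context {R : realType} {m : nat}.
Notation T := 'rV[R]_m.+1.
Implicit Types (B : T * T) (x : T) (i : 'I_m.+1).
Notation mu := (@lebesgue_rV R m.+1).
Variables (O : set T) (Q : T * T).
Hypothesis nQ : nondeg Q.
Hypothesis QO : obox Q `<=` O.

Let mQ : measurable (obox Q) := measurable_obox Q.

Let l : R := \sum_i (Q.2 ord0 i - Q.1 ord0 i).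
Let Ql i : Q.2 ord0 i - Q.1 ord0 i <= l.
Proof.
rewrite /l (bigD1 i)//= lerDl; apply: sumr_ge0 => j _.
by rewrite subr_ge0 ltW.
Qed.

Lemma weak_partial_hbox (u w : T -> R) i B : weak_partial O i u w -> nondeg B ->
  obox B `<=` O -> mu.-integrable (hbox B) (EFin \o u) -> mu.-integrable (hbox B) (EFin \o w) ->
  `|\int[mu]_(x in hbox (lo i B)) u x - \int[mu]_(x in hbox (hi i B)) u x| <=
  (B.2 ord0 i - B.1 ord0 i) / 2 * \int[mu]_(x in hbox B) `|w x|.
Proof.
move=> wp nB BO iu iw; have mhB := measurable_hbox B; have moB := measurable_obox B.
rewrite (Rintegral_hbox (nondeg_lo i nB)); last first.
  by apply: (integrableS mhB _ _ iu); [exact: measurable_hbox|exact: hbox_lo_sub].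
rewrite (Rintegral_hbox (nondeg_hi i nB)); last first.
  by apply: (integrableS mhB _ _ iu); [exact: measurable_hbox|exact: hbox_hi_sub].
rewrite (Rintegral_hbox nB); last exact: (integrable_norm iw).
apply: weak_partial_tent wp nB BO _ _.
  exact: (integrableS mhB moB (@sub_oh _ _ B) iu).
exact: (integrableS mhB moB (@sub_oh _ _ B) iw).
Qed.

Section one_function.
Variables (u : T -> R) (w : 'I_m.+1 -> T -> R) (D : R).
Hypothesis wp : forall i, weak_partial O i u (w i).
Hypothesis WD : (\int[mu]_(x in obox Q) (\sum_i w i x ^+ 2)%:E <= D%:E)%E.

Let mu_u : measurable_fun (obox Q) u.
Proof. by have [lu _ _] := wp ord0; exact: locally_integrable_measurable lu. Qed.

Let mw i : measurable_fun (obox Q) (w i).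
Proof. by have [_ lw _] := wp i; exact: locally_integrable_measurable lw. Qed.

Let W x := \sum_i w i x ^+ 2.
Let W0 x : 0 <= W x.
Proof. by apply: sumr_ge0 => i _; exact: sqr_ge0. Qed.

Let mW : measurable_fun (obox Q) W.
Proof. by apply: measurable_sum => i; apply: measurable_funX. Qed.

Let iW : mu.-integrable (obox Q) (EFin \o W).
Proof.
apply/integrableP; split; first exact/measurable_EFinP.
under eq_integral do rewrite gee0_abs ?lee_fin//.
exact: le_lt_trans WD (ltry _).
Qed.

Let IWD B : hbox B `<=` obox Q -> \int[mu]_(x in hbox B) W x <= D.
Proof.
move=> BQ; rewrite -lee_fin /Rintegral fineK; last first.
  apply: integrable_fin_num; first exact: measurable_hbox.
  by apply: integrableS iW => //; exact: measurable_hbox.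
apply: le_trans WD; apply: ge0_subset_integral => //; first exact: measurable_hbox.
  exact/measurable_EFinP.
by move=> x _; rewrite lee_fin.
Qed.

Let D0 : 0 <= D.
Proof.
rewrite -lee_fin; apply: le_trans WD; apply: integral_ge0 => x _.
by rewrite lee_fin; exact: W0.
Qed.

Let lam (r : R) := Num.sqrt (2 `^ (r - 2 / m.+1%:R) : R).
Definition poincare_const := l ^+ 2 * (1 - lam 0)^-1 ^+ 2.

(** The approximation estimate at generation 0, with weight 1. It is applied on shrunken boxes
    because [u] and [w] are only known to be integrable on compact subsets. The constant does not
    involve [t]: each side is at most [l]. *)
Lemma poincare_shrink t : 0 < t -> t < 2^-1 ->
  (\int[mu]_(x in hbox (shrink t Q)) ((u x - avg u (shrink t Q)) ^+ 2)%:E <=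
   (poincare_const * D)%:E)%E.
Proof.
move=> t0 t1; set B := shrink t Q.
have nB : nondeg B by exact: nondeg_shrink.
have BQ : hbox B `<=` obox Q.
  by apply: subset_trans (shrink_cbox nQ t0); exact: sub_hc.
have mB := measurable_hbox B.
have cB : compact (cbox B) by exact: compact_cbox.
have cBO : cbox B `<=` O by apply: subset_trans QO; exact: shrink_cbox.
have iu : mu.-integrable (hbox B) (EFin \o u).
  have [lu _ _] := wp ord0; have := lu _ cB cBO.
  by apply: integrableS => //; [exact: measurable_cbox|exact: sub_hc].
have iw i : mu.-integrable (hbox B) (EFin \o w i).
  have [_ lw _] := wp i; have := lw _ cB cBO.
  by apply: integrableS => //; [exact: measurable_cbox|exact: sub_hc].
have sB := nondeg_le_sub nB (subset_trans BQ (@sub_oh _ _ Q)).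
have tentB i B' : nondeg B' -> hbox B' `<=` hbox B ->
  `|\int[mu]_(x in hbox (lo i B')) u x - \int[mu]_(x in hbox (hi i B')) u x| <=
  (B'.2 ord0 i - B'.1 ord0 i) / 2 * \int[mu]_(x in hbox B') `|w i x|.
  move=> nB' B'B; have mB' := measurable_hbox B'.
  apply: (weak_partial_hbox (wp i) nB').
  - by apply: subset_trans (subset_trans BQ QO); apply: subset_trans B'B; exact: sub_oh.
  - exact: (integrableS mB mB' B'B).
  - exact: (integrableS mB mB' B'B).
have one1 B' : nondeg B' -> hbox B' `<=` hbox B ->
  (\int[mu]_(x in hbox B') ((fun=> 1) x)%:E <= (1 * vol B' `^ (1 - 0))%:E)%E.
  move=> nB' _; rewrite integral_cst; last exact: measurable_hbox.
  rewrite mul1e lebesgue_hbox; last by move=> i; exact: ltW.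
  by rewrite subr0 mul1r powRr1// ltW// vol_gt0.
have m0 : (0 : R) < 2 / m.+1%:R by rewrite divr_gt0.
have := @integral_sub_En R m B u w l nB (fun i => le_trans (sB i) (Ql i)) iu
  (fun i => measurable_funS mQ BQ (mw i)) (integrableS mQ mB BQ iW) tentB (fun=> 1) 1 0 0
  (measurable_cst _) (fun=> ler01) one1 (lexx _) m0.
move=> h; apply: (@le_trans _ _ _ _ _ (le_trans _ h)).
  apply: eqW.
  by apply: eq_integral => x _; rewrite mulr1.
rewrite lee_fin oppr0 powRr0 !mulr1 expr0 mul1r /poincare_const -/lam.
rewrite mulrAC ler_wpM2l ?IWD//.
by rewrite mulr_ge0 ?sqr_ge0.
Qed.

Variables (rho : T -> R) (c0 : R).
Hypothesis mrho : measurable_fun (obox Q) rho.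
Hypothesis rho0 : forall x, obox Q x -> 0 < rho x.
Hypothesis c0_gt0 : 0 < c0.
Hypothesis rhoc0 : forall x, hbox (shrink 4^-1 Q) x -> c0 <= rho x.
Hypothesis uD : (\int[mu]_(x in obox Q) (u x ^+ 2 * rho x)%:E <= D%:E)%E.

Let M := poincare_const * D.
(** Write a for the average over a shrunken box and K0 for the middle box. From u^2 <= 2 (u - a)^2 +
    2 a^2 comes 2 M + 2 [vol Q] a^2. The quotient bounds a^2: integrate a^2 <= 2 u^2 + 2 (u - a)^2
    over K0, where [c0 <= rho] turns the weighted bound on u into D / c0. *)
Definition L2_const := 2 * M + 2 * vol Q * ((2 * (D / c0) + 2 * M) / vol (shrink 4^-1 Q)).

Let K0 := shrink 4^-1 Q.
Let nK0 : nondeg K0.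
Proof. by apply: nondeg_shrink => //; lra. Qed.

Let K0Q : hbox K0 `<=` obox Q.
Proof.
by apply: subset_trans (subset_trans (@sub_hc _ _ _) (shrink_cbox nQ _)) _.
Qed.

Let M0 : 0 <= M.
Proof. by apply: mulr_ge0 => //; apply: mulr_ge0; exact: sqr_ge0. Qed.

Let int_K0 : (\int[mu]_(x in hbox K0) (u x ^+ 2)%:E <= (D / c0)%:E)%E.
Proof.
have mK0 := measurable_hbox K0.
have muK := measurable_funS mQ K0Q mu_u.
apply: (@le_trans _ _ (\int[mu]_(x in hbox K0) (c0^-1%:E * (u x ^+ 2 * rho x)%:E))%E).
  apply: ge0_le_integral => //.
  - by move=> x _; rewrite lee_fin sqr_ge0.
  - by apply/measurable_EFinP; exact: measurable_funX.
  - apply: emeasurable_funM; first exact: measurable_cst.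
    apply/measurable_EFinP; apply: measurable_funM; first exact: measurable_funX.
    exact: (measurable_funS mQ K0Q).
  - move=> x Kx; rewrite -EFinM lee_fin mulrCA ler_peMr ?sqr_ge0//.
    by rewrite mulrC ler_pdivlMr// mul1r; exact: rhoc0.
rewrite ge0_integralZl//; last 3 first.
- apply/measurable_EFinP; apply: measurable_funM; first exact: measurable_funX.
  exact: (measurable_funS mQ K0Q).
- by move=> x Kx; rewrite lee_fin mulr_ge0 ?sqr_ge0// ltW// rho0//; exact: K0Q.
- by rewrite lee_fin invr_ge0 ltW.
rewrite mulrC EFinM lee_wpmul2l ?lee_fin ?invr_ge0 ?(ltW c0_gt0)//.
apply: le_trans uD; apply: ge0_subset_integral => //.
  apply/measurable_EFinP; apply: measurable_funM => //; exact: measurable_funX.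
by move=> x Qx; rewrite lee_fin mulr_ge0 ?sqr_ge0// ltW// rho0.
Qed.

Let int_shrink t : 0 < t -> t <= 4^-1 ->
  (\int[mu]_(x in hbox (shrink t Q)) (u x ^+ 2)%:E <= L2_const%:E)%E.
Proof.
move=> t0 t4; set B := shrink t Q; set a := avg u B.
have t2 : t < 2^-1 by lra.
have nB : nondeg B by exact: nondeg_shrink.
have BQ : hbox B `<=` obox Q.
  by apply: subset_trans (shrink_cbox nQ t0); exact: sub_hc.
have mB := measurable_hbox B; have mK0 := measurable_hbox K0.
have K0B : hbox K0 `<=` hbox B by exact: shrink_sub.
have muB := measurable_funS mQ BQ mu_u; have muK := measurable_funS mQ K0Q mu_u.
have PB : (\int[mu]_(x in hbox B) ((u x - a) ^+ 2)%:E <= M%:E)%E by exact: poincare_shrink.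
have mua E : measurable_fun E u -> measurable_fun E (fun x => (u x - a) ^+ 2).
  by move=> mE; apply: measurable_funX; apply: measurable_funB => //; exact: measurable_cst.
have PK : (\int[mu]_(x in hbox K0) ((u x - a) ^+ 2)%:E <= M%:E)%E.
  apply: le_trans PB; apply: ge0_subset_integral => //.
    by apply/measurable_EFinP; exact: mua.
  by move=> x _; rewrite lee_fin sqr_ge0.
have a2 : a ^+ 2 <= (2 * (D / c0) + 2 * M) / vol K0.
  rewrite ler_pdivlMr ?vol_gt0// -lee_fin.
  rewrite EFinM -(lebesgue_hbox (B := K0)); last by move=> i; exact: ltW.
  rewrite -integral_cst//.
  apply: (@le_trans _ _ (\int[mu]_(x in hbox K0) (2 * u x ^+ 2 + 2 * (u x - a) ^+ 2)%:E)%E).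
    apply: ge0_le_integral => //.
    - by move=> x _; rewrite lee_fin sqr_ge0.
    - apply/measurable_EFinP; apply: measurable_funD; apply: measurable_funM => //.
      + exact: measurable_funX.
      + exact: mua.
    - move=> x _; rewrite lee_fin; have := sqr_le_2D a (u x).
      by rewrite -[(a - u x) ^+ 2]sqrrN opprB addrC.
  rewrite integral_2D//; [|exact: measurable_funX|exact: mua|by move=> x; rewrite sqr_ge0|by move=> x; rewrite sqr_ge0].
  rewrite (EFinD (2 * (D / c0)) (2 * M)) (EFinM 2 (D / c0)) (EFinM 2 M).
  apply: leeD.
    by apply: lee_wpmul2l; [rewrite lee_fin|exact: int_K0].
  by apply: lee_wpmul2l; [rewrite lee_fin|exact: PK].
apply: (@le_trans _ _ (\int[mu]_(x in hbox B) (2 * (u x - a) ^+ 2 + 2 * a ^+ 2)%:E)%E).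
  apply: ge0_le_integral => //.
  - by move=> x _; rewrite lee_fin sqr_ge0.
  - by apply/measurable_EFinP; exact: measurable_funX.
  - apply/measurable_EFinP; apply: measurable_funD => //; apply: measurable_funM => //.
    exact: mua.
  - by move=> x _; rewrite lee_fin; exact: sqr_le_2D.
rewrite integral_2D//; [|exact: mua|by move=> x; rewrite sqr_ge0|by move=> x; rewrite sqr_ge0].
have iB : (\int[mu]_(x in hbox B) (a ^+ 2)%:E)%E = (a ^+ 2 * vol B)%:E.
  by rewrite integral_cst// lebesgue_hbox// => i; exact: ltW.
rewrite iB; apply: (@le_trans _ _ (2%:E * M%:E + 2%:E * (a ^+ 2 * vol B)%:E)%E).
  apply: leeD; last exact: lexx.
  by apply: lee_wpmul2l; [rewrite lee_fin|exact: PB].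
rewrite -(EFinM 2 M) -(EFinM 2 (a ^+ 2 * vol B)) -(EFinD (2 * M)) lee_fin.
rewrite /L2_const -/M lerD2l -mulrA ler_wpM2l//.
rewrite mulrC; apply: ler_pM => //; [by rewrite ltW// vol_gt0|exact: sqr_ge0|].
rewrite /vol; apply: ler_prod => i _; rewrite subr_ge0 ltW//=.
by rewrite !mxE; have := nQ i; nra.
Qed.

(** The bound on shrunken boxes is uniform and these boxes exhaust [obox Q]; Fatou's lemma
    concludes. *)
Lemma L2_bound : (\int[mu]_(x in obox Q) (u x ^+ 2)%:E <= L2_const%:E)%E.
Proof.
pose B j := shrink (j.+4%:R)^-1 Q.
have B4 j : (j.+4%:R)^-1 <= 4^-1 :> R by rewrite lef_pV2 ?posrE// ler_nat.
have Bp j : 0 < (j.+4%:R)^-1 :> R by rewrite invr_gt0.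
have BQ j : hbox (B j) `<=` obox Q.
  by apply: subset_trans (shrink_cbox nQ (Bp j)); exact: sub_hc.
pose F j x : \bar R := (u x ^+ 2 * \1_(hbox (B j)) x)%:E.
have mF j : measurable_fun (obox Q) (F j).
  apply/measurable_EFinP; apply: measurable_funM; first exact: measurable_funX.
  by apply: measurable_indic; exact: measurable_hbox.
have F0 j x : obox Q x -> (0 <= F j x)%E by move=> _; rewrite lee_fin mulr_ge0// sqr_ge0.
rewrite (@eq_integral _ _ _ _ _ (fun x => limn_einf (F ^~ x))); last first.
  move=> x; rewrite inE => Qx; apply/esym; apply: (cvg_limn_einf_sup _).1.
  have [j _ hj] := obox_shrink nQ Qx.
  apply: cvg_near_cst; exists j => // k /= jk.
  by rewrite /F indicE mem_set ?mulr1//; exact: hj.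
apply: (le_trans (fatou mu mQ mF F0)).
rewrite limn_einf_lim; apply: lime_le; first exact: is_cvg_einfs.
apply: nearW => n; apply: ereal_inf_le; exists (\int[mu]_(x in obox Q) F n x)%E.
  by exists n => /=.
rewrite /F (_ : (\int[mu]_(x in obox Q) _)%E = (\int[mu]_(x in hbox (B n)) (u x ^+ 2)%:E)%E).
  exact: int_shrink.
rewrite -[in RHS](setIidr (BQ n)) integral_mkcondr; apply: eq_integral => x _.
by rewrite patchE indicE; case: ifP => _; rewrite ?mulr1 ?mulr0.
Qed.

End one_function.
End box_compactness.

(** Truncation at height t: where a > t, a = a^p a^(1 - p) <= a^p t^(1 - p). *)
Lemma young_weight {R : realType} (a t p : R) : 0 <= a -> 0 < t -> 1 <= p ->
  a <= t + t `^ (1 - p) * a `^ p.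
Proof.
move=> a0 t0 p1; have [at_|ta] := leP a t.
  by apply: (le_trans at_); rewrite lerDl mulr_ge0 ?powR_ge0.
have {}a0 : 0 < a by exact: lt_trans ta.
apply: (@le_trans _ _ (t `^ (1 - p) * a `^ p)); last by rewrite lerDr ltW.
rewrite -opprB powRN mulrC ler_pdivlMr ?powR_gt0//.
have -> : a `^ p = a * a `^ (p - 1).
  rewrite -{2}(powRr1 (ltW a0)) -powRD; last by apply/implyP => _; rewrite gt_eqF.
  by congr (_ `^ _); ring.
apply: ler_wpM2l; first exact: ltW.
by apply: ge0_ler_powR; rewrite ?nnegrE ?subr_ge0 ?(ltW a0) ?(ltW t0) ?(ltW ta).
Qed.

Lemma integrable_patch d (T : measurableType d) (R : realType) (mu : {measure set T -> \bar R})
    (A D : set T) (f : T -> R) : measurable A -> measurable D ->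
  mu.-integrable A (EFin \o f) -> mu.-integrable D (EFin \o (f \_ A)).
Proof.
move=> mA mD; rewrite -restrict_EFin integrable_mkcond// => h.
exact: (integrableS measurableT mD _ h).
Qed.

Section box_sequence.
Context {R : realType} {m : nat}.
Notation T := 'rV[R]_m.+1.
Implicit Types (B : T * T) (x : T) (i : 'I_m.+1) (k : nat).
Notation mu := (@lebesgue_rV R m.+1).
Variables (O : set T) (Q : T * T).
Hypothesis nQ : nondeg Q.
Hypothesis QO : obox Q `<=` O.
Variables (rho : T -> R) (c0 p P : R).
Hypothesis mrho : measurable_fun (obox Q) rho.
Hypothesis rho0 : forall x, obox Q x -> 0 < rho x.
Hypothesis c0_gt0 : 0 < c0.
Hypothesis rhoc0 : forall x, hbox (shrink 4^-1 Q) x -> c0 <= rho x.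
Hypothesis p1 : 1 <= p.
Hypothesis pm : m.+1%:R / 2 < p.
Hypothesis rhoP : (\int[mu]_(x in obox Q) (rho x `^ p)%:E <= P%:E)%E.

Let mQ : measurable (obox Q) := measurable_obox Q.
Let mhQ : measurable (hbox Q) := measurable_hbox Q.
(** Extension by zero, as for [u1] and [w1] below: the tree estimates are about half-open boxes and
    a weight nonnegative everywhere, while the data are controlled on the open box. The added faces
    are null. *)
Let rho1 := rho \_ (obox Q).

Let rho1_ge0 x : 0 <= rho1 x.
Proof. by rewrite /rho1 patchE; case: ifPn => //; rewrite inE => /rho0/ltW. Qed.

Let mrho1 : measurable_fun setT rho1.
Proof. by apply/(measurable_restrictT rho mQ). Qed.

Let P0 : 0 <= P.
Proof.
rewrite -lee_fin; apply: le_trans rhoP; apply: integral_ge0 => x _.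
by rewrite lee_fin powR_ge0.
Qed.

Let r := p^-1.
Let R0 := 1 + P.

Lemma weight_bound B : nondeg B -> hbox B `<=` hbox Q ->
  (\int[mu]_(x in hbox B) (rho1 x)%:E <= (R0 * vol B `^ (1 - r))%:E)%E.
Proof.
move=> nB BQ; have V0 := vol_gt0 nB; have mB := measurable_hbox B.
have p0 : 0 < p by exact: lt_le_trans p1.
(* This height balances the two terms of [young_weight] after integration: both t * vol and t^(1 -
   p) equal vol^(1 - r), because r p = 1. The sum of the constants is [R0]. *)
pose t := vol B `^ (- r); have t0 : 0 < t by exact: powR_gt0.
have mp : measurable_fun setT (fun x => rho1 x `^ p).
  by apply: (measurableT_comp (measurable_powR p)).
apply: (@le_trans _ _ (\int[mu]_(x in hbox B) (t%:E + (t `^ (1 - p))%:E * (rho1 x `^ p)%:E))%E).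
  apply: ge0_le_integral => //.
  - by move=> x _; rewrite lee_fin.
  - by apply/measurable_EFinP; exact: (measurable_funS measurableT).
  - apply: emeasurable_funD; first exact: measurable_cst.
    apply: emeasurable_funM; first exact: measurable_cst.
    by apply/measurable_EFinP; exact: (measurable_funS measurableT).
  - by move=> x _; rewrite -EFinM -EFinD lee_fin; exact: young_weight.
have mpB : measurable_fun (hbox B) (fun x => (rho1 x `^ p)%:E).
  by apply/measurable_EFinP; exact: (measurable_funS measurableT).
have rp0 x : (0 <= (rho1 x `^ p)%:E)%E by rewrite lee_fin powR_ge0.
rewrite ge0_integralD//; last 3 first.
- by move=> x _; rewrite lee_fin ltW.
- by move=> x _; rewrite mule_ge0// lee_fin powR_ge0.
- by apply: emeasurable_funM; first exact: measurable_cst.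
rewrite integral_cst// lebesgue_hbox; last by move=> i; exact: ltW.
rewrite ge0_integralZl//; last by rewrite lee_fin powR_ge0.
have IP : (\int[mu]_(x in hbox B) (rho1 x `^ p)%:E <= P%:E)%E.
  apply: le_trans rhoP; rewrite (ge0_integral_hbox nB)//.
  have BQ' := hbox_obox_sub nB BQ.
  apply: (@le_trans _ _ (\int[mu]_(x in obox B) (rho x `^ p)%:E)%E).
    apply: eqW; apply: eq_integral => x; rewrite inE => Bx.
    by rewrite /rho1 patchE mem_set//; exact: BQ'.
  apply: ge0_subset_integral => //; first exact: measurable_obox.
    by apply/measurable_EFinP; exact: (measurableT_comp (measurable_powR p) mrho).
  by move=> x _; rewrite lee_fin powR_ge0.
apply: (@le_trans _ _ (t%:E * (vol B)%:E + (t `^ (1 - p))%:E * P%:E)%E).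
  by apply: leeD; [exact: lexx|apply: lee_wpmul2l => //; rewrite lee_fin powR_ge0].
rewrite -EFinM -EFinM -EFinD lee_fin.
have -> : t * vol B = vol B `^ (1 - r).
  rewrite powRD; last by apply/implyP => _; rewrite gt_eqF.
  by rewrite powRr1 ?(ltW V0)// mulrC.
have -> : t `^ (1 - p) = vol B `^ (1 - r).
  rewrite /t -powRrM; congr (_ `^ _); rewrite /r; field; by rewrite gt_eqF.
by rewrite /R0 mulrDl mul1r [P * _]mulrC.
Qed.

Variables (u : nat -> T -> R) (w : nat -> 'I_m.+1 -> T -> R) (D : R).
Hypothesis wp : forall k i, weak_partial O i (u k) (w k i).
Hypothesis uD : forall k, (\int[mu]_(x in obox Q) (u k x ^+ 2 * rho x)%:E <= D%:E)%E.
Hypothesis WD : forall k, (\int[mu]_(x in obox Q) (\sum_i w k i x ^+ 2)%:E <= D%:E)%E.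

Let mu_u k : measurable_fun (obox Q) (u k).
Proof. by have [lu _ _] := wp k ord0; exact: locally_integrable_measurable lu. Qed.

Let mw k i : measurable_fun (obox Q) (w k i).
Proof. by have [_ lw _] := wp k i; exact: locally_integrable_measurable lw. Qed.

Let u1 k := u k \_ (obox Q).
Let w1 k i := w k i \_ (obox Q).
Let K := L2_const Q D c0.

Let Qfin : (mu (obox Q) < +oo)%E.
Proof. by rewrite lebesgue_obox ?ltry// => i; exact: ltW. Qed.

Let u_L2 k : (\int[mu]_(x in obox Q) (u k x ^+ 2)%:E <= K%:E)%E.
Proof. exact: (L2_bound nQ QO (wp k) (WD k) mrho rho0 c0_gt0 rhoc0 (uD k)). Qed.

Let iu2 k : mu.-integrable (obox Q) (EFin \o (fun x => u k x ^+ 2)).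
Proof.
apply/integrableP; split; first by apply/measurable_EFinP; exact: measurable_funX.
under eq_integral do rewrite gee0_abs ?lee_fin ?sqr_ge0//.
exact: le_lt_trans (u_L2 k) (ltry _).
Qed.

Let iu k : mu.-integrable (obox Q) (EFin \o u k).
Proof. exact: integrable_of_sqr. Qed.

Let iW k : mu.-integrable (obox Q) (EFin \o (fun x => \sum_i w k i x ^+ 2)).
Proof.
apply/integrableP; split.
  by apply/measurable_EFinP; apply: measurable_sum => i; exact: measurable_funX.
under eq_integral.
  by move=> x _; rewrite gee0_abs ?lee_fin; [over|apply: sumr_ge0 => i _; exact: sqr_ge0].
exact: le_lt_trans (WD k) (ltry _).
Qed.

Let iw k i : mu.-integrable (obox Q) (EFin \o w k i).
Proof.
apply: integrable_of_sqr => //; apply: le_integrable (iW k) => //.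
  by apply/measurable_EFinP; exact: measurable_funX.
move=> x _; rewrite /= lee_fin ger0_norm ?sqr_ge0// ger0_norm; last first.
  by apply: sumr_ge0 => j _; exact: sqr_ge0.
by rewrite (bigD1 i)//= lerDl; apply: sumr_ge0 => j _; exact: sqr_ge0.
Qed.

Let iu1 k : mu.-integrable (hbox Q) (EFin \o u1 k).
Proof. exact: integrable_patch. Qed.

Let iw1 k i : mu.-integrable (hbox Q) (EFin \o w1 k i).
Proof. exact: integrable_patch. Qed.

Let on_obox (f : T -> R) B : nondeg B -> hbox B `<=` hbox Q ->
  mu.-integrable (hbox Q) (EFin \o (f \_ (obox Q))) ->
  \int[mu]_(x in hbox B) (f \_ (obox Q)) x = \int[mu]_(x in obox B) f x.
Proof.
move=> nB BQ if_; rewrite Rintegral_hbox//; last first.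
  by apply: (integrableS mhQ _ BQ) => //; exact: measurable_hbox.
apply: eq_Rintegral => x; rewrite inE => Bx.
by rewrite patchE mem_set//; exact: (hbox_obox_sub nB BQ).
Qed.

Let u1_obox k B : nondeg B -> hbox B `<=` hbox Q ->
  \int[mu]_(x in hbox B) u1 k x = \int[mu]_(x in obox B) u k x.
Proof. by move=> nB BQ; exact: (on_obox nB BQ (iu1 k)). Qed.

Let tent1 k i B : nondeg B -> hbox B `<=` hbox Q ->
  `|\int[mu]_(x in hbox (lo i B)) u1 k x - \int[mu]_(x in hbox (hi i B)) u1 k x| <=
  (B.2 ord0 i - B.1 ord0 i) / 2 * \int[mu]_(x in hbox B) `|w1 k i x|.
Proof.
move=> nB BQ; have BoQ := hbox_obox_sub nB BQ.
have lQ := subset_trans (@hbox_lo_sub _ _ i _ nB) BQ.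
have hQ := subset_trans (@hbox_hi_sub _ _ i _ nB) BQ.
rewrite (u1_obox k (nondeg_lo i nB) lQ) (u1_obox k (nondeg_hi i nB) hQ).
have -> : \int[mu]_(x in hbox B) `|w1 k i x| = \int[mu]_(x in obox B) `|w k i x|.
  rewrite Rintegral_hbox//; last first.
    have mB := measurable_hbox B.
    exact: (integrable_norm (integrableS mhQ mB BQ (iw1 k i))).
  apply: eq_Rintegral => x; rewrite inE => Bx.
  by rewrite /w1 patchE mem_set//; exact: BoQ.
have mB := measurable_obox B.
apply: (weak_partial_tent (wp k i) nB).
- exact: subset_trans BoQ QO.
- exact: (integrableS mQ mB BoQ (iu k)).
- exact: (integrableS mQ mB BoQ (iw k i)).
Qed.

Let avg_bound : exists M, forall k B, nondeg B -> hbox B `<=` hbox Q ->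
  `|avg (u1 k) B| <= (vol B)^-1 * M.
Proof.
have VQ : mu (obox Q) = (vol Q)%:E by apply: lebesgue_obox => i; exact: ltW.
(* If t is the integral of |u k| over [obox Q], Cauchy-Schwarz gives t^2 <= vol Q * K, and t <= 1 +
   t^2. *)
exists (1 + vol Q * K) => k B nB BQ.
have V0' := vol_gt0 nB.
rewrite /avg normrM ger0_norm ?invr_ge0 ?(ltW V0')//.
apply: ler_wpM2l; first by rewrite invr_ge0 ltW.
rewrite u1_obox//.
have mB := measurable_obox B; have BoQ := hbox_obox_sub nB BQ.
apply: (le_trans (le_normr_Rintegral mB (integrableS mQ mB BoQ (iu k)))).
set I := Rintegral _ _ _.
have : I <= \int[mu]_(x in obox Q) `|u k x|.
  rewrite /I /Rintegral fine_le//.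
  - apply: integrable_fin_num => //.
    exact: (integrable_norm (integrableS mQ mB BoQ (iu k))).
  - by apply: integrable_fin_num => //; exact: (integrable_norm (iu k)).
  - apply: ge0_subset_integral => //.
    by apply/measurable_EFinP; exact: measurableT_comp.
move=> /le_trans; apply.
have := sqr_Rintegral_le mQ (vol_gt0 nQ) VQ (mu_u k) (iu2 k).
have : \int[mu]_(x in obox Q) (u k x ^+ 2) <= K.
  rewrite -lee_fin /Rintegral fineK//; by apply: integrable_fin_num => //; exact: iu2.
have V0 := vol_gt0 nQ.
set s := \int[mu]_(x in obox Q) (u k x ^+ 2); set t := \int[mu]_(x in obox Q) _.
move=> h1 h2.
have : vol Q * s <= vol Q * K by rewrite ler_wpM2l// ltW.
by have := sqr_ge0 (t - 1); nra.
Qed.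

Variable F : set_system nat.
Hypothesis FU : UltraFilter F.

(** This is the finite-dimensional part. At generation 0 the averages form a bounded real sequence,
    to which [ultra_cauchy] applies; each cut then intersects two members of [F], which is where one
    filter serving all boxes pays off. *)
Let sub_avg_small n s B eps : nondeg B -> hbox B `<=` hbox Q -> 0 < eps ->
  exists A, F A /\ forall k l, A k -> A l ->
   (\int[mu]_(x in hbox B) ((avg (u1 k) (bx n s B x) - avg (u1 l) (bx n s B x)) ^+ 2 * rho1 x)%:E
     <= eps%:E)%E.
Proof.
have FP : ProperFilter F by exact: ultra_proper.
have mf k l n' s' B' : measurable_fun (hbox B')
    (fun x => ((avg (u1 k) (bx n' s' B' x) - avg (u1 l) (bx n' s' B' x)) ^+ 2 * rho1 x)%:E).
  apply/measurable_EFinP; apply: (measurable_funS measurableT) => //.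
  apply: measurable_funM => //; apply: measurable_funX.
  exact: (@measurable_bx _ _ (fun B => avg (u1 k) B - avg (u1 l) B)).
elim: n s B eps => [|n IH] s B eps nB BQ e0.
  have [M HM] := avg_bound.
  set V := R0 * vol B `^ (1 - r).
  have V0 : 0 <= V by rewrite mulr_ge0 ?powR_ge0// addr_ge0.
  (* With t <= 1 one has t^2 V <= t (V + 1) <= eps; adding 1 to [V] avoids a division by zero. *)
  pose d := Num.min 1 (eps / (V + 1)).
  have V1 : 0 < V + 1 by rewrite ltr_wpDl.
  have d0 : 0 < d by rewrite lt_min ltr01 divr_gt0.
  have [A [FA HA]] := ultra_cauchy FU (fun k => HM k B nB BQ) d0.
  exists A; split => // k l Ak Al.
  have mB := measurable_hbox B.
  apply: (@le_trans _ _ (\int[mu]_(x in hbox B)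
      (((avg (u1 k) B - avg (u1 l) B) ^+ 2)%:E * (rho1 x)%:E))%E).
    by apply: eqW; apply: eq_integral => x _; rewrite -EFinM.
  rewrite ge0_integralZl//; last 3 first.
  - by apply/measurable_EFinP; exact: (measurable_funS measurableT).
  - by move=> x _; rewrite lee_fin.
  - by rewrite lee_fin sqr_ge0.
  apply: (@le_trans _ _ (((avg (u1 k) B - avg (u1 l) B) ^+ 2)%:E * V%:E)%E).
    by apply: lee_wpmul2l; [rewrite lee_fin sqr_ge0|exact: weight_bound].
  rewrite -EFinM lee_fin -real_normK ?num_real//.
  have := HA k l Ak Al; set t := `|_|; move=> td.
  have t0 : 0 <= t by rewrite normr_ge0.
  have t1 : t <= 1 by rewrite (le_trans td)// ge_min lexx.
  have te : t * (V + 1) <= eps by rewrite -ler_pdivlMr// (le_trans td)// ge_min lexx orbT.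
  nra.
have nl := nondeg_lo (dir s) nB; have nh := nondeg_hi (dir s) nB.
have lQ := subset_trans (@hbox_lo_sub _ _ (dir s) _ nB) BQ.
have hQ := subset_trans (@hbox_hi_sub _ _ (dir s) _ nB) BQ.
have e2 : 0 < eps / 2 by rewrite divr_gt0.
have [A1 [FA1 H1]] := IH s.+1 _ _ nl lQ e2.
have [A2 [FA2 H2]] := IH s.+1 _ _ nh hQ e2.
exists (A1 `&` A2); split; first exact: filterI.
move=> k l [k1 k2] [l1 l2].
rewrite (integral_hbox_split (dir s) nB); last 2 first.
- exact: (mf k l n.+1).
- by move=> x _; rewrite lee_fin mulr_ge0// sqr_ge0.
rewrite (splitr eps) EFinD; apply: leeD.
  apply: le_trans (H1 k l k1 l1).
  apply: eqW; apply: eq_integral => x.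
  by rewrite inE => Bx; rewrite (bx_lo n nB Bx).
apply: le_trans (H2 k l k2 l2).
apply: eqW; apply: eq_integral => x.
by rewrite inE => Bx; rewrite (bx_hi n nB Bx).
Qed.

Lemma box_ultra_cauchy eps : 0 < eps ->
  exists A, F A /\ forall k l, A k -> A l ->
   (\int[mu]_(x in obox Q) ((u k x - u l x) ^+ 2 * rho x)%:E <= eps%:E)%E.
Proof.
move=> e0.
pose L := \sum_i (Q.2 ord0 i - Q.1 ord0 i).
have QL i : Q.2 ord0 i - Q.1 ord0 i <= L.
  by rewrite /L (bigD1 i)//= lerDl; apply: sumr_ge0 => j _; rewrite subr_ge0 ltW.
have p0 : 0 < p by exact: lt_le_trans p1.
have r0 : 0 <= r by rewrite invr_ge0 ltW.
have rm : r < 2 / m.+1%:R.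
  by rewrite /r -[_ / _]invrK invf_div ltf_pV2 ?posrE// divr_gt0.
pose lam : R := Num.sqrt (2 `^ (r - 2 / m.+1%:R)).
have lam0 : 0 <= lam by exact: sqrtr_ge0.
have lam1 : lam < 1.
  rewrite -sqrtr1 ltr_sqrt// /powR pnatr_eq0/= -[X in _ < X]expR0 ltr_expR.
  by rewrite nmulr_rlt0 ?subr_lt0// ln_gt0// ltr1n.
pose C := L ^+ 2 * R0 * vol Q `^ (- r) * D.
have W1E k : (fun x => \sum_i w1 k i x ^+ 2) = (fun x => \sum_i w k i x ^+ 2) \_ (obox Q).
  apply/funext => x; rewrite patchE; case: ifPn => h.
    by apply: eq_bigr => i _; rewrite /w1 patchE h.
  by rewrite big1// => i _; rewrite /w1 patchE (negbTE h) expr0n.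
have iW1 k : mu.-integrable (hbox Q) (EFin \o (fun x => \sum_i w1 k i x ^+ 2)).
  by rewrite W1E; exact: integrable_patch.
have IWD k : \int[mu]_(x in hbox Q) (\sum_i w1 k i x ^+ 2) <= D.
  rewrite (Rintegral_hbox nQ (iW1 k)) -lee_fin /Rintegral fineK; last first.
    by apply: integrable_fin_num => //; exact: (integrableS mhQ mQ (@sub_oh _ _ Q) (iW1 k)).
  apply: le_trans (WD k); apply: eqW.
  apply: eq_integral => x xQ; congr (_%:E); apply: eq_bigr => i _.
  by rewrite /w1 patchE xQ.
have cvC : C * (lam ^+ J / (1 - lam)) ^+ 2 @[J --> \oo] --> (0 : R).
  rewrite -[X in _ --> X](mulr0 C); apply: cvgM; first exact: cvg_cst.
  have cv : lam ^+ J / (1 - lam) @[J --> \oo] --> (0 : R).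
    rewrite -[X in _ --> X](mul0r (1 - lam)^-1); apply: cvgM; last exact: cvg_cst.
    by apply: cvg_expr; rewrite ger0_norm.
  by rewrite -[X in _ --> X](mul0r 0); exact: cvgM.
(* The difference of two functions is split at their averages, and (a + b)^2 <= 2 a^2 + 2 b^2 is
   used twice, with coefficients 2, 4, 4. The tolerances eps/12, eps/8, eps/12 add up to exactly
   eps. *)
have [J HJ] : exists J, C * (lam ^+ J / (1 - lam)) ^+ 2 < eps / 12.
  have : \forall J \near \oo, C * (lam ^+ J / (1 - lam)) ^+ 2 < eps / 12.
    by apply: (cvgr_lt 0 cvC); rewrite divr_gt0.
  by move=> [J _ /(_ J (leqnn J)) h]; exists J.
have e8 : 0 < eps / 8 by rewrite divr_gt0.
have [A [FA HA]] := sub_avg_small J 0 nQ (@subset_refl _ _) e8.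
exists A; split => // k l Ak Al.
pose E j x := avg (u1 j) (bx J 0 Q x).
have mu1 j : measurable_fun (hbox Q) (u1 j) by exact/measurable_EFinP/measurable_int/iu1.
have mE j : measurable_fun (hbox Q) (E j).
  by apply: (measurable_funS measurableT) => //; exact: measurable_bx.
have mrhoQ : measurable_fun (hbox Q) rho1 by exact: (measurable_funS measurableT).
have mw1 j i : measurable_fun (hbox Q) (w1 j i) by exact/measurable_EFinP/measurable_int/iw1.
have approx j : (\int[mu]_(x in hbox Q) ((u1 j x - E j x) ^+ 2 * rho1 x)%:E <= (eps / 12)%:E)%E.
  apply: le_trans (integral_sub_En nQ QL (iu1 j) (mw1 j) (iW1 j) (tent1 j) J
    mrhoQ rho1_ge0 weight_bound r0 rm) _.
  rewrite lee_fin; apply: (le_trans _ (ltW HJ)); rewrite /C -/lam.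
  apply: ler_wpM2r; first exact: sqr_ge0.
  apply: ler_wpM2l; last exact: IWD.
  apply: mulr_ge0; last exact: powR_ge0.
  by apply: mulr_ge0; [exact: sqr_ge0|rewrite /R0 addr_ge0].
pose X x := (u1 k x - E k x) ^+ 2 * rho1 x.
pose Y x := (E k x - E l x) ^+ 2 * rho1 x.
pose Z x := (u1 l x - E l x) ^+ 2 * rho1 x.
have sq0 (f : T -> R) x : 0 <= f x ^+ 2 * rho1 x by rewrite mulr_ge0// sqr_ge0.
have mXYZ (f g : T -> R) : measurable_fun (hbox Q) f -> measurable_fun (hbox Q) g ->
    measurable_fun (hbox Q) (fun x => (f x - g x) ^+ 2 * rho1 x).
  by move=> mf mg; apply: measurable_funM => //; apply: measurable_funX; exact: measurable_funB.
have X0 x : 0 <= X x by exact: (sq0 (fun x => u1 k x - E k x)).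
have Y0 x : 0 <= Y x by exact: (sq0 (fun x => E k x - E l x)).
have Z0 x : 0 <= Z x by exact: (sq0 (fun x => u1 l x - E l x)).
have mX : measurable_fun (hbox Q) X by exact: mXYZ.
have mY : measurable_fun (hbox Q) Y by exact: mXYZ.
have mZ : measurable_fun (hbox Q) Z by exact: mXYZ.
have mYZ : measurable_fun (hbox Q) (fun x => 2 * Y x + 2 * Z x).
  by apply: measurable_funD; apply: measurable_funM.
have YZ0 x : 0 <= 2 * Y x + 2 * Z x by apply: addr_ge0; apply: mulr_ge0.
apply: (@le_trans _ _ (\int[mu]_(x in hbox Q) (2 * X x + 2 * (2 * Y x + 2 * Z x))%:E)%E).
  apply: (@le_trans _ _ (\int[mu]_(x in hbox Q) ((u1 k x - u1 l x) ^+ 2 * rho1 x)%:E)%E).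
    rewrite (ge0_integral_hbox nQ); last 2 first.
    - by apply/measurable_EFinP; exact: mXYZ.
    - by move=> x _; rewrite lee_fin (sq0 (fun x => u1 k x - u1 l x)).
    apply: eqW; apply: eq_integral => x xQ.
    by rewrite /u1 /rho1 !patchE xQ.
  apply: ge0_le_integral => //.
  - by move=> x _; rewrite lee_fin (sq0 (fun x => u1 k x - u1 l x)).
  - by apply/measurable_EFinP; exact: mXYZ.
  - by apply/measurable_EFinP; apply: measurable_funD; apply: measurable_funM.
  - move=> x _; rewrite lee_fin /X /Y /Z.
    have E3 (a b c d : R) : 2 * (a * d) + 2 * (2 * (b * d) + 2 * (c * d)) =
      (2 * a + 2 * (2 * b + 2 * c)) * d by ring.
    rewrite E3; apply: ler_wpM2r => //.
    have := sqrB_le_2D (u1 k x - E k x) (E k x - u1 l x).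
    have := sqrB_le_2D (E k x - E l x) (E l x - u1 l x).
    rewrite -[(E l x - u1 l x) ^+ 2]sqrrN opprB.
    rewrite (_ : E k x - E l x + (E l x - u1 l x) = E k x - u1 l x); last by ring.
    rewrite (_ : u1 k x - E k x + (E k x - u1 l x) = u1 k x - u1 l x); last by ring.
    by move: (_ ^+ 2) (_ ^+ 2) (_ ^+ 2) (_ ^+ 2) (_ ^+ 2) => a b c d e h1 h2; lra.
rewrite integral_2D// integral_2D//.
apply: (@le_trans _ _ (2%:E * (eps / 12)%:E + 2%:E * (2%:E * (eps / 8)%:E + 2%:E * (eps / 12)%:E))%E).
  apply: leeD; first by apply: lee_wpmul2l; [rewrite lee_fin|exact: approx].
  apply: lee_wpmul2l; first by rewrite lee_fin.
  apply: leeD; apply: lee_wpmul2l; rewrite ?lee_fin//; first exact: HA.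
  exact: approx.
rewrite -(EFinM 2 (eps / 8)) -(EFinM 2 (eps / 12)) -(EFinD (2 * (eps / 8))) -(EFinM 2) -(EFinD (2 * (eps / 12))).
by rewrite lee_fin; lra.
Qed.

End box_sequence.

(** * Jacobians and coordinate frames *)

Section continuously_differentiable.
Context {R : realType} {m : nat}.
Implicit Types (f : 'rV[R]_m -> R) (x y h : 'rV[R]_m) (i : 'I_m) (O : set 'rV[R]_m).

Lemma rV_norm_le (v : 'rV[R]_m) (c : R) :
  0 <= c -> (forall i, `|v ord0 i| <= c) -> `|v| <= c.
Proof.
move=> c0 vc; rewrite /Num.norm/= mx_normrE; apply/bigmax_leP; split => // -[i j] _ /=.
by rewrite ord1.
Qed.

Lemma coord_le_norm (v : 'rV[R]_m) i : `|v ord0 i| <= `|v|.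
Proof.
rewrite [leRHS]/Num.norm/= mx_normrE.
exact: (le_bigmax _ (fun ij : 'I_1 * 'I_m => `|v ij.1 ij.2|) (ord0, i)).
Qed.

Lemma is_derive_line f y i (s : R) :
  derivable (f : 'rV[R]_m -> R^o) (y + s *: delta_mx ord0 i) (delta_mx ord0 i) ->
  is_derive s (1 : R) (fun t : R => f (y + t *: delta_mx ord0 i) : R)
    (partial i f (y + s *: delta_mx ord0 i)).
Proof.
move=> df.
have E : (fun h : R => h^-1 *: ((fun t : R => f (y + t *: delta_mx ord0 i) : R^o) (h *: (1 : R) + s)
    - f (y + s *: delta_mx ord0 i) : R^o)) =
    (fun h : R => h^-1 *: ((f : 'rV[R]_m -> R^o) (h *: delta_mx ord0 i + (y + s *: delta_mx ord0 i))
    - f (y + s *: delta_mx ord0 i))).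
  apply/funext => h /=; congr (_ *: (f _ - _)).
  by rewrite scalerDl [h *: 1]mulr1 [RHS]addrCA.
apply: DeriveDef; first by rewrite /derivable E.
by rewrite /derive E.
Qed.

Lemma line_increment_ge0 f y i (t L e : R) : 0 <= t ->
  (forall s, 0 <= s <= t ->
    derivable (f : 'rV[R]_m -> R^o) (y + s *: delta_mx ord0 i) (delta_mx ord0 i) /\
    `|partial i f (y + s *: delta_mx ord0 i) - L| <= e) ->
  `|f (y + t *: delta_mx ord0 i) - f y - t * L| <= e * t.
Proof.
move=> t0 H.
have dg s : s \in `[0, t]%R -> is_derive s (1 : R)
    (fun t : R => f (y + t *: delta_mx ord0 i) : R) (partial i f (y + s *: delta_mx ord0 i)).
  by rewrite in_itv/= => /H[+ _]; exact: is_derive_line.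
have [|c] := MVT_segment t0 (fun s st => dg s (subset_itv_oo_cc st)).
  by apply: derivable_within_continuous => s st; exact: (@ex_derive _ _ _ _ _ _ _ (dg s st)).
rewrite in_itv/= => /H[_ cL]; rewrite scale0r addr0 subr0 => ->.
by rewrite [t * L]mulrC -mulrBl normrM (ger0_norm t0) ler_wpM2r.
Qed.

Lemma line_increment f y i (t L e : R) :
  (forall s, `|s| <= `|t| -> `|t - s| <= `|t| ->
    derivable (f : 'rV[R]_m -> R^o) (y + s *: delta_mx ord0 i) (delta_mx ord0 i) /\
    `|partial i f (y + s *: delta_mx ord0 i) - L| <= e) ->
  `|f (y + t *: delta_mx ord0 i) - f y - t * L| <= e * `|t|.
Proof.
have [t0 H|t0 H] := leP 0 t.
  rewrite (ger0_norm t0); apply: line_increment_ge0 => // s /andP[s0 st].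
  by apply: H; rewrite !ger0_norm ?subr_ge0// gerBl.
rewrite (ltr0_norm t0).
have : `|f (y + t *: delta_mx ord0 i + (- t) *: delta_mx ord0 i)
   - f (y + t *: delta_mx ord0 i) - (- t) * L| <= e * (- t).
  apply: line_increment_ge0; first by rewrite oppr_ge0 ltW.
  move=> s /andP[s0 st]; rewrite -addrA -scalerDl; apply: H.
    by rewrite (ltr0_norm t0) ler0_norm; lra.
  by rewrite (ltr0_norm t0) opprD addrA subrr sub0r normrN ger0_norm.
rewrite -(addrA y) -scalerDl subrr scale0r addr0 -normrN.
by congr (`|_| <= _); ring.
Qed.

(** The point x + h is reached along the coordinate axes, one coordinate at a time; the mean value
    theorem bounds each increment by the oscillation of one partial derivative near x. *)
Lemma increment_littleo f x O : open O -> O x ->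
  (forall y i, O y -> derivable (f : 'rV[R]_m -> R^o) y (delta_mx ord0 i)) ->
  (forall i, {for x, continuous (partial i f)}) ->
  forall e : R, 0 < e -> \forall h \near (0 : 'rV[R]_m),
    `|f (x + h) - f x - \sum_i h ord0 i * partial i f x| <= e * `|h|.
Proof.
move=> oO Ox df cf e e0.
(* There are [m] increments; the divisor [m.+1] also covers m = 0. *)
pose e' := e / m.+1%:R; have e'0 : 0 < e' by rewrite divr_gt0.
have : \forall y \near x, O y /\ forall i, `|partial i f y - partial i f x| <= e'.
  apply: filterI; first exact: open_nbhs_nbhs.
  apply: (@filter_forall _ _ (fun i (y : 'rV[R]_m) =>
      `|partial i f y - partial i f x| <= e') _ (nbhs_filter x)) => i.
  have := cf i => /cvgrPdist_le /(_ _ e'0).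
  by apply: filterS => y; rewrite distrC.
move=> /nbhs_ballP[d /= d0 Hd].
have HB y : `|y - x| < d -> O y /\ forall i, `|partial i f y - partial i f x| <= e'.
  by move=> yd; apply: Hd; rewrite -ball_normE /= distrC.
near=> h.
have hd : `|h| < d.
  near: h; apply/nbhs_ballP; exists d => //= z.
  by rewrite -ball_normE /= sub0r normrN.
pose c (k : nat) : 'rV[R]_m := \row_i (if (i < k)%N then h ord0 i else 0).
have cS (k : 'I_m) : c k.+1 = c k + h ord0 k *: delta_mx ord0 k.
  apply/rowP => j; rewrite !mxE eqxx /=; have [->|jk] := eqVneq j k.
    by rewrite ltnSn ltnn mulr1 add0r.
  by rewrite mulr0 addr0 ltnS leq_eqVlt (negbTE jk : (j == k :> nat) = false).
have c0 : c 0 = 0 by apply/rowP => j; rewrite !mxE ltn0.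
have cm : c m = h by apply/rowP => j; rewrite !mxE ltn_ord.
have -> : f (x + h) - f x = \sum_(k < m) (f (x + c k.+1) - f (x + c k)).
  by rewrite -(big_mkord xpredT (fun k => f (x + c k.+1) - f (x + c k))) telescope_sumr// cm c0 addr0.
rewrite -sumrB; apply: (le_trans (ler_norm_sum _ _ _)).
apply: (@le_trans _ _ (\sum_(k < m) e' * `|h|)); last first.
  rewrite big_const_ord iter_addr_0 -mulr_natr mulrAC; apply: ler_wpM2r => //.
  by rewrite /e' mulrAC ler_pdivrMr ?ltr0n// ler_pM2l// ler_nat.
apply: ler_sum => k _; rewrite cS addrA.
apply: (@le_trans _ _ (e' * `|h ord0 k|)); last first.
  by apply: ler_wpM2l; [exact: ltW|exact: coord_le_norm].
apply: line_increment => s s1 s2.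
have [Oy Py] : O (x + c k + s *: delta_mx ord0 k) /\ forall i,
    `|partial i f (x + c k + s *: delta_mx ord0 k) - partial i f x| <= e'.
  apply: HB.
  have -> : x + c k + s *: delta_mx ord0 k - x = c k + s *: delta_mx ord0 k.
    by rewrite -(addrA x) addrAC subrr add0r.
  apply: le_lt_trans hd.
  apply: rV_norm_le => // i; rewrite !mxE eqxx /=; have [->|ik] := eqVneq i k.
    by rewrite ltnn add0r mulr1 (le_trans s1)// coord_le_norm.
  by rewrite mulr0 addr0; case: ifP => _; rewrite ?normr0// coord_le_norm.
by split; [exact: df|exact: Py].
Unshelve. all: by end_near. Qed.

End continuously_differentiable.

Section smooth_maps.
Context {R : realType} {m k : nat}.
Implicit Types (F : 'rV[R]_m -> 'rV[R]_k) (x : 'rV[R]_m) (O : set 'rV[R]_m).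

Lemma mulmxr_continuous (J : 'M[R]_(m, k)) : continuous (mulmxr J : 'rV[R]_m -> 'rV[R]_k).
Proof.
apply: bounded_linear_continuous.
pose C := \sum_i \sum_j `|J i j|.
have C0 : 0 <= C by apply: sumr_ge0 => i _; apply: sumr_ge0 => j _.
apply/linear_boundedP; near=> r => x.
have rC : C <= r by near: r; apply: nbhs_pinfty_ge; exact: num_real.
apply: (@le_trans _ _ (C * `|x|)); last by apply: ler_wpM2r.
apply: rV_norm_le; first exact: mulr_ge0.
move=> j; rewrite /mulmxr mxE (le_trans (ler_norm_sum _ _ _))// /C mulr_suml.
apply: ler_sum => i _; rewrite normrM mulrC; apply: ler_pM => //; last exact: coord_le_norm.
by rewrite (bigD1 j)//= lerDl; apply: sumr_ge0.
Unshelve. all: by end_near. Qed.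

(** The bridge from [smooth_on], which speaks of partial derivatives, to [jacobian], which speaks of
    the differential; with it the chain rule applies to chart transitions. *)
Lemma smooth_differentiable O F x : open O -> O x -> smooth_map_on O F ->
  differentiable F x.
Proof.
move=> oO Ox sF.
pose J : 'M[R]_(m, k) := \matrix_(i, j) partial i (fun y => F y ord0 j) x.
have HJ : F \o shift x = cst (F x) + mulmxr J +o_ (0 : 'rV[R]_m) id.
  apply/eqaddoP => e e0.
  have : \forall h \near (0 : 'rV[R]_m), forall j : 'I_k, `|F (x + h) ord0 j - F x ord0 j -
      \sum_i h ord0 i * partial i (fun y => F y ord0 j) x| <= e * `|h|.
    apply: (@filter_forall _ _ (fun (j : 'I_k) (h : 'rV[R]_m) => `|F (x + h) ord0 j - F x ord0 j -
      \sum_i h ord0 i * partial i (fun y => F y ord0 j) x| <= e * `|h|) _ (nbhs_filter _)) => j.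
    apply: (increment_littleo oO Ox) => //.
    - by move=> y i Oy; have [_ /(_ i)] := sF j [::] y Oy.
    - by move=> i; have [] := sF j [:: i] x Ox.
  apply: filterS => h Hh.
  apply: rV_norm_le; first by rewrite mulr_ge0// ltW.
  move=> j; rewrite !mxE /=.
  have -> : \sum_i h ord0 i * J i j = \sum_i h ord0 i * partial i (fun y => F y ord0 j) x.
    by apply: eq_bigr => i _; rewrite mxE.
  by rewrite opprD addrA [h + x]addrC; exact: Hh.
have dF := diff_unique (@mulmxr_continuous J) HJ.
apply/diff_locallyP; split; first by rewrite dF; exact: mulmxr_continuous.
by rewrite dF.
Qed.

End smooth_maps.

(** * Positive definite matrices *)

Section positive_definite.
Context {R : realType} {m : nat}.
Implicit Types (A F : 'M[R]_m) (v w : 'rV[R]_m).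

Lemma posdefmx_ge0 A v : posdefmx A -> 0 <= (v *m A *m v^T) ord0 ord0.
Proof.
move=> [_ pA]; have [->|/pA/ltW//] := eqVneq v 0.
by rewrite !mul0mx mxE.
Qed.

Lemma posdefmx_unit A : posdefmx A -> A \in unitmx.
Proof.
move=> [_ pA]; rewrite -row_free_unit -kermx_eq0; apply/eqP/row_matrixP => i.
rewrite row0; apply/eqP/negPn/negP => /pA; rewrite -row_mul mulmx_ker row0 mul0mx mxE.
by rewrite ltxx.
Qed.

Lemma posdefmx_segment A (t : R) : posdefmx A -> 0 <= t <= 1 ->
  posdefmx (t%:M + (1 - t) *: A).
Proof.
move=> pA /andP[t0 t1]; split.
  by rewrite linearD linearZ/= tr_scalar_mx (proj1 pA).
move=> v v0; rewrite mulmxDr mulmxDl -scalemxAr -scalemxAl mul_mx_scalar -scalemxAl.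
have E (X Y : 'M[R]_1) (a b : R) : (a *: X + b *: Y) ord0 ord0 =
    a * X ord0 ord0 + b * Y ord0 ord0 by rewrite !mxE.
rewrite E.
have V : 0 < (v *m v^T) ord0 ord0.
  rewrite mxE lt_neqAle; apply/andP; split; last first.
    by apply: sumr_ge0 => i _; rewrite mxE -expr2 sqr_ge0.
  rewrite eq_sym psumr_eq0; last by move=> i _; rewrite mxE -expr2 sqr_ge0.
  apply: contra v0 => /allP H; apply/eqP/rowP => i; rewrite mxE.
  have := H i (mem_index_enum _); rewrite mxE mulf_eq0 orbb; exact: eqP.
have Av := (proj2 pA) v v0.
have [tt|tt] := eqVneq t 0; first by rewrite tt mul0r add0r subr0 mul1r.
by rewrite ltr_pwDl// ?mulr_gt0// ?lt_neqAle 1?eq_sym ?tt// mulr_ge0 ?subr_ge0// ltW.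
Qed.

(* [t |-> det (t I + (1 - t) A)] has no zero on [[0, 1]]. *)
Lemma posdefmx_det_gt0 A : posdefmx A -> 0 < \det A.
Proof.
move=> pA.
pose P : {poly R} := \det ('X%:M + (1 - 'X) *: map_mx polyC A).
have PE t : P.[t] = \det (t%:M + (1 - t) *: A).
  rewrite /P -horner_evalE -det_map_mx; congr (\det _); apply/matrixP => i j.
  rewrite !mxE /= horner_evalE hornerD hornerM !hornerE /=.
  by case: (i == j); rewrite ?mulr1n ?mulr0n !hornerE.
rewrite ltNge; apply/negP => d0.
have P0 : P.[0] = \det A by rewrite PE subr0 scale1r (_ : 0%:M = 0) ?add0r// raddf0.
have P1 : P.[1] = 1 by rewrite PE subrr scale0r addr0 det1.
have [|t t01 /rootP] := @poly_ivt _ P 0 1 ler01; first by rewrite P0 P1 d0 ler01.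
have /posdefmx_unit := posdefmx_segment pA t01.
by rewrite unitmxE -PE unitfE => /negPf h /eqP; rewrite h.
Qed.

Lemma posdefmx_congr A F : posdefmx A -> F \in unitmx -> posdefmx (F *m A *m F^T).
Proof.
move=> [sA pA] uF; split; first by rewrite !trmx_mul trmxK sA mulmxA.
move=> v v0; have : v *m F != 0.
  by apply: contra v0 => /eqP h; rewrite -(mulmxK uF v) h mul0mx.
by move/pA; rewrite trmx_mul !mulmxA.
Qed.

(** Evaluate the form at a v - b w, with a its value at w and b the mixed term: the result is a (a c
    - b^2), c being the value at v. *)
Lemma posdefmx_CauchySchwarz A v w : posdefmx A ->
  (v *m A *m w^T) ord0 ord0 ^+ 2 <=
  (v *m A *m v^T) ord0 ord0 * (w *m A *m w^T) ord0 ord0.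
Proof.
move=> pA; have [->|w0] := eqVneq w 0.
  by rewrite trmx0 !mulmx0 mxE expr0n/= mulr0.
have := proj2 pA _ w0; set a := (w *m A *m w^T) ord0 ord0 => a0.
have sym : (w *m A *m v^T) ord0 ord0 = (v *m A *m w^T) ord0 ord0.
  have -> : w *m A *m v^T = (v *m A *m w^T)^T by rewrite !trmx_mul trmxK (proj1 pA) mulmxA.
  by rewrite mxE.
have := posdefmx_ge0 (a *: v - (v *m A *m w^T) ord0 ord0 *: w) pA.
set b := (v *m A *m w^T) ord0 ord0; set c := (v *m A *m v^T) ord0 ord0.
have -> : ((a *: v - b *: w) *m A *m (a *: v - b *: w)^T) ord0 ord0 =
    a * (a * c - b ^+ 2).
  have E (X Y : 'M[R]_1) (s t : R) : (s *: X - t *: Y) ord0 ord0 =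
    s * X ord0 ord0 - t * Y ord0 ord0 by rewrite !mxE.
  have -> : (a *: v - b *: w)^T = a *: v^T - b *: w^T.
    by apply/matrixP => i j; rewrite !mxE.
  rewrite [_ *m A]mulmxBl -[(a *: v) *m A]scalemxAl -[(b *: w) *m A]scalemxAl.
  rewrite [LHS](_ : _ = (a *: (a *: (v *m A *m v^T) - b *: (v *m A *m w^T)) -
    b *: (a *: (w *m A *m v^T) - b *: (w *m A *m w^T))) ord0 ord0); last first.
    congr (fun_of_matrix _ _ _).
    by rewrite mulmxBl -!scalemxAl !mulmxBr -!scalemxAr.
  by rewrite !E -/a -/b -/c sym -/b; ring.
by rewrite pmulr_rge0// subr_ge0 mulrC.
Qed.

End positive_definite.

(** Since the off-diagonal blocks vanish, scaling the first block amounts to multiplying on the left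
    by a diagonal matrix with k entries [a] and the others 1. *)
Lemma det_scale_block (R : realType) (m k : nat) (a : R) (A : 'M[R]_m) : (k <= m)%N ->
  (forall i j : 'I_m, (i < k)%N != (j < k)%N -> A i j = 0) ->
  \det (scale_block k a A) = a ^+ k * \det A.
Proof.
move=> km A0.
have -> : scale_block k a A = diag_mx (\row_i (if (i < k)%N then a else 1)) *m A.
  apply/matrixP => i j; rewrite mul_diag_mx !mxE.
  by have := A0 i j; case: (i < k)%N; case: (j < k)%N => //= h; rewrite ?mul1r// h ?mulr0.
rewrite det_mulmx det_diag; congr (_ * _).
under eq_bigr do rewrite mxE.
rewrite -big_mkcond /= (big_ord_narrow km) /= prodr_const card_ord //.
Qed.

Section chart_topology.
Context {R : realType} {M : ptopologicalType} {m : nat}.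
Implicit Types (c : chart R M m) (U V : set M) (O : set 'rV[R]_m).

Lemma cmap_cimg c U x : cimg c U x -> [/\ cdom c (cinv c x), U (cinv c x) & cmap c (cinv c x) = x].
Proof. by move=> [p [cp Up] <-]; rewrite cmapK. Qed.

Lemma cinv_continuous_at c x : (cmap c @` cdom c) x -> {for x, continuous (cinv c)}.
Proof.
move=> cx; have := @cinv_cont _ _ _ c; rewrite continuous_open_subspace; last exact: cimg_open.
by apply; rewrite inE.
Qed.

Lemma cmap_continuous_at c p : cdom c p -> {for p, continuous (cmap c)}.
Proof.
move=> cp; have := @cmap_cont _ _ _ c; rewrite continuous_open_subspace; last exact: cdom_open.
by apply; rewrite inE.
Qed.

Lemma open_cimg c U : open U -> open (cimg c U).
Proof.
move=> oU; rewrite openE => x /cmap_cimg[cp Up xE]; rewrite /interior.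
have cx : (cmap c @` cdom c) x by exists (cinv c x).
have nx : nbhs x (cmap c @` cdom c) by apply: open_nbhs_nbhs; split => //; exact: cimg_open.
have nU : nbhs x (cinv c @^-1` U).
  by apply: (cinv_continuous_at cx); apply: open_nbhs_nbhs.
by apply: filterS2 nx nU => _ [p cpp <-] /=; rewrite cmapK// => ?; exists p.
Qed.

Lemma cmap_preimage_open c O : open O -> open (cdom c `&` cmap c @^-1` O).
Proof.
move=> oO; rewrite openE => p [cp Op]; rewrite /interior; apply: filterI.
  by apply: open_nbhs_nbhs; split => //; exact: cdom_open.
by apply: (cmap_continuous_at cp); exact: open_nbhs_nbhs.
Qed.

End chart_topology.

Lemma mul_jacobian (R : realType) (a b c : nat) (F : 'rV[R]_a -> 'rV[R]_b)
    (G : 'rV[R]_b -> 'rV[R]_c) x : differentiable F x -> differentiable G (F x) ->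
  jacobian F x *m jacobian G (F x) = jacobian (G \o F) x.
Proof.
move=> dF dG; apply/row_matrixP => i; rewrite !rowE mulmxA.
rewrite -(deriveEjacobian _ dF) -(deriveEjacobian _ dG).
rewrite -(deriveEjacobian _ (differentiable_comp dF dG)) !deriveE//.
  by rewrite (diff_comp dF dG).
exact: differentiable_comp.
Qed.

Lemma jacobian_near_id (R : realType) (a : nat) (F : 'rV[R]_a -> 'rV[R]_a) x :
  differentiable F x -> (\forall y \near x, F y = y) -> jacobian F x = 1%:M.
Proof.
move=> dF Fid; apply/row_matrixP => i; rewrite !rowE -(deriveEjacobian _ dF).
by rewrite (near_eq_derive _ Fid) derive_id mulmx1.
Qed.

Lemma cvg_det (R : realType) (T : Type) (F : set_system T) (n : nat)
    (A : T -> 'M[R]_n) (L : 'M[R]_n) : Filter F ->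
  (forall i j, (A y i j : R) @[y --> F] --> (L i j : R)) ->
  (\det (A y) : R) @[y --> F] --> (\det L : R).
Proof.
move=> FF cA.
have cprod (f : T -> 'I_n -> R) (l : 'I_n -> R) (r : seq 'I_n) :
    (forall i, f y i @[y --> F] --> l i) ->
    (\prod_(i <- r) f y i : R) @[y --> F] --> (\prod_(i <- r) l i : R).
  move=> fl; elim: r => [|i r IH].
    by rewrite big_nil; under eq_fun do rewrite big_nil; exact: cvg_cst.
  by rewrite big_cons; under eq_fun do rewrite big_cons; apply: cvgM.
have csum (I : Type) (f : T -> I -> R) (l : I -> R) (r : seq I) :
    (forall i, f y i @[y --> F] --> l i) ->
    (\sum_(i <- r) f y i : R) @[y --> F] --> (\sum_(i <- r) l i : R).
  move=> fl; elim: r => [|i r IH].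
    by rewrite big_nil; under eq_fun do rewrite big_nil; exact: cvg_cst.
  by rewrite big_cons; under eq_fun do rewrite big_cons; apply: cvgD.
rewrite /determinant; apply: csum => s; apply: cvgM; first exact: cvg_cst.
by apply: cprod => i; exact: cA.
Qed.

Section riemannian.
Context {R : realType} {M : ptopologicalType} {m : nat}.
Variable S : smooth_structure R M m.
Implicit Types (c : chart R M m) (U V : set M) (g : M -> 'M[R]_m).

(** The two transition maps between [c] and the preferred chart are inverse to each other near the
    point, so their Jacobians multiply to the identity. Hence a positive definite metric has a
    positive definite matrix in every chart. *)
Lemma frame_unit c p : atlas S c -> cdom c p -> frame S c p \in unitmx.
Proof.
move=> ac cp; set c' := chart_at S p.
have ac' : atlas S c' := chart_at_atlas S p.
have cp' : cdom c' p := chart_at_dom S p.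
pose F := cmap c' \o cinv c; pose G := cmap c \o cinv c'.
have Fp : F (cmap c p) = cmap c' p by rewrite /F /= cmapK.
have oF : open (cimg c (cdom c')) by apply/open_cimg/cdom_open.
have oG : open (cimg c' (cdom c)) by apply/open_cimg/cdom_open.
have dF : differentiable F (cmap c p).
  by apply: (smooth_differentiable oF); [by exists p|exact: (atlas_compat ac ac')].
have dG : differentiable G (F (cmap c p)).
  by rewrite Fp; apply: (smooth_differentiable oG); [by exists p|exact: (atlas_compat ac' ac)].
apply: (@mulmx1_unit _ _ _ (jacobian G (F (cmap c p))) _).1.
rewrite [frame _ _ _]/(jacobian F _) (mul_jacobian dF dG) jacobian_near_id//.
  exact: differentiable_comp.
have : nbhs (cmap c p) (cimg c (cdom c')) by apply: open_nbhs_nbhs; split => //; exists p.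
by apply: filterS => _ [q [cq cq'] <-]; rewrite /G /F /= cmapK// cmapK.
Qed.

Lemma metric_coord_posdef U g c p : riemannian_metric S U g -> atlas S c ->
  cdom c p -> U p -> posdefmx (metric_coord S g c p).
Proof.
by move=> [pg _] ac cp Up; apply: posdefmx_congr; [exact: pg|exact: frame_unit].
Qed.

Definition vol_density g c x : R := Num.sqrt (\det (metric_coord S g c (cinv c x))).

Lemma vol_density_gt0 U g c x : riemannian_metric S U g -> atlas S c ->
  cimg c U x -> 0 < vol_density g c x.
Proof.
move=> rg ac /cmap_cimg[cp Up _]; rewrite sqrtr_gt0; apply: posdefmx_det_gt0.
exact: metric_coord_posdef rg _ _ _.
Qed.

Lemma metric_coord_continuous U g c x i j : riemannian_metric S U g -> atlas S c ->
  cimg c U x -> {for x, continuous (fun y => metric_coord S g c (cinv c y) i j)}.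
Proof. by move=> [_ sg] ac cx; have [] := sg c ac i j [::] x cx. Qed.

Lemma vol_density_continuous U g c x : riemannian_metric S U g -> atlas S c ->
  cimg c U x -> {for x, continuous (vol_density g c)}.
Proof.
move=> rg ac cx; rewrite /vol_density.
apply: (@continuous_comp _ _ _ (fun y => \det (metric_coord S g c (cinv c y))) Num.sqrt).
  apply: (@cvg_det R _ (nbhs x) m (fun y => metric_coord S g c (cinv c y)) _
    (nbhs_filter x)) => i j.
  exact: (metric_coord_continuous rg ac cx).
exact: sqrt_continuous.
Qed.

End riemannian.

(** * Integration in charts *)

Section change_of_variables.
Import HBNNSimple.
Context d1 d2 (X : measurableType d1) (Y : measurableType d2) (R : realType).
Variables (mu : {measure set X -> \bar R}) (nu : {measure set Y -> \bar R}).
Variables (D : set X) (P : set Y) (phi : X -> Y) (rho : X -> R).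
Hypotheses (mD : measurable D) (mP : measurable P).
Hypothesis mphi : measurable_fun D phi.
Hypothesis phiD : forall x, D x -> P (phi x).
Hypothesis mrho : measurable_fun D rho.
Hypothesis rho0 : forall x, D x -> 0 <= rho x.
Hypothesis nuE : forall B, measurable B -> B `<=` P ->
  nu B = (\int[mu]_(x in D `&` phi @^-1` B) (rho x)%:E)%E.

Lemma integral_indic_change (B : set Y) : measurable B ->
  (\int[nu]_(y in P) (\1_B y)%:E = \int[mu]_(x in D) (\1_B (phi x) * rho x)%:E)%E.
Proof.
move=> mB; rewrite integral_indic// nuE; last 2 first.
- exact: measurableI.
- by move=> y [].
transitivity (\int[mu]_(x in D) ((EFin \o rho) \_ (phi @^-1` B)) x)%E.
  rewrite -integral_mkcondr; congr integral.
  by apply/seteqP; split=> x [Dx]/= => [[] //|Bx]; split=> //; split=> //; exact: phiD.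
apply: eq_integral => x _; rewrite patchE indicE.
have [Bx|Bx] := pselect (B (phi x)); first by rewrite !mem_set//= mul1r.
by rewrite !memNset//= mul0r.
Qed.

Lemma integral_nnsfun_change (h : {nnsfun Y >-> R}) :
  (\int[nu]_(y in P) (h y)%:E = \int[mu]_(x in D) (h (phi x) * rho x)%:E)%E.
Proof.
have mI (r : R) : measurable (h @^-1` [set r]) by [].
have mIphi (r : R) : measurable_fun D (fun x => \1_(h @^-1` [set r]) (phi x) * rho x).
  apply: measurable_funM => //.
  exact: (measurableT_comp (measurable_indic (mI r)) mphi).
transitivity (\int[nu]_(y in P)
   (\sum_(r \in range h) (r * \1_(h @^-1` [set r]) y)%:E))%E.
  by apply: eq_integral => t tE; rewrite /= fimfunE -fsumEFin.
rewrite ge0_integral_fsum//; last 2 first.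
- by move=> r; apply/measurable_EFinP; apply: measurable_funM.
- by move=> r y Py; exact: nnfun_muleindic_ge0.
transitivity (\int[mu]_(x in D)
   (\sum_(r \in range h) (r * (\1_(h @^-1` [set r]) (phi x) * rho x))%:E))%E; last first.
  apply: eq_integral => x xD; rewrite fsumEFin// [in RHS]fimfunE.
  congr (_%:E); rewrite !fsbig_finite//= mulr_suml.
  by apply: eq_bigr => r _; rewrite mulrA.
rewrite ge0_integral_fsum//; last 2 first.
- by move=> r; apply/measurable_EFinP; apply: measurable_funM.
- move=> r x Dx; rewrite mulrA EFinM mule_ge0 ?nnfun_muleindic_ge0//.
  by rewrite lee_fin rho0.
apply: eq_fsbigr => r; rewrite inE => -[y _ <-].
under eq_integral do rewrite EFinM.
rewrite ge0_integralZl//.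
under [RHS]eq_integral do rewrite EFinM.
rewrite ge0_integralZl//; last 3 first.
- exact/measurable_EFinP.
- by move=> t Dt; rewrite lee_fin mulr_ge0 ?rho0.
- by rewrite lee_fin.
  by rewrite integral_indic_change.
- by apply/measurable_EFinP; exact: measurable_funTS.
- by rewrite lee_fin.
Qed.

(** On [P], [nu] is the image under [phi] of [mu] with density [rho]; the formula passes from
    indicators to simple functions and then to monotone limits. *)
Lemma ge0_integral_change (h : Y -> R) : measurable_fun P h ->
  (forall y, P y -> 0 <= h y) ->
  (\int[nu]_(y in P) (h y)%:E = \int[mu]_(x in D) (h (phi x) * rho x)%:E)%E.
Proof.
move=> mh h0; have mhE : measurable_fun P (EFin \o h) by exact/measurable_EFinP.
pose k := nnsfun_approx mP mhE.
have kh y : P y -> (EFin \o k ^~ y) @ \oo --> (h y)%:E.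
  move=> Py; apply: (@cvg_nnsfun_approx _ _ _ _ mP _ mhE) => //.
have nd y : {homo (k ^~ y) : a b / (a <= b)%N >-> a <= b}.
  by move=> a b ab; exact/lefP/nd_nnsfun_approx.
transitivity (limn (fun n => \int[nu]_(y in P) (k n y)%:E))%E.
  rewrite -(@monotone_convergence _ _ _ nu _ mP (fun n y => (k n y)%:E))//.
  - by apply: eq_integral => y /[!inE] Py; apply/esym/cvg_lim => //; exact: kh.
  - move=> n; apply/measurable_EFinP; exact: measurable_funTS.
  - by move=> n y _; rewrite lee_fin.
  - by move=> y _ a b ab; rewrite lee_fin; exact: nd.
transitivity (limn (fun n => \int[mu]_(x in D) (k n (phi x) * rho x)%:E))%E.
  by congr (limn _); apply/funext => n; exact: integral_nnsfun_change.
rewrite -(@monotone_convergence _ _ _ mu _ mD (fun n x => (k n (phi x) * rho x)%:E))//.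
- apply: eq_integral => x /[!inE] Dx; apply/cvg_lim => //.
  under eq_fun do rewrite EFinM; rewrite EFinM.
  by apply: cvgeZr => //; exact: (kh _ (phiD Dx)).
- move=> n; apply/measurable_EFinP; apply: measurable_funM => //.
  exact: (measurableT_comp _ mphi).
- by move=> n x Dx; rewrite lee_fin mulr_ge0 ?rho0.
- by move=> x Dx a b ab; rewrite lee_fin ler_wpM2r ?rho0//; exact: nd.
Qed.

End change_of_variables.

(** The integral of a nonnegative function is a supremum over simple functions below it, hence
    monotone even when the larger function is not measurable. This is applied with [k] the squared
    norm of a weak gradient, expressed in unrelated preferred charts and not known to be
    measurable. *)
Lemma le_integral_unmeasurable d (T : measurableType d) (R : realType)
    (mu : {measure set T -> \bar R}) (P U : set T) (h k : T -> R) :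
  measurable P -> measurable_fun P h -> P `<=` U ->
  (forall x, P x -> 0 <= h x <= k x) -> (forall x, U x -> 0 <= k x) ->
  (\int[mu]_(x in P) (h x)%:E <= \int[mu]_(x in U) (k x)%:E)%E.
Proof.
move=> mP mh PU hk k0.
rewrite integral_mkcond [leRHS]integral_mkcond.
rewrite ge0_integralTE; last first.
  move=> x; rewrite patchE; case: ifPn => //; rewrite inE => /hk/andP[+ _].
  by rewrite lee_fin.
rewrite ge0_integralTE; last first.
  by move=> x; rewrite patchE; case: ifPn => //; rewrite inE => /k0; rewrite lee_fin.
apply: le_ereal_sup => _ [s /= sh <-]; exists s => // x; apply: (le_trans (sh x)).
have [Px|nPx] := pselect (P x).
  by rewrite !patchE !mem_set ?lee_fin; [case/andP: (hk _ Px)|exact: PU|].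
rewrite patchE memNset//; apply: erestrict_ge0 => y Uy.
by rewrite lee_fin k0.
Qed.

Section chart_pieces.
Context {R : realType} {M : ptopologicalType} {m : nat}.
Variables (c : chart R M m) (O : set 'rV[R]_m).
Hypotheses (oO : open O) (Oc : O `<=` cmap c @` cdom c).

Definition piece : set M := cdom c `&` cmap c @^-1` O.

Lemma open_piece : open piece.
Proof. exact: cmap_preimage_open. Qed.

Lemma measurable_open_borel (V : set M) : open V -> measurable (V : set (borel M)).
Proof. exact: sub_sigma_algebra. Qed.

Lemma measurable_piece : measurable (piece : set (borel M)).
Proof. exact: measurable_open_borel open_piece. Qed.

Lemma piece_cinv x : O x -> piece (cinv c x).
Proof. by move=> Ox; have [p cp px] := Oc Ox; split; rewrite /= -px cmapK// px. Qed.

Lemma cinvK x : O x -> cmap c (cinv c x) = x.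
Proof. by move=> /Oc[p cp <-]; rewrite cmapK. Qed.

Lemma measurable_cinv : measurable_fun O (cinv c : 'rV[R]_m -> borel M).
Proof.
apply: (@measurability _ _ _ (borel M) O (cinv c) (@open M) erefl) => _ [V oV <-].
have -> : O `&` cinv c @^-1` V = O `&` cimg c V.
  apply/seteqP; split=> x [Ox /=].
    by move=> Vx; split=> //; have [p cp px] := Oc Ox; exists p => //; split=> //; rewrite -(cmapK cp) px.
  by move=> /cmap_cimg[].
by apply: open_measurable_rV; apply: openI => //; exact: open_cimg.
Qed.

Lemma measurable_cmap : measurable_fun (piece : set (borel M)) (cmap c).
Proof.
apply: (measurability (\big[setU/set0]_(i < m) preimage_set_system setT
  (fun v : 'rV[R]_m => v ord0 i : measurableTypeR R) measurable)) => //.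
move=> _ [B + <-]; rewrite -bigcup_seq => -[i _ [Y mY <-]].
rewrite setTI -comp_preimage.
have mi : measurable_fun (piece : set (borel M)) (fun p => cmap c p ord0 i).
  apply: measurable_fun_gt => a.
  rewrite (_ : _ `&` _ = cdom c `&` cmap c @^-1` (O `&` [set x | a < x ord0 i])).
    apply: measurable_open_borel; apply: cmap_preimage_open; apply: openI => //.
    have : open ((fun x : 'rV[R]_m => x ord0 i) @^-1` [set y : R | a < y]).
      apply: open_comp; last exact: open_gt.
      by move=> x _; exact: coord_continuous.
    by [].
  by apply/seteqP; split=> p /=; rewrite in_itv/= andbT; [move=> [[? ?] ?]|move=> [? [? ?]]];
    split.
exact: mi measurable_piece Y mY.
Qed.

End chart_pieces.

Section riemannian_pieces.
Context {R : realType} {M : ptopologicalType} {m : nat}.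
Variables (S : smooth_structure R M m) (U : set M) (g : M -> 'M[R]_m).
Variable (mu : {measure set (borel M) -> \bar R}).
Hypotheses (gU : riemannian_metric S U g) (muU : riemannian_measure S U g mu).
Variables (c : chart R M m) (O : set 'rV[R]_m).
Hypotheses (ac : atlas S c) (oO : open O) (Oc : O `<=` cimg c U).

Lemma cimg_sub : O `<=` cmap c @` cdom c.
Proof. by move=> x /Oc[p [cp _] <-]; exists p. Qed.

Lemma piece_sub : piece c O `<=` U.
Proof.
by move=> p [cp /Oc[q [cq Uq]]] => /(congr1 (cinv c)); rewrite !cmapK// => <-.
Qed.

Lemma measurable_vol_density : measurable_fun O (vol_density S g c).
Proof.
apply: within_continuous_measurable_rV => // x Ox.
exact: vol_density_continuous gU ac (Oc Ox).
Qed.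

Lemma integral_piece (h : M -> R) : measurable_fun (piece c O : set (borel M)) h ->
  (forall p, piece c O p -> 0 <= h p) ->
  (\int[mu]_(p in piece c O : set (borel M)) (h p)%:E =
   \int[lebesgue_rV m]_(x in O) (h (cinv c x) * vol_density S g c x)%:E)%E.
Proof.
have cO := cimg_sub.
move=> mh h0; apply: (@ge0_integral_change _ _ _ (borel M)) => //.
- exact: open_measurable_rV.
- exact: measurable_piece.
- exact: measurable_cinv.
- exact: piece_cinv.
- exact: measurable_vol_density.
- by move=> x Ox; rewrite sqrtr_ge0.
- move=> B mB BP; rewrite (proj2 muU c)//; last first.
    by move=> p Bp; have := BP _ Bp; move=> /[dup] -[? _] /piece_sub.
  congr integral; apply/seteqP; split=> x.
    by move=> [p Bp <-]; have [cp Op] := BP _ Bp; split=> //=; rewrite cmapK.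
  by move=> [Ox Bx]; exists (cinv c x) => //; exact: cinvK cO _ Ox.
Qed.

End riemannian_pieces.

(** * Compactness near a point of the manifold *)

Section closed_box_extrema.
Context {R : realType} {m : nat}.
Variables (B : 'rV[R]_m.+1 * 'rV[R]_m.+1) (f : 'rV[R]_m.+1 -> R).
Hypotheses (nB : nondeg B) (cf : forall x, cbox B x -> {for x, continuous f}).

Let cbox_neq0 : cbox B !=set0.
Proof. by exists B.1 => i; rewrite /= in_itv/= lexx ltW. Qed.

Let within_cf : {within cbox B, continuous f}.
Proof. by apply: continuous_in_subspaceT => x; rewrite inE; exact: cf. Qed.

Lemma cbox_min : exists2 x, cbox B x & forall y, cbox B y -> f x <= f y.
Proof.
have [x xB H] := EVT_min_rV cbox_neq0 (@compact_cbox _ _ B) within_cf.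
by exists x; [rewrite inE in xB|move=> y By; apply: H; rewrite inE].
Qed.

Lemma cbox_max : exists2 x, cbox B x & forall y, cbox B y -> f y <= f x.
Proof.
have [x xB H] := EVT_max_rV cbox_neq0 (@compact_cbox _ _ B) within_cf.
by exists x; [rewrite inE in xB|move=> y By; apply: H; rewrite inE].
Qed.

End closed_box_extrema.

Section piece_sequence.
Context {R : realType} {M : ptopologicalType} {m : nat}.
Variables (S : smooth_structure R M m.+1) (U : set M) (g : M -> 'M[R]_m.+1).
Variable (mu : {measure set (borel M) -> \bar R}).
Hypotheses (oU : open U) (gU : riemannian_metric S U g).
Hypothesis muU : riemannian_measure S U g mu.
Notation leb := (lebesgue_rV m.+1).
Notation grad X c x i := ((X (cinv c x) *m g (cinv c x) *m (frame S c (cinv c x))^T) ord0 i).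

(** The weak derivative in direction i is g(X, e) with e the i-th coordinate field; Cauchy-Schwarz
    for g bounds its square by g(X, X) g(e, e). *)
Lemma grad_sqr_le X c x i : atlas S c -> cimg c U x ->
  grad X c x i ^+ 2 <= normsq g X (cinv c x) * metric_coord S g c (cinv c x) i i.
Proof.
move=> ac /cmap_cimg[cx Ux _]; set p := cinv c x in cx Ux *.
have rE (n : nat) (B : 'M[R]_(n, m.+1)) (F : 'M[R]_m.+1) j :
    (B *m F^T) j i = (B *m (row i F)^T) j ord0.
  by rewrite !mxE; apply: eq_bigr => k _; rewrite !mxE.
rewrite rE /metric_coord rE.
have -> : (frame S c p *m g p *m (row i (frame S c p))^T) i ord0 =
    (row i (frame S c p) *m g p *m (row i (frame S c p))^T) ord0 ord0.
  by rewrite -!row_mul [in RHS]mxE.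
by apply: posdefmx_CauchySchwarz; exact: (proj1 gU).
Qed.

Variables (c : chart R M m.+1) (Q : 'rV[R]_m.+1 * 'rV[R]_m.+1).
Hypotheses (ac : atlas S c) (nQ : nondeg Q) (QU : obox Q `<=` cimg c U).
Notation rho := (vol_density S g c).

Let oQ : open (obox Q) := @open_obox _ _ Q.
Let Qc : obox Q `<=` cmap c @` cdom c := cimg_sub QU.

Variables (p P C : R).
Hypotheses (p1 : 1 <= p) (pm : m.+1%:R / 2 < p).
Hypothesis rhoP : (\int[leb]_(x in obox Q) (rho x `^ p)%:E <= P%:E)%E.
Hypothesis C0 : 0 < C.
Hypothesis rhoC : forall x i, obox Q x -> metric_coord S g c (cinv c x) i i <= C * rho x.

Variables (u : nat -> M -> R) (X : nat -> M -> 'rV[R]_m.+1) (D : R).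
Hypothesis mu_u : forall k, measurable_fun (U : set (borel M)) (u k).
Hypothesis uX : forall k, is_weak_gradient S U g (u k) (X k).
Hypothesis uD : forall k, (\int[mu]_(q in U : set (borel M)) (u k q ^+ 2)%:E <= D%:E)%E.
Hypothesis XD : forall k,
  (\int[mu]_(q in U : set (borel M)) (normsq g (X k) q)%:E <= D%:E)%E.

Let D0 : 0 <= D.
Proof.
rewrite -lee_fin; apply: le_trans (uD 0); apply: integral_ge0 => x _.
by rewrite lee_fin sqr_ge0.
Qed.

Let mQ : measurable (obox Q) := measurable_obox Q.
Let mU : measurable (U : set (borel M)) := measurable_open_borel oU.
Let mP : measurable (piece c (obox Q) : set (borel M)) := measurable_piece c oQ.
Let PU : piece c (obox Q) `<=` U := piece_sub QU.
Let w k i x := grad (X k) c x i.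

Let rho0 x : obox Q x -> 0 < rho x.
Proof. by move=> Qx; exact: vol_density_gt0 gU ac (QU Qx). Qed.

Let uDQ k : (\int[leb]_(x in obox Q) ((u k \o cinv c) x ^+ 2 * rho x)%:E <= D%:E)%E.
Proof.
apply: le_trans (uD k).
have muU2 V : V `<=` U -> measurable_fun (V : set (borel M)) (fun q => u k q ^+ 2).
  by move=> VU; apply: measurable_funX; exact: (measurable_funS mU VU).
have := integral_piece gU muU ac oQ QU (muU2 _ PU) (fun q _ => sqr_ge0 (u k q)).
move=> <-; apply: ge0_subset_integral => //.
- by apply/measurable_EFinP; exact: muU2.
- by move=> q _; rewrite lee_fin sqr_ge0.
Qed.

Let mw k i : measurable_fun (obox Q) (w k i).
Proof. by have [_ lw _] := uX k ac i; exact: (locally_integrable_measurable nQ QU lw). Qed.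

Let WD k : (\int[leb]_(x in obox Q) (\sum_i w k i x ^+ 2)%:E <= (m.+1%:R * C * D)%:E)%E.
Proof.
pose K := m.+1%:R * C; have K0 : 0 < K by rewrite mulr_gt0.
(* A measurable minorant of the squared norm of the gradient: each w_i^2 is at most that norm times
   C rho, and there are [m.+1] of them. The factor [rho] cancels against the Riemannian density,
   leaving the unweighted energy. *)
pose h x := (\sum_i w k i x ^+ 2) / (K * rho x).
have mrho : measurable_fun (obox Q) rho := measurable_vol_density gU ac oQ QU.
have mW : measurable_fun (obox Q) (fun x => \sum_i w k i x ^+ 2).
  by apply: measurable_sum => i; exact: measurable_funX.
have W0 x : 0 <= \sum_i w k i x ^+ 2 by apply: sumr_ge0 => i _; exact: sqr_ge0.
have mh : measurable_fun (obox Q) h.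
  apply: measurable_funM => //; apply: (measurable_comp (F := [set x : R | 0 < x])).
  - exact: open_measurable.
  - by move=> _ [x Qx <-] /=; rewrite mulr_gt0// rho0.
  - apply: open_continuous_measurable_fun => // x; rewrite inE /= => x0.
    by apply: inv_continuous; rewrite gt_eqF.
  - by apply: measurable_funM.
have mhc : measurable_fun (piece c (obox Q) : set (borel M)) (h \o cmap c).
  apply: (measurable_comp mQ) => //; last exact: measurable_cmap.
  by move=> _ [q [_ Qq] <-].
have mhcc : measurable_fun (obox Q) (fun x => (h \o cmap c) (cinv c x)).
  by apply: eq_measurable_fun mh => x; rewrite inE => Qx /=; rewrite (cinvK Qc Qx).
have h0 q : piece c (obox Q) q -> 0 <= h (cmap c q).
  by move=> [_ Qq]; rewrite /h divr_ge0// mulr_ge0// ltW// rho0.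
have hE x : obox Q x -> \sum_i w k i x ^+ 2 = K * ((h \o cmap c) (cinv c x) * rho x).
  move=> Qx; rewrite /= (cinvK Qc Qx) /h.
  by field; rewrite ?gt_eqF ?rho0// mulr_gt0 ?rho0.
apply: (@le_trans _ _ (\int[leb]_(x in obox Q) (K%:E * ((h \o cmap c) (cinv c x) * rho x)%:E))%E).
  apply: eqW; apply: eq_integral => x.
  by rewrite inE => Qx; rewrite hE// EFinM.
rewrite ge0_integralZl//; last 3 first.
- by apply/measurable_EFinP; exact: (measurable_funM mhcc mrho).
- move=> x Qx; rewrite lee_fin mulr_ge0//; last by rewrite ltW// rho0.
  by apply: h0; exact: piece_cinv.
- by rewrite lee_fin ltW.
rewrite -(integral_piece gU muU ac oQ QU mhc h0) (EFinM K).
apply: lee_wpmul2l; first by rewrite lee_fin ltW.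
apply: le_trans (XD k); apply: (@le_integral_unmeasurable _ (borel M) _ mu
  (piece c (obox Q)) U (h \o cmap c) (normsq g (X k)) mP mhc PU); last first.
  by move=> q Uq; apply: posdefmx_ge0; exact: (proj1 gU).
move=> q Pq; rewrite (h0 _ Pq) andTb.
have [cq Qq] := Pq.
have qE : q = cinv c (cmap c q) by rewrite cmapK.
rewrite /= /h ler_pdivrMr; last by rewrite mulr_gt0// rho0.
apply: (@le_trans _ _ (\sum_(i < m.+1) normsq g (X k) q * (C * rho (cmap c q)))); last first.
  rewrite big_const_ord iter_addr_0 -mulr_natr /K.
  by apply: eqW; ring.
apply: ler_sum => i _; apply: (le_trans (grad_sqr_le (X k) i ac (QU Qq))).
rewrite -qE; apply: ler_wpM2l.
  by apply: posdefmx_ge0; apply: (proj1 gU); exact: PU.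
by rewrite [in leLHS]qE; exact: rhoC.
Qed.

Lemma piece_ultra_cauchy (F : set_system nat) (eps : R) : UltraFilter F -> 0 < eps ->
  exists A, F A /\ forall k l, A k -> A l ->
    (\int[mu]_(q in piece c (obox Q) : set (borel M)) ((u k q - u l q) ^+ 2)%:E <= eps%:E)%E.
Proof.
move=> FU e0.
have crho x : obox Q x -> {for x, continuous rho}.
  by move=> Qx; exact: vol_density_continuous gU ac (QU Qx).
have shQ : cbox (shrink 4^-1 Q) `<=` obox Q by apply: shrink_cbox => //; rewrite invr_gt0.
have nsQ : nondeg (shrink 4^-1 Q).
  by apply: nondeg_shrink => //; rewrite ltf_pV2 ?posrE// ltr_nat.
(* The lower bound [c0] of the weight on the middle box is its minimum over the closed middle box,
   where the density is continuous and positive. *)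
have [x0 x0Q Hx0] := cbox_min nsQ (fun x xQ => crho x (shQ x xQ)).
pose D' := D + m.+1%:R * C * D.
have DD' : D <= D' by rewrite lerDl !mulr_ge0// ltW.
have WD' : m.+1%:R * C * D <= D' by rewrite lerDr.
have uD' k : (\int[leb]_(x in obox Q) ((u k \o cinv c) x ^+ 2 * rho x)%:E <= D'%:E)%E.
  by apply: le_trans (uDQ k) _; rewrite lee_fin.
have XD' k : (\int[leb]_(x in obox Q) (\sum_i w k i x ^+ 2)%:E <= D'%:E)%E.
  by apply: le_trans (WD k) _; rewrite lee_fin.
have [A [FA HA]] := box_ultra_cauchy nQ QU (measurable_vol_density gU ac oQ QU) rho0
  (rho0 (shQ _ x0Q)) (fun x xQ => Hx0 x (@sub_hc _ _ _ x xQ)) p1 pm rhoP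
  (fun k i => uX k ac i) uD' XD' FU e0.
exists A; split => // k l Ak Al.
have mukl V : V `<=` U -> measurable_fun (V : set (borel M)) (fun q => (u k q - u l q) ^+ 2).
  move=> VU; apply: measurable_funX; apply: measurable_funB; exact: (measurable_funS mU VU).
rewrite (integral_piece gU muU ac oQ QU (mukl _ PU) (fun q _ => sqr_ge0 _)).
exact: HA.
Qed.

End piece_sequence.

Section Lp_spaces.
Context {R : realType} {M : ptopologicalType}.
Variables (U : set M) (mu : {measure set (borel M) -> \bar R}).
Hypothesis mU : measurable (U : set (borel M)).
Variable q : R.
Hypothesis q0 : 0 < q.

Lemma Lp_normE (u : M -> R) : Lp_norm U mu q u =
  ((\int[mu]_(x in U : set (borel M)) (`|u x| `^ q)%:E) `^ q^-1)%E.
Proof.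
rewrite /Lp_norm Lnorm.unlock /=.
rewrite [in RHS]integral_mkcond; congr (_ `^ _)%E; apply: eq_integral => x _ /=.
rewrite !patchE; case: ifPn => // _.
(* Outside [U] the restricted function takes the default value [point], which is 0 in [R]; its power
   is 0 because [q] is nonzero. *)
by rewrite (_ : (point : R) = 0)// normr0 powR0// gt_eqF.
Qed.

Lemma LpP (u : M -> R) : Lp U mu q u <-> measurable_fun (U : set (borel M)) u /\
  (\int[mu]_(x in U : set (borel M)) (`|u x| `^ q)%:E < +oo)%E.
Proof.
have E : ((\int[mu]_(x in U : set (borel M)) (`|u x| `^ q)%:E) `^ q^-1 < +oo)%E <->
    (\int[mu]_(x in U : set (borel M)) (`|u x| `^ q)%:E < +oo)%E.
  split => [h|]; last exact: poweR_lty.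
  rewrite -[X in (X < _)%E]poweRe1; last first.
    by apply: integral_ge0 => x _; rewrite lee_fin powR_ge0.
  by rewrite -(@mulVf _ q) ?gt_eqF// poweRrM; exact: poweR_lty.
have H := @measurable_restrictT _ _ (borel M) (measurableTypeR R) _ u mU.
rewrite /Lp /=; split.
  rewrite inE /= => /andP[]; rewrite !inE /= => mu_ fu; split.
    exact: (proj2 H mu_).
  by apply/E; rewrite -Lp_normE.
move=> [mu_ fu]; rewrite inE /=; apply/andP; rewrite !inE /=; split.
  exact: (proj1 H mu_).
by rewrite /finite_norm -/(Lp_norm U mu q u) Lp_normE; apply/E.
Qed.

End Lp_spaces.

Lemma powR2_norm (R : realType) (a : R) : `|a| `^ 2 = a ^+ 2.
Proof. by rewrite powR_mulrn// real_normK// num_real. Qed.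

(** * The scaled metric on a piece of a chart *)

Section scaled_piece.
Context {R : realType} {M : ptopologicalType} {m : nat}.
Variables (S : smooth_structure R M m.+1) (U : set M) (g gt : M -> 'M[R]_m.+1).
Variable (A : {measure set (borel M) -> \bar R}).
Hypotheses (oU : open U) (gT : riemannian_metric S setT g).
Hypothesis AT : riemannian_measure S setT g A.
Variables (c : chart R M m.+1) (Q : 'rV[R]_m.+1 * 'rV[R]_m.+1).
Hypotheses (ac : atlas S c) (nQ : nondeg Q) (QU : obox Q `<=` cimg c U).
Variables (k : nat) (f : M -> R) (q C1 a b B : R).
Hypotheses (k0 : (0 < k)%N) (km : (k <= m.+1)%N).
Hypothesis kq : k%:R * (m.+1%:R / 2) < q.
Hypothesis m1 : (1 < m.+1)%N.
Hypothesis fLp : Lp U A q f.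
Hypothesis f_lower : forall p, U p -> f p ^+ 2 <= C1 * `|f p| ^+ k.
Hypothesis f_lower1 : (k < m.+1)%N -> forall p, U p -> 1 <= C1 * `|f p| ^+ k.
Notation G x := (metric_coord S g c (cinv c x)).
Notation Gt x := (metric_coord S gt c (cinv c x)).
Notation rho := (vol_density S gt c).
Notation leb := (lebesgue_rV m.+1).
Hypothesis GtE : forall x, obox Q x -> Gt x = scale_block k (f (cinv c x) ^+ 2) (G x).
Hypothesis Gblock : forall x (i j : 'I_m.+1), obox Q x ->
  (i < k)%N != (j < k)%N -> G x i j = 0.
Hypotheses (a0 : 0 < a) (C10 : 0 <= C1).
Hypothesis abE : forall x, obox Q x -> a <= vol_density S g c x <= b.
Hypothesis BE : forall x i, obox Q x -> G x i i <= B.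

Let scaled_density x : obox Q x ->
  rho x = `|f (cinv c x)| ^+ k * vol_density S g c x.
Proof.
move=> Qx; rewrite /vol_density GtE// det_scale_block//; last first.
  by move=> i j; exact: Gblock.
rewrite sqrtrM; last by rewrite exprn_ge0// sqr_ge0.
by congr (_ * _); rewrite exprAC sqrtr_sqr normrX.
Qed.

Let k_gt0 : 0 < k%:R :> R. Proof. by rewrite ltr0n. Qed.
Let q_gt0 : 0 < q.
Proof. by apply: lt_trans kq; rewrite mulr_gt0 ?divr_gt0. Qed.
Let mU : measurable (U : set (borel M)) := measurable_open_borel oU.
Let Qc : obox Q `<=` cimg c setT.
Proof. by move=> x /QU[p [cp _] <-]; exists p. Qed.
Let oQ : open (obox Q) := @open_obox _ _ Q.
Let p := q / k%:R.
Let pm : m.+1%:R / 2 < p.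
Proof. by rewrite ltr_pdivlMr// mulrC. Qed.
Let p1 : 1 <= p.
Proof. by apply: (le_trans _ (ltW pm)); rewrite ler_pdivlMr// mul1r ler_nat. Qed.

Let b0 x : obox Q x -> 0 < b.
Proof. by move=> /abE/andP[h1 h2]; exact: lt_le_trans (le_trans h1 h2). Qed.

Lemma scaled_density_integral : exists P,
  (\int[leb]_(x in obox Q) (rho x `^ p)%:E <= P%:E)%E.
Proof.
have [mf If] := (proj1 (LpP A mU q_gt0 f) fLp).
have PU : piece c (obox Q) `<=` U := piece_sub QU.
have mP : measurable (piece c (obox Q) : set (borel M)) := measurable_piece c oQ.
pose h x := `|f x| `^ q.
have mh V : measurable (V : set (borel M)) -> V `<=` U -> measurable_fun (V : set (borel M)) h.
  move=> mV VU; apply: (measurableT_comp (measurable_powR q)).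
  by apply: measurableT_comp => //; exact: (measurable_funS mU VU).
have h0 x : 0 <= h x by exact: powR_ge0.
pose I := fine (\int[A]_(x in U : set (borel M)) (h x)%:E)%E.
have IE : (\int[A]_(x in U : set (borel M)) (h x)%:E = I%:E)%E.
  by rewrite fineK// ge0_fin_numE//; apply: integral_ge0 => x _; rewrite lee_fin.
exists (`|b| `^ (p - 1) * I).
have mG : measurable_fun (obox Q) (vol_density S g c) := measurable_vol_density gT ac oQ Qc.
have mhc : measurable_fun (obox Q) (h \o cinv c).
  apply: (@measurable_comp _ _ _ _ (borel M) _ (piece c (obox Q))) => //.
  - by move=> _ [x Qx <-]; apply: piece_cinv => //; exact: cimg_sub Qc.
  - exact: mh.
  - by apply: measurable_cinv => //; exact: cimg_sub Qc.
have mhG : measurable_fun (obox Q) (fun x => h (cinv c x) * vol_density S g c x).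
  exact: (measurable_funM mhc mG).
(* With p = q / k, the power of |f|^k is |f|^q. From the p-th power of the density of [g], p - 1
   factors are bounded by [b], and one is kept as the density that turns the integral over the box
   into one over M. *)
have rhoE x : obox Q x -> rho x `^ p <= `|b| `^ (p - 1) * (h (cinv c x) * vol_density S g c x).
  move=> Qx; rewrite scaled_density//; have /andP[h1 h2] := abE Qx.
  have G0 : 0 < vol_density S g c x by exact: lt_le_trans h1.
  rewrite powRM ?exprn_ge0 ?(ltW G0)// -powR_mulrn// -powRrM /p mulrCA divff ?gt_eqF// mulr1.
  rewrite -/(h _) mulrCA; apply: ler_wpM2l => //.
  rewrite -/p -{1}[p](subrK 1) powRD; last by apply/implyP => _; rewrite gt_eqF.
  rewrite (powRr1 (ltW G0)); apply: ler_wpM2r; first exact: ltW.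
  apply: ge0_ler_powR; rewrite ?nnegrE ?subr_ge0// ?(ltW G0)//.
  exact: le_trans h2 (ler_norm b).
apply: (@le_trans _ _ (\int[leb]_(x in obox Q)
   ((`|b| `^ (p - 1))%:E * (h (cinv c x) * vol_density S g c x)%:E))%E).
  apply: (@le_integral_unmeasurable _ _ _ leb (obox Q) (obox Q) (fun x => rho x `^ p)
    (fun x => `|b| `^ (p - 1) * (h (cinv c x) * vol_density S g c x))) => //.
  - exact: measurable_obox.
  - apply: (measurableT_comp (measurable_powR p)).
    apply: (eq_measurable_fun (fun x => `|f (cinv c x)| ^+ k * vol_density S g c x)).
      by move=> x; rewrite inE => Qx; rewrite scaled_density.
    apply: measurable_funM => //; apply: measurable_funX; apply: measurableT_comp => //.
    apply: (@measurable_comp _ _ _ _ (borel M) _ (piece c (obox Q))) => //.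
    + by move=> _ [x Qx <-]; apply: piece_cinv => //; exact: cimg_sub Qc.
    + exact: (measurable_funS mU PU mf).
    + by apply: measurable_cinv => //; exact: cimg_sub Qc.
  - by move=> x Qx; rewrite powR_ge0 rhoE.
  - by move=> x Qx; rewrite mulr_ge0 ?powR_ge0// mulr_ge0// sqrtr_ge0.
rewrite ge0_integralZl//; last 3 first.
- exact: measurable_obox.
- exact/measurable_EFinP.
- by move=> x _; rewrite lee_fin mulr_ge0// sqrtr_ge0.
rewrite -(integral_piece gT AT ac oQ Qc (mh _ mP PU) (fun x _ => h0 x)).
rewrite (EFinM (`|b| `^ (p - 1)) I) -IE; apply: lee_wpmul2l; first by rewrite lee_fin powR_ge0.
apply: ge0_subset_integral => //.
- by apply/measurable_EFinP; exact: mh.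
- by move=> x _; rewrite lee_fin.
Qed.

(** Both blocks are at most B C1 |f|^k: the scaled one by [f_lower], the other by [f_lower1],
    available because an index outside the first block forces k < m+1. Then |f|^k <= rho / a. The
    added 1 makes [C] positive. *)
Lemma scaled_metric_le : exists2 C, 0 < C &
  forall x i, obox Q x -> Gt x i i <= C * rho x.
Proof.
pose C := `|B| * C1 / a + 1; have C0 : 0 <= `|B| * C1 / a by rewrite !mulr_ge0// invr_ge0 ltW.
exists C; first by rewrite ltr_wpDl.
move=> x i Qx; have [cx Ux xE] := cmap_cimg (QU Qx).
have /andP[ax bx] := abE Qx.
have fk0 : 0 <= `|f (cinv c x)| ^+ k by rewrite exprn_ge0.
apply: (@le_trans _ _ (`|B| * (C1 * `|f (cinv c x)| ^+ k))).
  have GB : G x i i <= `|B| by exact: le_trans (BE i Qx) (ler_norm B).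
  have fk := f_lower Ux.
  rewrite GtE// mxE andbb; case: ifPn => ik.
    rewrite mulrC; apply: (@le_trans _ _ (`|B| * f (cinv c x) ^+ 2)).
      by apply: ler_wpM2r; rewrite ?sqr_ge0.
    by apply: ler_wpM2l.
  have km' : (k < m.+1)%N by rewrite -leqNgt in ik; exact: leq_ltn_trans (ltn_ord i).
  have h := f_lower1 km' Ux.
  apply: (le_trans GB); rewrite -{1}[`|B|]mulr1; exact: ler_wpM2l.
rewrite scaled_density// /C mulrDl mul1r.
apply: (@le_trans _ _ (`|B| * C1 / a * (`|f (cinv c x)| ^+ k * vol_density S g c x))); last first.
  by rewrite lerDl mulr_ge0// sqrtr_ge0.
rewrite -!mulrA; apply: ler_wpM2l => //; apply: ler_wpM2l => //.
rewrite mulrCA; rewrite -{1}[_ ^+ k]mulr1; apply: ler_wpM2l => //.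
by rewrite mulrC ler_pdivlMr// mul1r.
Qed.

Variables (At : {measure set (borel M) -> \bar R}).
Hypotheses (gtU : riemannian_metric S U gt) (AtU : riemannian_measure S U gt At).
Variables (u : nat -> M -> R) (X : nat -> M -> 'rV[R]_m.+1) (D : R).
Hypothesis mu_u : forall n, measurable_fun (U : set (borel M)) (u n).
Hypothesis uX : forall n, is_weak_gradient S U gt (u n) (X n).
Hypothesis uD : forall n, (\int[At]_(x in U : set (borel M)) (u n x ^+ 2)%:E <= D%:E)%E.
Hypothesis XD : forall n,
  (\int[At]_(x in U : set (borel M)) (normsq gt (X n) x)%:E <= D%:E)%E.

Lemma scaled_piece_ultra_cauchy (F : set_system nat) (eps : R) : UltraFilter F -> 0 < eps ->
  exists E, F E /\ forall n l, E n -> E l ->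
    (\int[At]_(x in piece c (obox Q) : set (borel M)) ((u n x - u l x) ^+ 2)%:E <= eps%:E)%E.
Proof.
move=> FU e0; have [P HP] := scaled_density_integral; have [C C0 HC] := scaled_metric_le.
exact: (piece_ultra_cauchy oU gtU AtU ac nQ QU p1 pm HP C0 HC mu_u uX uD XD FU e0).
Qed.

End scaled_piece.

Lemma le_integral_setU d (T : measurableType d) (R : realType)
    (mu : {measure set T -> \bar R}) (A B : set T) (f : T -> \bar R) :
  measurable A -> measurable B -> measurable_fun (A `|` B) f ->
  (forall x, (A `|` B) x -> (0 <= f x)%E) ->
  (\int[mu]_(x in A `|` B) f x <= \int[mu]_(x in A) f x + \int[mu]_(x in B) f x)%E.
Proof.
move=> mA mB mf f0.
have mBA : measurable (B `\` A) by exact: measurableD.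
have E : A `|` B = A `|` (B `\` A).
  apply/seteqP; split=> x; last by move=> [?|[? _]]; [left|right].
  by move=> [Ax|Bx]; [left|have [|] := pselect (A x); [left|right]].
rewrite {1}E ge0_integral_setU//; last 3 first.
- by rewrite -E.
- by rewrite -E.
- by apply/disj_setPS => x [Ax [_ nAx]].
apply: leeD => //; apply: ge0_subset_integral => //.
- apply: (measurable_funS _ _ mf); first exact: measurableU.
  exact: subsetUr.
- by move=> x Bx; apply: f0; right.
Qed.

Section ultra_cauchy_sets.
Context d (T : measurableType d) (R : realType) (mu : {measure set T -> \bar R}).
Variables (F : set_system nat) (u : nat -> T -> R) (U : set T).
Hypotheses (FU : UltraFilter F) (mU : measurable U).
Hypothesis mu_u : forall n, measurable_fun U (u n).

Definition ultra_cauchy_on (W : set T) := forall eps : R, 0 < eps ->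
  exists E, F E /\ forall n l, E n -> E l ->
    (\int[mu]_(x in W) ((u n x - u l x) ^+ 2)%:E <= eps%:E)%E.

Let mukl n l V : measurable V -> V `<=` U ->
  measurable_fun V (fun x => ((u n x - u l x) ^+ 2)%:E).
Proof.
move=> mV VU; apply/measurable_EFinP; apply: measurable_funX.
by apply: measurable_funB; exact: (measurable_funS mU VU).
Qed.

Lemma ultra_cauchy_onU V W : measurable V -> measurable W -> V `|` W `<=` U ->
  ultra_cauchy_on V -> ultra_cauchy_on W -> ultra_cauchy_on (V `|` W).
Proof.
move=> mV mW WU HV HW eps e0; have e2 : 0 < eps / 2 by rewrite divr_gt0.
have FP : ProperFilter F by exact: ultra_proper.
have [E1 [FE1 H1]] := HV _ e2; have [E2 [FE2 H2]] := HW _ e2.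
exists (E1 `&` E2); split; first exact: filterI.
move=> n l [n1 n2] [l1 l2]; rewrite (splitr eps) EFinD.
apply: (@le_trans _ _ (\int[mu]_(x in V) ((u n x - u l x) ^+ 2)%:E +
  \int[mu]_(x in W) ((u n x - u l x) ^+ 2)%:E)%E); last first.
  by apply: leeD; [exact: H1|exact: H2].
apply: le_integral_setU => //.
- by apply: mukl => //; exact: measurableU.
- by move=> x _; rewrite lee_fin sqr_ge0.
Qed.

Lemma ultra_cauchy_on_null V : measurable V -> V `<=` U -> mu V = 0%E ->
  ultra_cauchy_on V.
Proof.
move=> mV VU V0 eps e0; exists setT; split.
  by have FP : ProperFilter F := ultra_proper; exact: filterT.
move=> n l _ _; rewrite null_set_integral//; first by rewrite lee_fin ltW.
exact: mukl.
Qed.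

Lemma ultra_cauchy_on_bigcup (I : choiceType) (s : seq I) (V : I -> set T) :
  (forall i, measurable (V i)) -> (forall i, V i `<=` U) ->
  (forall i, ultra_cauchy_on (V i)) -> ultra_cauchy_on (\big[setU/set0]_(i <- s) V i).
Proof.
move=> mV VU HV; elim: s => [|i s IH].
  by rewrite big_nil; apply: ultra_cauchy_on_null; rewrite ?measure0.
rewrite big_cons; apply: ultra_cauchy_onU => //; first exact: bigsetU_measurable.
by rewrite subUset; split => //; rewrite -bigcup_seq; exact: bigcup_sub.
Qed.

(** A finite subcover suffices, and the common ultrafilter lets the finitely many sets of indices be
    intersected. The map [pi] is later the identity; it separates the measurable space [borel M]
    from the topological space [M]. *)
Lemma compact_ultra_cauchy_on (M : ptopologicalType) (pi : T -> M) : compact [set: M] ->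
  (forall p, exists V, [/\ open V, V p, measurable (pi @^-1` V `&` U) &
     ultra_cauchy_on (pi @^-1` V `&` U)]) -> ultra_cauchy_on U.
Proof.
move=> cM /choice[V HV].
have : cover_compact [set: M] by rewrite -compact_cover.
move=> /(_ M setT V)[].
- by move=> p _; have [] := HV p.
- by move=> p _; exists p => //; have [] := HV p.
move=> s _ cov; have := @ultra_cauchy_on_bigcup _ (finmap.enum_fset s) (fun p => pi @^-1` V p `&` U).
have -> : \big[setU/set0]_(p <- finmap.enum_fset s) (pi @^-1` V p `&` U) = U.
  rewrite -bigcup_seq; apply/seteqP; split => [x [p _ []//]|x Ux].
  by have [p /= sp Vp] := cov (pi x) I; exists p.
apply.
- by move=> p; have [] := HV p.
- by move=> p x [].
- by move=> p; have [] := HV p.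
Qed.

End ultra_cauchy_sets.

Section boxes_in_charts.
Context {R : realType} {M : ptopologicalType} {m : nat}.
Implicit Types (c : chart R M m.+1) (U : set M).

(** The box is centred at [x], so that bisecting it cuts along coordinate hyperplanes through [x];
    near N this is the hyperplane that contains N. *)
Lemma cbox_nbhs (x : 'rV[R]_m.+1) (O : set 'rV[R]_m.+1) : nbhs x O ->
  exists Q, [/\ nondeg Q, obox Q x, cbox Q `<=` O & forall i, mid i Q = x ord0 i].
Proof.
move=> /nbhs_obox[e e0 eO]; pose e2 := e / 2; have e20 : 0 < e2 by rewrite divr_gt0.
have e2e : e2 < e by rewrite /e2; lra.
exists (x - const_mx e2, x + const_mx e2); split.
- by move=> i; rewrite /= !mxE; lra.
- by move=> i; rewrite /= !mxE in_itv/=; apply/andP; split; lra.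
- move=> y yQ; apply: eO => i; have := yQ i; rewrite /= !mxE !in_itv/= => /andP[h1 h2].
  by apply/andP; split; lra.
- by move=> i; rewrite /mid /= !mxE; lra.
Qed.

Lemma sub_oc (Q : 'rV[R]_m.+1 * 'rV[R]_m.+1) : obox Q `<=` cbox Q.
Proof. by move=> x /sub_oh/sub_hc. Qed.

Lemma measurable_hyperplane (i : 'I_m.+1) (a : R) :
  measurable [set x : 'rV[R]_m.+1 | x ord0 i = a].
Proof.
have := measurable_coor i measurableT (measurable_set1 (a : measurableTypeR R)).
by rewrite setTI.
Qed.

Variables (S : smooth_structure R M m.+1).

Lemma metric_bounds U g c Q : riemannian_metric S U g -> atlas S c -> nondeg Q ->
  cbox Q `<=` cimg c U -> exists a b B : R, [/\ 0 < a,
    forall x, cbox Q x -> a <= vol_density S g c x <= b &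
    forall x i, cbox Q x -> metric_coord S g c (cinv c x) i i <= B].
Proof.
move=> gU ac nQ QU.
have cr x : cbox Q x -> {for x, continuous (vol_density S g c)}.
  by move=> Qx; exact: vol_density_continuous gU ac (QU _ Qx).
have [x0 x0Q Hx0] := cbox_min nQ cr; have [x1 x1Q Hx1] := cbox_max nQ cr.
have /choice[xs Hxs] : forall i : 'I_m.+1, exists x, forall y, cbox Q y ->
    metric_coord S g c (cinv c y) i i <= metric_coord S g c (cinv c x) i i.
  move=> i; have ci x : cbox Q x -> {for x, continuous (fun y => metric_coord S g c (cinv c y) i i)}.
    by move=> Qx; exact: metric_coord_continuous gU ac (QU _ Qx).
  by have [x _ Hx] := cbox_max nQ ci; exists x.
exists (vol_density S g c x0), (vol_density S g c x1),
  (\sum_i `|metric_coord S g c (cinv c (xs i)) i i|); split.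
- exact: vol_density_gt0 gU ac (QU _ x0Q).
- by move=> x Qx; apply/andP; split; [exact: Hx0|exact: Hx1].
- move=> x i Qx; apply: (le_trans (Hxs i x Qx)); apply: (le_trans (ler_norm _)).
  by rewrite (bigD1 i)//= lerDl; apply: sumr_ge0.
Qed.

End boxes_in_charts.

Section points.
Context {R : realType} {M : ptopologicalType} {m : nat}.
Variables (S : smooth_structure R M m.+1) (U : set M) (gt : M -> 'M[R]_m.+1).
Variable (At : {measure set (borel M) -> \bar R}).
Hypotheses (oU : open U) (gtU : riemannian_metric S U gt).
Hypothesis AtU : riemannian_measure S U gt At.
Hypothesis m1 : (1 < m.+1)%N.
Variables (u : nat -> M -> R) (X : nat -> M -> 'rV[R]_m.+1) (D : R).
Hypothesis mu_u : forall n, measurable_fun (U : set (borel M)) (u n).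
Hypothesis uX : forall n, is_weak_gradient S U gt (u n) (X n).
Hypothesis uD : forall n, (\int[At]_(x in U : set (borel M)) (u n x ^+ 2)%:E <= D%:E)%E.
Hypothesis XD : forall n,
  (\int[At]_(x in U : set (borel M)) (normsq gt (X n) x)%:E <= D%:E)%E.
Variable F : set_system nat.
Hypothesis FU : UltraFilter F.
Notation leb := (lebesgue_rV m.+1).
Notation ucauchy W := (@ultra_cauchy_on _ (borel M) R At F u W).
Let mU : measurable (U : set (borel M)) := measurable_open_borel oU.

Lemma regular_point p : U p -> exists V, [/\ open V, V p,
  measurable (V `&` U : set (borel M)) & ucauchy (V `&` U)].
Proof.
move=> Up; pose c := chart_at S p.
have ac : atlas S c := chart_at_atlas S p; have cp : cdom c p := chart_at_dom S p.
have : nbhs (cmap c p) (cimg c U).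
  by apply: open_nbhs_nbhs; split; [exact: open_cimg|exists p].
move=> /cbox_nbhs[Q [nQ Qp QU _]].
have QoU : obox Q `<=` cimg c U by exact: subset_trans (@sub_oc _ _ Q) QU.
have oV : open (piece c (obox Q)) by apply: open_piece; exact: open_obox.
exists (piece c (obox Q)); split => //.
  by apply: measurableI => //; exact: measurable_open_borel.
rewrite (setIidl (piece_sub QoU)).
have [a [b [B [a0 ab HB]]]] := metric_bounds gtU ac nQ QU.
have B0 : 0 <= `|B| / a by rewrite divr_ge0// ltW.
have b0 x : obox Q x -> vol_density S gt c x <= `|b|.
  by move=> /sub_oc/ab/andP[_ h]; exact: le_trans h (ler_norm b).
(* The density is bounded on this box, so any exponent above half the dimension would do; the
   dimension itself is also at least 1. *)
have rhoP : (\int[leb]_(x in obox Q) (vol_density S gt c x `^ m.+1%:R)%:E <=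
    (`|b| `^ m.+1%:R * vol Q)%:E)%E.
  apply: (@le_trans _ _ (\int[leb]_(x in obox Q) (cst (`|b| `^ m.+1%:R)%:E x))%E).
    apply: ge0_le_integral => //.
    - exact: measurable_obox.
    - by move=> x _; rewrite lee_fin powR_ge0.
    - apply/measurable_EFinP; apply: (measurableT_comp (measurable_powR _)).
      by apply: (measurable_vol_density gtU ac _ QoU); exact: open_obox.
    - move=> x Qx; rewrite lee_fin; apply: ge0_ler_powR; rewrite ?nnegrE ?sqrtr_ge0//.
      exact: b0.
  rewrite integral_cst//; last exact: measurable_obox.
  by rewrite lebesgue_obox// => i; exact: ltW.
have mm : m.+1%:R / 2 < m.+1%:R :> R.
  by rewrite ltr_pdivrMr// ltr_pMr ?ltr0n// ltr1n.
have B1 : 0 < `|B| / a + 1 by rewrite ltr_wpDl.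
have HC x i : obox Q x -> metric_coord S gt c (cinv c x) i i <=
    (`|B| / a + 1) * vol_density S gt c x.
  move=> /sub_oc Qx; have /andP[h1 h2] := ab x Qx.
  apply: (le_trans (HB x i Qx)); apply: (le_trans (ler_norm B)).
  rewrite mulrDl mul1r -[leLHS]addr0; apply: lerD; last exact: sqrtr_ge0.
  rewrite mulrAC ler_pdivlMr//; exact: ler_wpM2l.
move=> eps e0.
have m1R : 1 <= m.+1%:R :> R by rewrite ler1n.
exact: (piece_ultra_cauchy oU gtU AtU ac nQ QoU m1R mm rhoP B1 HC mu_u uX uD XD FU e0).
Qed.

Variables (N : set M) (n : nat) (g : M -> 'M[R]_m.+1) (D0 : set (chart R M m.+1)).
Variable (A : {measure set (borel M) -> \bar R}).
Hypothesis UE : U = ~` N.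
Hypotheses (hmn : (n + 2 <= m.+1)%N) (D0_diag : diagonalizes S n N g D0).
Hypotheses (gT : riemannian_metric S setT g) (AT : riemannian_measure S setT g A).
Variables (f : M -> R) (V0 : set M) (q C1 : R).
Hypotheses (oV0 : open V0) (NV0 : N `<=` V0).
Let k := (m.+1 - n)%N.
Hypothesis gtE : forall c p, D0 c -> cdom c p -> V0 p -> ~ N p ->
  metric_coord S gt c p = scale_block k (f p ^+ 2) (metric_coord S g c p).
Hypothesis kq : k%:R * (m.+1%:R / 2) < q.
Hypothesis fLp : Lp U A q f.
Hypothesis C10 : 0 <= C1.
Hypothesis f_lower : forall p, U p -> f p ^+ 2 <= C1 * `|f p| ^+ k.
Hypothesis f_lower1 : (k < m.+1)%N -> forall p, U p -> 1 <= C1 * `|f p| ^+ k.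

Lemma singular_point p : N p -> exists V, [/\ open V, V p,
  measurable (V `&` U : set (borel M)) & ucauchy (V `&` U)].
Proof.
move=> Np; have [D0S covD emb _ diagD] := D0_diag.
have [c Dc cp] := covD p Np; have ac : atlas S c := D0S c Dc.
have k0 : (0 < k)%N by rewrite /k subn_gt0; lia.
have km : (k <= m.+1)%N by exact: leq_subr.
(* [ord0] indexes a transverse coordinate because k > 0, so it vanishes at every point of N in the
   chart. *)
have xp0 : cmap c p ord0 ord0 = 0 by exact: (proj1 (emb c Dc p cp) Np).
have : nbhs (cmap c p) (cimg c V0).
  by apply: open_nbhs_nbhs; split; [exact: open_cimg|exists p => //; split => //; exact: NV0].
move=> /cbox_nbhs[Q [nQ Qp QV0 Qmid]].
have mid0 : mid ord0 Q = 0 by rewrite Qmid.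
have QT : cbox Q `<=` cimg c setT by move=> x /QV0[r [cr _] <-]; exists r.
have [a [b [B [a0 ab HB]]]] := metric_bounds gT ac nQ QT.
have QoV0 : obox Q `<=` cimg c V0 by exact: subset_trans (@sub_oc _ _ Q) QV0.
have off x : obox Q x -> x ord0 ord0 != 0 -> cimg c U x.
  move=> /QoV0[r [cr Vr] <-] x0; exists r => //; split => //; rewrite UE => Nr.
  by move/eqP: x0; apply; exact: (proj1 (emb c Dc r cr) Nr).
have half Q' : nondeg Q' -> obox Q' `<=` obox Q ->
    (forall x, obox Q' x -> x ord0 ord0 != 0) -> ucauchy (piece c (obox Q')).
  move=> nQ' QQ Q0 eps e0.
  have Q'U : obox Q' `<=` cimg c U by move=> x Qx; apply: off; [exact: QQ|exact: Q0].
  have GE x : obox Q' x -> metric_coord S gt c (cinv c x) =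
      scale_block k (f (cinv c x) ^+ 2) (metric_coord S g c (cinv c x)).
    move=> Qx; have [cx Ux _] := cmap_cimg (Q'U x Qx).
    have [_ Vx _] := cmap_cimg (QoV0 x (QQ x Qx)).
    by apply: gtE => //; rewrite UE in Ux.
  have GB x (i j : 'I_m.+1) : obox Q' x -> (i < k)%N != (j < k)%N ->
      metric_coord S g c (cinv c x) i j = 0.
    by move=> Qx; have [cx _ _] := cmap_cimg (Q'U x Qx); exact: diagD.
  apply: (scaled_piece_ultra_cauchy oU gT AT ac nQ' Q'U k0 km kq m1 fLp f_lower f_lower1
    GE GB a0 C10 _ _ gtU AtU mu_u uX uD XD FU e0).
  - by move=> x /QQ/sub_oc; exact: ab.
  - by move=> x i /QQ/sub_oc; exact: HB.
have nl := nondeg_lo ord0 nQ; have nh := nondeg_hi ord0 nQ.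
have ucl : ucauchy (piece c (obox (lo ord0 Q))).
  apply: half => // x /(loP _ (nQ ord0)) [//]; rewrite mid0 => _ h.
  by rewrite lt_eqF.
have uch : ucauchy (piece c (obox (hi ord0 Q))).
  apply: half => // x /(hiP _ (nQ ord0)) [//]; rewrite mid0 => _ h.
  by rewrite gt_eqF.
pose P := piece c (obox Q); pose Pl := piece c (obox (lo ord0 Q)).
pose Ph := piece c (obox (hi ord0 Q)).
have mPi Q' : measurable (piece c (obox Q') : set (borel M)).
  by apply: measurable_piece; exact: open_obox.
have PlP : Pl `<=` P by move=> r [cr /(loP _ (nQ ord0))[]].
have PhP : Ph `<=` P by move=> r [cr /(hiP _ (nQ ord0))[]].
have PlU : Pl `<=` U.
  apply: piece_sub => x /(loP _ (nQ ord0))[Qx]; rewrite mid0 => h.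
  by apply: off => //; rewrite lt_eqF.
have PhU : Ph `<=` U.
  apply: piece_sub => x /(hiP _ (nQ ord0))[Qx]; rewrite mid0 => h.
  by apply: off => //; rewrite gt_eqF.
have mPU : measurable (P `&` U : set (borel M)) by exact: (measurableI _ _ (mPi Q) mU).
exists P; split => //; first by apply: open_piece; exact: open_obox.
pose Z := (P `&` U) `\` (Pl `|` Ph).
have mZ : measurable (Z : set (borel M)).
  exact: (measurableD mPU (measurableU _ _ (mPi (lo ord0 Q)) (mPi (hi ord0 Q)))).
have ZU : Z `<=` U by move=> r [[]].
(* The measure [At] is known only through charts, so Z is carried to coordinates, where it lies in a
   hyperplane. Its image is measurable, being the part of that hyperplane inside the box and inside
   the image of [U]. *)
have Z0 : At Z = 0%E.
  have Z_c r : Z r -> cmap c r ord0 ord0 = 0.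
    move=> [[[cr Qr] Ur] nr]; apply/eqP; apply: contrapT => h; apply: nr.
    have [h1|h1|h1] := ltgtP (cmap c r ord0 ord0) 0; last by case: h; rewrite ?h1 ?eqxx.
      by left; split => //; apply/(loP _ (nQ ord0)); rewrite mid0.
    by right; split => //; apply/(hiP _ (nQ ord0)); rewrite mid0.
  have Zc : Z `<=` cdom c `&` U by move=> r [[[cr _] Ur] _].
  have mcZ : measurable (cmap c @` Z).
    rewrite (_ : cmap c @` Z = obox Q `&` [set x | x ord0 ord0 = 0] `&` cimg c U); last first.
      apply/seteqP; split => x.
        move=> [r Zr <-]; have [[[cr Qr] Ur] _] := Zr; split; last by exists r.
        by split => //; exact: Z_c.
      move=> [[Qx x0] [r [cr Ur] rx]]; exists r => //; split.
        by split => //; split => //=; rewrite rx.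
      move=> [] []; rewrite /= rx => _.
        by move=> /(loP _ (nQ ord0))[_]; rewrite mid0 x0 ltxx.
      by move=> /(hiP _ (nQ ord0))[_]; rewrite mid0 x0 ltxx.
    apply: measurableI; last by apply: open_measurable_rV; exact: open_cimg.
    by apply: measurableI; [exact: measurable_obox|exact: measurable_hyperplane].
  rewrite (proj2 AtU c Z ac mZ Zc); apply: null_set_integral => //.
  - apply/measurable_EFinP; apply: (@measurable_funS _ _ _ _ (cimg c U)).
    + by apply: open_measurable_rV; exact: open_cimg.
    + by move=> x [r /Zc[cr Ur] <-]; exists r.
    + have ocU : open (cimg c U) by exact: open_cimg.
      exact: (measurable_vol_density gtU ac ocU (@subset_refl _ _)).
  - apply: (subset_measure0 mcZ (@measurable_hyperplane _ _ ord0 0)).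
      by move=> x [r Zr <-]; exact: Z_c.
    exact: lebesgue_rV_hyperplane.
have -> : P `&` U = Pl `|` (Ph `|` Z).
  apply/seteqP; split => r.
    move=> PUr; have [h|h] := pselect ((Pl `|` Ph) r); last by right; right.
    by case: h => h; [left|right; left].
  move=> [h|[h|[h _] //]]; split; [exact: PlP|exact: PlU|exact: PhP|exact: PhU].
apply: (ultra_cauchy_onU FU mU mu_u) => //.
- exact: mPi.
- exact: (measurableU _ _ (mPi (hi ord0 Q)) mZ).
- by rewrite !subUset.
- apply: (ultra_cauchy_onU FU mU mu_u) => //; first exact: mPi.
    by rewrite subUset.
  exact: (ultra_cauchy_on_null FU mU mu_u).
Qed.

End points.

(** * Extraction of a convergent subsequence *)

(** Each finite intersection of the sets [A i] belongs to [F], hence meets every tail of the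
    integers; choosing in turn a larger index in the next intersection gives the subsequence. *)
Lemma ultra_subsequence (F : set_system nat) (A : nat -> set nat) : ProperFilter F ->
  (forall P : set nat, (\forall n \near \oo, P n) -> F P) -> (forall j, F (A j)) ->
  exists s : nat -> nat, {homo s : i j / (i < j)%N} /\ forall j l, (j <= l)%N -> A j (s l).
Proof.
move=> FP Foo FA; pose B j n := forall i, (i <= j)%N -> A i n.
have FB j : F (B j).
  elim: j => [|j IH].
    by apply: filterS (FA 0) => n An i; rewrite leqn0 => /eqP ->.
  apply: filterS2 IH (FA j.+1) => n Bn An i; rewrite leq_eqVlt => /predU1P[->//|].
  exact: Bn.
have /choice[h Hh] : forall ja : nat * nat, exists n, B ja.1 n /\ (ja.2 < n)%N.
  move=> [j a]; have Fa : F [set n | (a < n)%N] by apply: Foo; exists a.+1.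
  exact: filter_ex (filterI (FB j) Fa).
pose s := fix s j := if j is j'.+1 then h (j, s j') else h (0, 0).
exists s; split.
  by apply: homo_ltn => [x y z|i]; [exact: ltn_trans|exact: (Hh (i.+1, s i)).2].
move=> j [|l] jl; first exact: (Hh (0, 0)).1.
exact: (Hh (l.+1, s l)).1.
Qed.

Section L2_completeness.
Context d (T : measurableType d) (R : realType) (mu : {measure set T -> \bar R}).
Variables (U : set T) (u : nat -> T -> R).
Hypotheses (mU : measurable U) (mu_u : forall n, measurable_fun U (u n)).
Hypothesis uC : forall k l, (k <= l)%N ->
  (\int[mu]_(x in U) ((u k x - u l x) ^+ 2)%:E <= ((4^-1) ^+ k)%:E)%E.

(** The weights h^-t = 2^t against integrals of order 4^-t leave the summable 2^-t. *)
Let h : R := 2^-1.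
Let h0 : 0 < h. Proof. by rewrite invr_gt0. Qed.
Let h1 : h < 1. Proof. by rewrite invf_lt1// ltr1n. Qed.
Let hV t : 0 <= h ^- t. Proof. by rewrite invr_ge0 exprn_ge0// ltW. Qed.

Let g x : \bar R := (\sum_(0 <= t <oo) (h ^- t * (u t.+1 x - u t x) ^+ 2)%:E)%E.

Let g_term_ge0 t x : (0 <= (h ^- t * (u t.+1 x - u t x) ^+ 2)%:E)%E.
Proof. by rewrite lee_fin mulr_ge0 ?sqr_ge0 ?hV. Qed.

Let m_term t : measurable_fun U (fun x => (h ^- t * (u t.+1 x - u t x) ^+ 2)%:E).
Proof.
apply/measurable_EFinP; apply: measurable_funM => //; apply: measurable_funX.
exact: measurable_funB.
Qed.

Let g0 x : (0 <= g x)%E.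
Proof. exact: nneseries_ge0. Qed.

Let mg : measurable_fun U g.
Proof. exact: ge0_emeasurable_sum. Qed.

Let ig : mu.-integrable U g.
Proof.
apply/integrableP; split => //.
under eq_integral do rewrite gee0_abs//.
rewrite integral_nneseries//.
apply: (@le_lt_trans _ _ (\sum_(0 <= t <oo) (h ^+ t)%:E)%E).
  apply: lee_nneseries => [t _ _|t _]; first exact: integral_ge0.
  under eq_integral do rewrite EFinM.
  rewrite ge0_integralZl//; last 3 first.
  - apply/measurable_EFinP; apply: measurable_funX; exact: measurable_funB.
  - by move=> x _; rewrite lee_fin sqr_ge0.
  - by rewrite lee_fin.
  apply: (@le_trans _ _ ((h ^- t)%:E * ((4^-1) ^+ t)%:E)%E).
    apply: lee_wpmul2l; first by rewrite lee_fin.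
    apply: le_trans (uC (leqnSn t)); apply: eqW.
    by apply: eq_integral => x _; rewrite -sqrrN opprB.
  rewrite -EFinM lee_fin; apply: eqW.
  rewrite (_ : 4^-1 = h * h :> R); last by rewrite /h; field.
  by rewrite exprMn mulrA mulVf ?mul1r// expf_neq0// gt_eqF.
apply: (@le_lt_trans _ _ (1 / (1 - h))%:E); last exact: ltry.
apply: lime_le.
  by apply: is_cvg_nneseries => t _ _; rewrite lee_fin exprn_ge0// ltW.
apply: nearW => n; rewrite sumEFin lee_fin.
by have := geom_sum_le h0 h1 (leq0n n); rewrite expr0.
Qed.

Let v x := fine (limn_esup (fun n => (u n x)%:E)).

Let u_cvg x : g x \is a fin_num -> u n x @[n --> \oo] --> v x.
Proof. by move=> gx; exact: (summable_steps_cvg h0 h1 gx). Qed.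

Let mv : measurable_fun U v.
Proof.
apply: (measurableT_comp (@fine_measurable R setT measurableT)).
by apply: measurable_fun_limn_esup => n; exact/measurable_EFinP.
Qed.

(** The weighted series of squared increments has finite integral, so it is finite almost everywhere
    and forces pointwise convergence; Fatou's lemma then passes the Cauchy estimate to the limit. *)
Lemma L2_limit : exists2 v : T -> R, measurable_fun U v &
  forall k, (\int[mu]_(x in U) ((u k x - v x) ^+ 2)%:E <= ((4^-1) ^+ k)%:E)%E.
Proof.
exists v => // k.
pose F N x := ((u k x - u N x) ^+ 2)%:E.
have mF N : measurable_fun U (F N).
  by apply/measurable_EFinP; apply: measurable_funX; exact: measurable_funB.
have F0 N x : U x -> (0 <= F N x)%E by move=> _; rewrite lee_fin sqr_ge0.
rewrite (@ae_eq_integral _ _ _ mu _ (fun x => limn_einf (F ^~ x)))//; last 3 first.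
- by apply/measurable_EFinP; apply: measurable_funX; exact: measurable_funB.
- apply: (measurableT_comp (@oppe_measurable R setT)).
  by apply: measurable_fun_limn_esup => n; exact: measurableT_comp.
- apply: filterS (integrable_ae mU ig) => x gx Ux; apply/esym.
  have ux := u_cvg (gx Ux).
  apply: (cvg_limn_einf_sup _).1; apply: cvg_EFin; first exact: nearW.
  rewrite expr2 (_ : _ \o _ = fun N => (u k x - u N x) * (u k x - u N x)); last first.
    by apply/funext => N; rewrite /F /= expr2.
  by apply: cvgM; apply: cvgB; [exact: cvg_cst|exact: ux|exact: cvg_cst|exact: ux].
apply: (le_trans (fatou mu mU mF F0)).
rewrite limn_einf_lim; apply: lime_le; first exact: is_cvg_einfs.
apply: nearW => n; apply: ereal_inf_le; exists (\int[mu]_(x in U) F (maxn n k) x)%E.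
  by exists (maxn n k) => //=; exact: leq_maxl.
by apply: uC; exact: leq_maxr.
Qed.

End L2_completeness.

(** Since f / c0 >= 1, its powers k - 2 and k are at least 1. The exponent k - 2 is where
    codimension at least two enters the comparison of f^2 with f^k. *)
Lemma power_domination (R : realType) (T : Type) (U : set T) (f : T -> R) (c0 : R) (k : nat) :
  (2 <= k)%N -> 0 < c0 -> (forall x, U x -> c0 <= f x) ->
  exists2 C, 0 <= C & forall x, U x ->
    f x ^+ 2 <= C * `|f x| ^+ k /\ 1 <= C * `|f x| ^+ k.
Proof.
move=> k2 c00 fc.
have Ck0 j : 0 <= c0 ^- j by rewrite invr_ge0 exprn_ge0// ltW.
exists (c0 ^- (k - 2) + c0 ^- k); first exact: addr_ge0.
move=> x Ux; have fx := fc x Ux; have fx0 : 0 < f x by exact: lt_le_trans fx.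
rewrite (ger0_norm (ltW fx0)) mulrDl.
have pow j : 1 <= c0 ^- j * f x ^+ j.
  by rewrite mulrC ler_pdivlMr ?exprn_gt0// mul1r lerXn2r// nnegrE ltW.
have fk0 : 0 <= f x ^+ k by rewrite exprn_ge0// ltW.
split; last by apply: ler_wpDl; [exact: mulr_ge0|exact: pow].
apply: ler_wpDr; first exact: mulr_ge0.
rewrite -{2}(subnK k2) exprD mulrA -{1}[f x ^+ 2]mul1r.
by apply: ler_wpM2r; [exact: sqr_ge0|exact: pow].
Qed.

Section W12_bounds.
Context {R : realType} {M : ptopologicalType} {m : nat}.
Variables (S : smooth_structure R M m) (U : set M) (g : M -> 'M[R]_m).
Variable (mu : {measure set (borel M) -> \bar R}).
Hypothesis gU : riemannian_metric S U g.

Lemma W12_weak_gradient u : W12 S U mu g u ->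
  is_weak_gradient S U g u (weak_gradient S U g u).
Proof.
by move=> [_ [X HX] _]; exact: (@xgetPex _ (fun=> 0) [set X | is_weak_gradient S U g u X] (ex_intro _ X HX)).
Qed.

Let energy_ge0 u : (0 <= gradient_energy S U mu g u)%E.
Proof.
apply: integral_ge0 => p Up; rewrite lee_fin; apply: posdefmx_ge0.
exact: (proj1 gU).
Qed.

Let sqr_ge0' u : (0 <= \int[mu]_(p in U : set (borel M)) (u p ^+ 2)%:E)%E.
Proof. by apply: integral_ge0 => p _; rewrite lee_fin sqr_ge0. Qed.

Lemma W12_norm_bound u C : (W12_norm S U mu g u <= C%:E)%E ->
  (\int[mu]_(p in U : set (borel M)) (u p ^+ 2)%:E <= (C ^+ 2)%:E)%E /\
  (gradient_energy S U mu g u <= (C ^+ 2)%:E)%E.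
Proof.
rewrite /W12_norm; set I := integral _ _ _; set E := gradient_energy _ _ _ _ _.
have I0 : (0 <= I)%E := sqr_ge0' u; have E0 : (0 <= E)%E := energy_ge0 u.
move=> IE; suff : (I + E <= (C ^+ 2)%:E)%E.
  by move=> H; split; apply: le_trans H; [rewrite leeDl|rewrite leeDr].
have IE0 : (0 <= I + E)%E by exact: adde_ge0.
rewrite -[leLHS]poweRe1// -(@mulVf _ 2)// poweRrM.
have : (I + E \is a fin_num)%E.
  rewrite ge0_fin_numE//; apply: (@lty_poweRy _ _ 2^-1); first by rewrite invr_eq0.
  exact: le_lt_trans IE (ltry _).
move: IE IE0; case: (I + E)%E => [r| |]// + r0 _; rewrite lee_fin in r0.
rewrite !poweR_EFin !lee_fin => rC.
rewrite powR_mulrn ?powR_ge0//; apply: lerXn2r; rewrite ?nnegrE ?powR_ge0//.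
exact: le_trans (powR_ge0 _ _) rC.
Qed.

End W12_bounds.

Theorem theorem1p1 (R : realType) (M : ptopologicalType) (m n : nat)
    (S : smooth_structure R M m)
    (M_compact : compact [set: M]) (M_hausdorff : hausdorff_space M)
    (g : M -> 'M[R]_m) (g_riem : riemannian_metric S setT g)
    (N : set M) (N_compact : compact N) (N_sub : submanifold S n N)
    (hmn : (n + 2 <= m)%N)
    (D : set (chart R M m)) (D_diag : diagonalizes S n N g D)
    (gt : M -> 'M[R]_m) (gt_riem : riemannian_metric S (~` N) gt)
    (f : M -> R) (f_smooth : smooth_fun S (~` N) f)
    (gt_near_N : exists2 V : set M, open V /\ N `<=` V &
      forall c p, D c -> cdom c p -> V p -> ~ N p ->
        metric_coord S gt c p =
        scale_block (m - n)%N (f p ^+ 2) (metric_coord S g c p))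
    (A : {measure set (borel M) -> \bar R})
    (A_vol : riemannian_measure S setT g A)
    (At : {measure set (borel M) -> \bar R})
    (At_vol : riemannian_measure S (~` N) gt At)
    (f_m2 : m = 2%N -> exists2 eps : R, 0 < eps & Lp (~` N) A (2 + eps) f)
    (f_m3 : (3 <= m)%N ->
      (0 < ereal_inf [set (f p)%:E | p in ~` N])%E /\
      exists2 eps : R, 0 < eps &
        Lp (~` N) A ((m * (m - n))%N%:R / 2 + eps) f) :
  compactly_included (W12 S (~` N) At gt) (W12_norm S (~` N) At gt)
                     (Lp (~` N) At 2) (Lp_norm (~` N) At 2).
Proof.
split=> [u [//]|u C uW uC].
destruct m as [|m]; first by rewrite addn2 in hmn.
have oU : open (~` N).
  by rewrite openC; exact: compact_closed.
have mU : measurable (~` N : set (borel M)) := measurable_open_borel oU.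
have k2 : (2 <= m.+1 - n)%N by lia.
(* For m = 2 the codimension is also 2, and k m / 2 equals 2; so both integrability hypotheses on
   [f] are instances of q > k m / 2. *)
have [q kq fLp] : exists2 q : R, (m.+1 - n)%:R * (m.+1%:R / 2) < q & Lp (~` N) A q f.
  have [m3|m3] := leqP 3 m.+1.
    have [_ [eps e0 Lf]] := f_m3 m3; exists ((m.+1 * (m.+1 - n))%N%:R / 2 + eps) => //.
    by rewrite natrM; lra.
  have m2 : m.+1 = 2%N by lia.
  have [eps e0 Lf] := f_m2 m2; exists (2 + eps) => //.
  have -> : (m.+1 - n = 2)%N by lia.
  by rewrite m2; lra.
(* For m = 2 one takes C1 = 1: f^2 = |f|^k, and the second inequality is vacuous because k = m. *)
have [C1 C10 fC] : exists2 C1, 0 <= C1 & forall p, (~` N) p ->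
    f p ^+ 2 <= C1 * `|f p| ^+ (m.+1 - n) /\ ((m.+1 - n < m.+1)%N -> 1 <= C1 * `|f p| ^+ (m.+1 - n)).
  have [m3|m3] := leqP 3 m.+1.
    have [inf0 _] := f_m3 m3.
    have [c0 c00 fc] : exists2 c0 : R, 0 < c0 & forall p, (~` N) p -> c0 <= f p.
      have lb p : (~` N) p -> (ereal_inf [set (f p)%:E | p in ~` N] <= (f p)%:E)%E.
        by move=> Np; apply: ereal_inf_lbound; exists p.
      (* An infinite infimum means that the complement of N is empty, and then any positive constant
         is a lower bound. *)
      move: inf0 lb; case: (ereal_inf _) => [c| |]//; last first.
        by move=> _ lb; exists 1 => // p /lb; rewrite leye_eq.
      by rewrite lte_fin => c0 lb; exists c => // p /lb; rewrite lee_fin.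
    have [C1 C10 H] := power_domination k2 c00 fc; exists C1 => // p Np.
    by have [? ?] := H p Np.
  have m2 : m.+1 = 2%N by lia.
  exists 1 => // p _; have -> : (m.+1 - n = 2)%N by lia.
  by rewrite mul1r real_normK ?num_real//; split => //; rewrite m2.
have [V0 [oV0 NV0] gtE] := gt_near_N.
have wX k := W12_weak_gradient (uW k).
have bnd k := W12_norm_bound gt_riem (uC k).
have uL k : Lp (~` N) At 2 (u k) by have [] := uW k.
have mu_u k : measurable_fun (~` N : set (borel M)) (u k).
  by have [] := proj1 (LpP At mU (ltr0Sn R 1) (u k)) (uL k).
(* The ultrafilter refines the filter of tails, so its members contain arbitrarily large indices, as
   the extraction of a subsequence requires. *)
have [F [FU Foo]] := ultraFilterLemma (@eventually_filter).
have FP : ProperFilter F by exact: ultra_proper.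
have UC : @ultra_cauchy_on _ (borel M) R At F u (~` N).
  apply: (@compact_ultra_cauchy_on _ (borel M) R At F u (~` N) FU mU mu_u M id M_compact) => p.
  have uD k := (bnd k).1; have XD k := (bnd k).2.
  have [Np|Up] := pselect (N p); last first.
    exact: (regular_point oU gt_riem At_vol mu_u wX uD XD FU Up).
  have m1 : (1 < m.+1)%N by lia.
  exact: (singular_point oU gt_riem At_vol m1 mu_u wX uD XD FU erefl hmn D_diag g_riem A_vol
    oV0 NV0 gtE kq fLp C10 (fun p Up => (fC p Up).1) (fun km p Up => (fC p Up).2 km) Np).
have e4 j : 0 < (4^-1 : R) ^+ j by rewrite exprn_gt0.
have /choice[E HE] : forall j, exists E, F E /\ forall k l, E k -> E l ->
    (\int[At]_(x in ~` N : set (borel M)) ((u k x - u l x) ^+ 2)%:E <= ((4^-1) ^+ j)%:E)%E.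
  by move=> j; exact: UC (e4 j).
have [s [s_incr sE]] := ultra_subsequence FP Foo (fun j => (HE j).1).
have sC k l : (k <= l)%N -> (\int[At]_(x in ~` N : set (borel M))
    ((u (s k) x - u (s l) x) ^+ 2)%:E <= ((4^-1) ^+ k)%:E)%E.
  by move=> kl; apply: (HE k).2; exact: sE.
have [v mv uv] := L2_limit mU (fun k => mu_u (s k)) sC.
have two0 : 0 < 2 :> R by [].
have sqrE (w : M -> R) : (\int[At]_(x in ~` N : set (borel M)) (`|w x| `^ 2)%:E =
    \int[At]_(x in ~` N : set (borel M)) (w x ^+ 2)%:E)%E.
  by apply: eq_integral => x _; rewrite powR2_norm.
exists s; split => //; exists v.
  apply/(LpP At mU two0); split => //; rewrite sqrE.
  have mB : measurable_fun (~` N : set (borel M)) (fun x => v x - u (s 0) x).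
    exact: measurable_funB.
  apply: (@le_lt_trans _ _ (\int[At]_(x in ~` N : set (borel M))
    (2 * (u (s 0) x) ^+ 2 + 2 * (u (s 0) x - v x) ^+ 2)%:E)%E).
    apply: ge0_le_integral => //.
    - by move=> x _; rewrite lee_fin sqr_ge0.
    - by apply/measurable_EFinP; exact: measurable_funX.
    - apply/measurable_EFinP; apply: measurable_funD; apply: measurable_funM => //;
        apply: measurable_funX => //; exact: measurable_funB.
    - move=> x _; rewrite lee_fin -[(u (s 0) x - v x) ^+ 2]sqrrN opprB.
      by have := sqrB_le_2D (u (s 0) x) (v x - u (s 0) x); rewrite addrC subrK.
  rewrite integral_2D//; last 4 first.
  - by apply: measurable_funX.
  - by apply: measurable_funX; exact: measurable_funB.
  - by move=> x; rewrite sqr_ge0.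
  - by move=> x; rewrite sqr_ge0.
  rewrite lte_add_pinfty// lte_mul_pinfty//.
    by rewrite (le_lt_trans (bnd (s 0)).1)// ltry.
  by rewrite (le_lt_trans (uv 0))// ltry.
(* The squared distance to the limit is at most 4^-k, so the norm is at most 2^-k. *)
apply: (@squeeze_cvge _ _ _ _ (cst 0%E) _ (fun k => ((2^-1 : R) ^+ k)%:E)).
- apply: nearW => k; rewrite Lnorm_ge0/= (Lp_normE (~` N) At two0) sqrE.
  have -> : ((2^-1 : R) ^+ k)%:E = ((((4^-1 : R) ^+ k)%:E) `^ 2^-1)%E.
    rewrite poweR_EFin powR12_sqrt ?exprn_ge0//.
    rewrite (_ : 4^-1 = 2^-1 ^+ 2 :> R); last by field.
    by rewrite exprAC sqrtr_sqr ger0_norm// exprn_ge0.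
  apply: gt0_ler_poweR; first by rewrite invr_ge0.
  + rewrite in_itv/= leey andbT.
    by apply: integral_ge0 => x _; rewrite lee_fin sqr_ge0.
  + by rewrite in_itv/= leey andbT lee_fin exprn_ge0.
  + exact: uv.
- exact: cvg_cst.
- by apply: cvg_EFin; [exact: nearW|apply: cvg_expr; rewrite ger0_norm// invf_lt1// ltr1n].
Qed.
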